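(* Let $q$ be a power of $2$. Then $T_7$ maps $W5(q)$ into itself, and the kernel of $T_7:W5(q)\to W5(q)$ is $DI(q)$.
   Context: For an odd prime $p$, $T_p:\mathbb{Z}/2[[x]]\to\mathbb{Z}/2[[x]]$ is the map $\sum c_nx^n\mapsto\sum c_{pn}x^n+\sum c_nx^{pn}$. Let $D=\sum_{n>0,\ \gcd(n,6)=1}x^{n^2}\in\mathbb{Z}/2[[x]]$. $W5(q)$ is the $\mathbb{Z}/2$-span of the $D^n$ with $n>0$, $n\equiv5\pmod6$ and $n<12q^2$. Let $p_{3,2}:\mathbb{Z}/2[[x]]\to\mathbb{Z}/2[[x]]$ send $\sum c_nx^n$ to $\sum_{n\equiv2\ (3)}c_nx^n$. Every ideal of $\mathbb{Z}[i]$ of odd norm has a generator $a+2bi$ with $a$ odd, unique up to sign. Two such ideals $(\alpha),(\beta)$ (generators of this form) are Gauss-equivalent if there is an integer $N$ with $N\alpha\equiv\beta\pmod{4q\mathbb{Z}[i]}$; the equivalence classes are Gauss-classes. $\mathit{AMB}$ denotes the Gauss-class consisting of the ideals $(a+2bqi)$ with $a,b$ odd. For a Gauss-class $R$, $\theta(R)=\sum_{I\in R}x^{\mathrm{norm}(I)}\in\mathbb{Z}[[x]]$; $\theta(\mathit{AMB})\in2\mathbb{Z}[[x]]$. $DI(q)$ is the image under $p_{3,2}$ of the $\mathbb{Z}/2$-span of the mod $2$ reductions of all $\theta(R)$ ($R$ a Gauss-class) and of $\tfrac12\theta(\mathit{AMB})$. *)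

(* Defs.v *)
From HB Require Import structures.
From mathcomp Require Import all_boot all_order all_algebra.
From mathcomp Require Import finmap.
From mathcomp Require Import mathcomp_extra boolp classical_sets functions.
From mathcomp Require Import cardinality fsbigop.
From mathcomp Require Import ring.

Set Implicit Arguments.
Unset Strict Implicit.
Unset Printing Implicit Defensive.

Import GRing.Theory.

Local Open Scope classical_set_scope.
Local Open Scope ring_scope.

(* A power series is the sequence of its coefficients.  The alias [fps R] gets
   the Cauchy product, unlike the bare function type [nat -> R], whose ring
   structure is pointwise. *)
Definition fps (R : comNzRingType) : Type := nat -> R.

HB.instance Definition _ (R : comNzRingType) :=
  GRing.Zmodule.copy (fps R) (nat -> R).

Section Scaling.
Variable R : comNzRingType.
Implicit Types (c : R) (f : fps R).

Definition fps_scale c f : fps R := fun n => c * f n.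

Lemma fps_scaleA c d f : fps_scale c (fps_scale d f) = fps_scale (c * d) f.
Proof. by apply/funext => n; rewrite /fps_scale mulrA. Qed.

Lemma fps_scale1 : left_id 1 fps_scale.
Proof. by move=> f; apply/funext => n; rewrite /fps_scale mul1r. Qed.

Lemma fps_scaleDr : right_distributive fps_scale +%R.
Proof. by move=> c f g; apply/funext => n; exact: mulrDr. Qed.

Lemma fps_scaleDl f : {morph fps_scale^~ f : c d / c + d}.
Proof. by move=> c d; apply/funext => n; exact: mulrDl. Qed.

End Scaling.

HB.instance Definition _ (R : comNzRingType) :=
  GRing.Zmodule_isLmodule.Build R (fps R)
    (@fps_scaleA R) (@fps_scale1 R) (@fps_scaleDr R) (@fps_scaleDl R).

Section CauchyProduct.
Variable R : comNzRingType.
Implicit Types f g h : fps R.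

Definition fps_one : fps R := fun n => (n == 0)%:R.

Definition fps_mul f g : fps R := fun n => \sum_(i < n.+1) f i * g (n - i)%N.

Lemma fps_mul_rev f g n : fps_mul f g n = \sum_(i < n.+1) f (n - i)%N * g i.
Proof.
rewrite /fps_mul (reindex_inj rev_ord_inj) /=.
by apply: eq_bigr => i _; rewrite subSS subKn // -ltnS.
Qed.

Lemma fps_mulC : commutative fps_mul.
Proof.
move=> f g; apply/funext => n; rewrite fps_mul_rev.
by apply: eq_bigr => i _; rewrite mulrC.
Qed.

Lemma fps_mulA : associative fps_mul.
Proof.
move=> f g h; apply/funext => n; rewrite [RHS]fps_mul_rev.
pose c3 j k : R := f j * (g (n - j - k)%N * h k).
transitivity (\sum_(j < n.+1) \sum_(k < n.+1 | (k <= n - j)%N) c3 j k).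
  apply: eq_bigr => /= j _; rewrite fps_mul_rev big_distrr /=.
  by rewrite (big_ord_narrow_leq (leq_subr _ _)).
rewrite (exchange_big_dep predT) //=; apply: eq_bigr => k _.
transitivity (\sum_(j < n.+1 | (j <= n - k)%N) c3 j k).
  apply: eq_bigl => j; rewrite -ltnS -(ltnS j) -!subSn ?leq_ord //.
  by rewrite -subn_gt0 -(subn_gt0 j) -!subnDA addnC.
rewrite (big_ord_narrow_leq (leq_subr _ _)) /fps_mul big_distrl /=.
by apply: eq_bigr => j _; rewrite /c3 mulrA -!subnDA addnC.
Qed.

Lemma fps_mul1 : left_id fps_one fps_mul.
Proof.
move=> f; apply/funext => n; rewrite /fps_mul big_ord_recl /= subn0 mul1r.
by rewrite big1 ?addr0 // => i _; rewrite /fps_one /= mul0r.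
Qed.

Lemma fps_mulDl : left_distributive fps_mul +%R.
Proof.
move=> f g h; apply/funext => n.
transitivity (\sum_(i < n.+1) (f i * h (n - i)%N + g i * h (n - i)%N)).
  by apply: eq_bigr => i _; exact: mulrDl.
exact: big_split.
Qed.

Lemma fps_one_neq0 : fps_one != 0.
Proof. by apply/eqP => /(congr1 (@^~ 0%N)) /eqP; rewrite oner_eq0. Qed.

End CauchyProduct.

HB.instance Definition _ (R : comNzRingType) :=
  GRing.Zmodule_isComNzRing.Build (fps R)
    (@fps_mulA R) (@fps_mulC R) (@fps_mul1 R) (@fps_mulDl R) (@fps_one_neq0 R).

(* The series \sum_(t \in A) x^(e t).  Each coefficient is a sum with finite
   support as long as [e] has finite fibers on [A] (otherwise the library's
   [\sum_(_ \in _)] returns the junk value 0). *)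
Definition xsum (R : comNzRingType) (T : choiceType) (A : set T) (e : T -> nat)
  : fps R := fun m => \sum_(t \in A) ((e t == m)%:R : R).

Definition red2 (f : fps int) : fps 'F_2 := fun n => (f n)%:~R.

Definition span (K : nzRingType) (V : lmodType K) (S : set V) : set V :=
  [set v | exists (n : nat) (c : 'I_n -> K) (u : 'I_n -> V),
     (forall i, S (u i)) /\ v = \sum_i c i *: u i].

Definition hecke (p : nat) (f : fps 'F_2) : fps 'F_2 :=
  fun n => f (p * n)%N + (if (p %| n)%N then f (n %/ p)%N else 0).

Definition D : fps 'F_2 :=
  xsum 'F_2 [set n : nat | (0 < n)%N && (gcdn n 6 == 1%N)] (fun n => (n ^ 2)%N).

Definition W5 (q : nat) : set (fps 'F_2) :=
  span [set D ^+ n | n in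
    [set n : nat | [&& (0 < n)%N, (n == 5 %[mod 6])%N & (n < 12 * q ^ 2)%N]]].

Definition p32 (f : fps 'F_2) : fps 'F_2 :=
  fun n => if (n == 2 %[mod 3])%N then f n else 0.

(* [GaussInt a b] is a + bi. *)
Record gaussInt := GaussInt { gre : int; gim : int }.

Definition gauss_pair (z : gaussInt) := (gre z, gim z).
Definition gauss_of_pair (u : int * int) := GaussInt u.1 u.2.
Lemma gauss_pairK : cancel gauss_pair gauss_of_pair.
Proof. by case. Qed.

HB.instance Definition _ := Choice.copy gaussInt (can_type gauss_pairK).

Definition gauss_add (z w : gaussInt) :=
  GaussInt (gre z + gre w) (gim z + gim w).
Definition gauss_opp (z : gaussInt) := GaussInt (- gre z) (- gim z).
Definition gauss_mul (z w : gaussInt) :=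
  GaussInt (gre z * gre w - gim z * gim w) (gre z * gim w + gim z * gre w).

Lemma gauss_addA : associative gauss_add.
Proof. by move=> [a b] [c d] [e f]; rewrite /gauss_add /= !addrA. Qed.
Lemma gauss_addC : commutative gauss_add.
Proof.
by move=> [a b] [c d]; rewrite /gauss_add /= (addrC a) (addrC b).
Qed.
Lemma gauss_add0 : left_id (GaussInt 0 0) gauss_add.
Proof. by move=> [a b]; rewrite /gauss_add /= !add0r. Qed.
Lemma gauss_addN : left_inverse (GaussInt 0 0) gauss_opp gauss_add.
Proof. by move=> [a b]; rewrite /gauss_add /= !addNr. Qed.

HB.instance Definition _ := GRing.isZmodule.Build gaussInt
  gauss_addA gauss_addC gauss_add0 gauss_addN.

Lemma gauss_mulA : associative gauss_mul.
Proof.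
by move=> [a b] [c d] [e f]; rewrite /gauss_mul /=; congr GaussInt; ring.
Qed.
Lemma gauss_mulC : commutative gauss_mul.
Proof. by move=> [a b] [c d]; rewrite /gauss_mul /=; congr GaussInt; ring. Qed.
Lemma gauss_mul1 : left_id (GaussInt 1 0) gauss_mul.
Proof. by move=> [a b]; rewrite /gauss_mul /=; congr GaussInt; ring. Qed.
Lemma gauss_mulDl : left_distributive gauss_mul +%R.
Proof.
by move=> [a b] [c d] [e f]; rewrite /gauss_mul /=; congr GaussInt;
  rewrite /=; ring.
Qed.
Lemma gauss_one_neq0 : GaussInt 1 0 != 0.
Proof. by []. Qed.

HB.instance Definition _ := GRing.Zmodule_isComNzRing.Build gaussInt
  gauss_mulA gauss_mulC gauss_mul1 gauss_mulDl gauss_one_neq0.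

Definition is_ideal (R : comNzRingType) (I : set R) : Prop :=
  [/\ I 0, forall x y, I x -> I y -> I (x + y) & forall a x, I x -> I (a * x)].

Definition principal (R : comNzRingType) (x : R) : set R := range (fun a => a * x).

(* The index of [I]; it is 0 when the quotient by [I] is infinite. *)
Definition ideal_norm (R : comNzRingType) (I : set R) : nat :=
  #|` fset_set (range (fun x : R => [set x + y | y in I])) |.

Definition odd_ideal (I : set gaussInt) : Prop :=
  is_ideal I /\ odd (ideal_norm I).

Definition gauss_equiv (q : nat) (I J : set gaussInt) : Prop :=
  exists a b c d : int,
    let alpha := GaussInt a (2 * b) in
    let beta := GaussInt c (2 * d) in
    [/\ odd `|a|%N, odd `|c|%N, I = principal alpha, J = principal beta
      & exists N : int,
          principal (4 * q%:R : gaussInt) (N%:~R * alpha - beta)].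

Definition gauss_class (q : nat) (C : set (set gaussInt)) : Prop :=
  exists2 I, odd_ideal I & C = [set J | odd_ideal J /\ gauss_equiv q I J].

Definition AMB (q : nat) : set (set gaussInt) :=
  [set I | exists a b : int, [/\ odd `|a|%N, odd `|b|%N
     & I = principal (GaussInt a (2 * b * q%:Z))]].

Definition theta (C : set (set gaussInt)) : fps int :=
  xsum int C (@ideal_norm gaussInt).

(* Z[[x]] has no 2-torsion, so the only [g] with 2 g = theta (AMB q) is
   theta (AMB q) / 2. *)
Definition DI (q : nat) : set (fps 'F_2) :=
  p32 @` span ([set red2 (theta C) | C in gauss_class q]
               `|` [set red2 g | g in [set g : fps int | g *+ 2 = theta (AMB q)]]).

(* Main.v *)
(** Write F = \sum x^(a^2) over a = 1 mod 4, so that D is the part of F with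
    exponents prime to 3.  Counting pairs of squares gives modular equations
    relating F to F(x^3), F(x^5) and F(x^7), hence a linear recurrence for
    n |-> T_7(D^n).  Solving it on n = 5 + 6 M in terms of the base 4 digits
    of M shows that T_7(D^n) has a nonzero leading term unless all the digits
    of M are even, so the kernel of T_7 on W5(q) has dimension at most q.

    On pairs (c, d), standing for the ideal (c + 2di), T_7 kills every theta
    series because 7 is inert, while T_5 and T_13 act on the Gauss-classes by
    multiplication by a prime above 5 or 13.  The powers of T_5 reach every
    class from theta(AMB)/2, and T_5 preserves a degree bound, so DI(q) lies in
    W5(q).  The level 2q series theta(AMB)/2 is sent by T_13^q to the level q
    one, so the series T_13^i (D^(1+4q^2)) with i < q are nonzero and
    independent: they are q elements of DI(q), which exhaust the kernel. *)
Require Import Defs.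
From HB Require Import structures.
From mathcomp Require Import all_boot all_order all_algebra finmap.
From mathcomp Require Import mathcomp_extra boolp classical_sets functions.
From mathcomp Require Import cardinality fsbigop.
From mathcomp Require Import zify ring.

Set Implicit Arguments.
Unset Strict Implicit.
Unset Printing Implicit Defensive.

Import Order.TTheory GRing.Theory Num.Theory.

Local Open Scope classical_set_scope.
Local Open Scope ring_scope.

(** * Series enumerated by a set *)

(** Bounding the kernel: give D^(5+6M) the weight 2a + 3b, with a and b read from the base 4 digits
    of M. Up to monomials of weight at most wt M - 3, T_7 lowers a by 1, which costs weight 2, and
    gives 0 if a = 0. As (a, b) -> (a-1, b) is injective, a kernel element is determined by its
    coordinates at the M with a = 0; there are q of them below 2q^2.

    Filling the kernel: let p = r^2 + 4 and let G_j be the theta series mod 2 of the class of (r -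
    2i)^j (1 + 2qi). Conjugation makes G_0, the series of AMB, vanish, so the chain T_p G_j =
    G_(j+1) + G_(j-1) can only be entered through theta(AMB)/2, which T_p sends to G_1. In
    characteristic 2 this gives T_p^(2^m) (theta(AMB)/2) = G_(2^m). At level 2q and 2^m = q the
    class reached consists of one half of the level q AMB, whence the descent.

    Two primes serve different ends. T_5 exchanges the exponents 1 and 2 mod 3, so both parts must
    be bounded together; its recurrence controls degrees. T_13 commutes with the projection to
    exponents 2 mod 3 and so acts on the kernel itself. *)

Lemma fps_mulE (R : comNzRingType) (f g : fps R) n :
  (f * g) n = \sum_(i < n.+1) f i * g (n - i)%N.
Proof. by []. Qed.

Lemma fps_addE (R : comNzRingType) (f g : fps R) n : (f + g) n = f n + g n.
Proof. by []. Qed.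

Lemma fps_sumE (R : comNzRingType) (I : Type) (r : seq I) (P : pred I)
    (F : I -> fps R) n :
  (\sum_(i <- r | P i) F i) n = \sum_(i <- r | P i) F i n.
Proof. by elim/big_rec2: _ => // i x y _ <-. Qed.

Section XSum.
Variable R : comNzRingType.

(** Sublevel sets instead of fibers: a single finite index set then serves all coefficients up to a
    given degree, as the Cauchy product requires. *)
Definition finite_fibers (T : choiceType) (A : set T) (e : T -> nat) :=
  forall m, finite_set [set t | A t /\ (e t <= m)%N].

Lemma finite_fibers_sub (T : choiceType) (A B : set T) (e : T -> nat) :
  A `<=` B -> finite_fibers B e -> finite_fibers A e.
Proof. by move=> AB Be m; apply: sub_finite_set (Be m) => t [/AB]. Qed.

Lemma xsum_trunc (T : choiceType) (A : set T) (e : T -> nat) n i :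
  (i <= n)%N ->
  xsum R A e i = \sum_(t \in [set t | A t /\ (e t <= n)%N]) ((e t == i)%:R : R).
Proof.
move=> le_in; apply/esym/fsbig_widen => [t []//|t [At /= nt]].
by case: eqP => // eti; case: nt; split=> //; rewrite eti.
Qed.

Lemma xsum0P (T : choiceType) (A : set T) (e : T -> nat) n :
  (forall t, A t -> e t != n) -> xsum R A e n = 0.
Proof. by move=> H; apply: fsbig1 => t /H /negbTE ->. Qed.

Lemma xsum_bij (T U : choiceType) (A : set T) (B : set U) e f
    (h : T -> U) (g : U -> T) :
  (forall t, A t -> [/\ B (h t), g (h t) = t & f (h t) = e t]) ->
  (forall u, B u -> A (g u) /\ h (g u) = u) ->
  xsum R A e = xsum R B f.
Proof.
move=> Ah Bg; apply/funext => m; rewrite /xsum.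
rewrite [RHS](reindex_fsbig h A B).
  by apply: eq_fsbigr => t /set_mem /Ah [_ _ efe]; rewrite -efe.
split=> [t /Ah[]//|t t' /set_mem At /set_mem At' hh|].
  by have [[_ <- _] [_ <- _]] := (Ah _ At, Ah _ At'); rewrite hh.
by move=> u /Bg [Agu hgu]; exists (g u).
Qed.

Lemma eq_xsum (T : choiceType) (A B : set T) (e f : T -> nat) :
  (forall t, A t <-> B t) -> (forall t, A t -> e t = f t) ->
  xsum R A e = xsum R B f.
Proof.
move=> AB ef; apply: (@xsum_bij _ _ A B e f id id) => t At.
  by split=> //; [exact/AB | rewrite ef].
by split=> //; exact/AB.
Qed.

Lemma xsumU (T : choiceType) (A B C : set T) (e : T -> nat) :
  finite_fibers C e -> (forall t, C t <-> A t \/ B t) ->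
  (forall t, A t -> B t -> False) ->
  xsum R C e = xsum R A e + xsum R B e.
Proof.
move=> Cf CAB AB0; apply/funext => m; rewrite fps_addE !(xsum_trunc _ _ (leqnn m)).
rewrite -fsbigU0; last by move=> t [[At _] [Bt _]]; exact: AB0 At Bt.
- apply: eq_fsbigl; apply/seteqP; split=> [t [/CAB [At|Bt] lt]|t].
  + by left.
  + by right.
  by move=> [[At lt]|[Bt lt]]; split=> //; apply/CAB; [left|right].
- by apply: sub_finite_set (Cf m) => t [At]; split=> //; apply/CAB; left.
- by apply: sub_finite_set (Cf m) => t [Bt]; split=> //; apply/CAB; right.
Qed.

Lemma xsum_mul (T U : choiceType) (A : set T) (B : set U) e f :
  finite_fibers A e -> finite_fibers B f ->
  xsum R A e * xsum R B f = xsum R (A `*` B) (fun u => e u.1 + f u.2)%N.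
Proof.
move=> Af Bf; apply/funext => n.
pose A' := [set t | A t /\ (e t <= n)%N]; pose B' := [set t | B t /\ (f t <= n)%N].
have fA : finite_set A' by exact: Af.
have fB : finite_set B' by exact: Bf.
transitivity (\sum_(t \in A') \sum_(u \in B') (((e t + f u)%N == n)%:R : R)).
  rewrite fps_mulE.
  transitivity (\sum_(i < n.+1) (\sum_(t <- fset_set A') \sum_(u <- fset_set B')
      ((e t == i)%:R * (f u == (n - i)%N)%:R : R))).
    apply: eq_bigr => i _.
    rewrite (xsum_trunc A e (n := n)) -1?ltnS // (xsum_trunc B f (leq_subr i n)).
    by rewrite !fsbig_finite // mulr_suml; apply: eq_bigr => t _; rewrite mulr_sumr.
  rewrite exchange_big fsbig_finite //=; apply: eq_big_seq => t.
  rewrite in_fset_set // inE => -[_ let_n].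
  rewrite exchange_big fsbig_finite //=; apply: eq_bigr => u _.
  rewrite (bigD1 (Ordinal (let_n : (e t < n.+1)%N))) //= eqxx mul1r big1.
    by rewrite addr0 -(eqn_add2l (e t)) subnKC.
  by move=> i ne; rewrite -val_eqE /= in ne; rewrite eq_sym (negbTE ne) mul0r.
rewrite pair_fsbig //; apply: fsbig_widen => [[t u] /= [[At _] [Bu _]]//|].
move=> [t u] [[/= At Bu] nt] /=; case: eqP => // eqn; case: nt.
by split; split=> //=; rewrite -eqn ?leq_addl ?leq_addr.
Qed.

End XSum.

(** * Operators on power series mod 2 *)

Notation series := (fps 'F_2).

Lemma F2_sqr (x : 'F_2) : x * x = x.
Proof. by case: x => [[|[|]]] // ?; apply/val_inj. Qed.

Lemma F2_addxx (x : 'F_2) : x + x = 0.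
Proof. by case: x => [[|[|]]] // ?; apply/val_inj. Qed.

Lemma addss (f : series) : f + f = 0.
Proof. by apply/funext => n; exact: F2_addxx. Qed.

Lemma opps (f : series) : - f = f.
Proof. by apply/eqP; rewrite -subr_eq0 -opprD addss oppr0. Qed.

Lemma addsK (f g : series) : f + (f + g) = g.
Proof. by rewrite addrA addss add0r. Qed.

Lemma adds_eq0 (f g : series) : f + g = 0 <-> f = g.
Proof. by split=> [/eqP|->]; rewrite ?addss // addr_eq0 opps => /eqP. Qed.

Lemma pchar_series : 2 \in [pchar series].
Proof. by rewrite inE /=; apply/eqP; rewrite mulr2n addss. Qed.

Lemma exprDpow2 (f g : series) k : (f + g) ^+ (2 ^ k) = f ^+ (2 ^ k) + g ^+ (2 ^ k).
Proof.
by apply: exprDn_pchar; rewrite pnatX; apply/orP; left;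
  rewrite pnatE // pchar_series.
Qed.

Definition dilate m (f : series) : series :=
  fun n => if (m %| n)%N then f (n %/ m)%N else 0.

Definition contract m (f : series) : series := fun n => f (m * n)%N.

Definition res m r (f : series) : series :=
  fun n => if n == r %[mod m] then f n else 0.

Lemma heckeE p f : hecke p f = contract p f + dilate p f.
Proof. by []. Qed.

Lemma dilateD m : {morph dilate m : f g / f + g}.
Proof.
move=> f g; apply/funext => n; rewrite fps_addE /dilate.
by case: ifP => _; rewrite ?addr0.
Qed.

Lemma contractD m : {morph contract m : f g / f + g}.
Proof. by []. Qed.

Lemma resD m r : {morph res m r : f g / f + g}.
Proof.
move=> f g; apply/funext => n; rewrite fps_addE /res.
by case: ifP => _; rewrite ?addr0.
Qed.

Lemma heckeD p : {morph hecke p : f g / f + g}.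
Proof. by move=> f g; rewrite !heckeE contractD dilateD addrACA. Qed.

Lemma dilate0 m : dilate m 0 = 0.
Proof. by apply/funext => n; rewrite /dilate; case: ifP. Qed.

Lemma res0 m r : res m r 0 = 0.
Proof. by apply/funext => n; rewrite /res; case: ifP. Qed.

Lemma hecke0 p : hecke p 0 = 0.
Proof. by rewrite heckeE dilate0 addr0. Qed.

Lemma hecke_sum p (I : Type) (r : seq I) (P : pred I) (F : I -> series) :
  hecke p (\sum_(i <- r | P i) F i) = \sum_(i <- r | P i) hecke p (F i).
Proof. exact: (big_morph _ (heckeD p) (hecke0 p)). Qed.

Lemma sum_dilate m (f : series) (G : nat -> 'F_2) n : (0 < m)%N ->
  \sum_(i < n.+1) dilate m f i * G i = \sum_(j < (n %/ m).+1) f j * G (m * j)%N.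
Proof.
move=> m0; elim: n => [|n IHn].
  by rewrite div0n !big_ord_recl !big_ord0 /dilate /= dvdn0 div0n muln0.
rewrite big_ord_recr /= IHn divnS // /dilate.
case: ifP => [dv|_] /=; last by rewrite add0n mul0r addr0.
have dE : (n.+1 %/ m = (n %/ m).+1)%N by rewrite divnS // dv.
rewrite add1n [RHS]big_ord_recr /= -dE; congr (_ + _ * G _).
by rewrite mulnC divnK.
Qed.

Lemma dilateM m : (0 < m)%N -> {morph dilate m : f g / f * g}.
Proof.
move=> m0 f g; apply/funext => n.
rewrite [RHS]fps_mulE (sum_dilate f (fun i => dilate m g (n - i)%N)) // /dilate.
case: ifP => mn.
  rewrite fps_mulE; apply: eq_bigr => j _.
  have -> : (n - m * j = (n %/ m - j) * m)%N.
    by rewrite mulnBl divnK // [(j * m)%N]mulnC.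
  by rewrite dvdn_mull // mulnK.
rewrite big1 // => j _; rewrite ifF ?mulr0 //.
have lemj : (m * j <= n)%N by rewrite mulnC -leq_divRL // -ltnS.
by rewrite dvdn_subl ?mn // dvdn_mulr.
Qed.

Lemma contract_dilateM m f g : (0 < m)%N ->
  contract m (dilate m f * g) = f * contract m g.
Proof.
move=> m0; apply/funext => n.
rewrite /contract fps_mulE (sum_dilate f (fun i => g (m * n - i)%N)) //.
rewrite mulKn //; apply: eq_bigr => j _; by rewrite mulnBr.
Qed.

Lemma fps_1E (R : comNzRingType) n : (1 : fps R) n = (n == 0%N)%:R.
Proof. by []. Qed.

Lemma dilate1 m : (0 < m)%N -> dilate m 1 = 1.
Proof.
move=> m0; apply/funext => n; rewrite /dilate; case: ifP => [/dvdnP[k ->]|].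
  by rewrite mulnK // !fps_1E muln_eq0 (gtn_eqF m0) orbF.
by case: n => [|n _]; rewrite ?dvdn0 // fps_1E.
Qed.

Lemma dilateX m k : (0 < m)%N -> {morph dilate m : f / f ^+ k}.
Proof.
by move=> m0 f; elim: k => [|k IHk]; rewrite ?dilate1 // !exprS dilateM // IHk.
Qed.

Lemma dilate_comp m k f : (0 < m)%N -> (0 < k)%N ->
  dilate m (dilate k f) = dilate (m * k) f.
Proof.
move=> m0 k0; apply/funext => n; rewrite /dilate.
case: (boolP (m %| n)%N) => [/dvdnP[j ->]|nd].
  by rewrite mulnK // [(j * m)%N]mulnC dvdn_pmul2l // divnMl.
by case: ifP => // /(dvdn_trans (dvdn_mulr _ (dvdnn m))) /(negP nd).
Qed.

(** The terms at [i] and [n - i] cancel mod 2, so only a middle term survives. *)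
Lemma sum_palindrome (G : nat -> 'F_2) n :
  (forall i, (i <= n)%N -> G (n - i)%N = G i) ->
  \sum_(i < n.+1) G i = if odd n then 0 else G n./2.
Proof.
move=> Gsym; rewrite (bigID (fun i : 'I_n.+1 => (i < n - i)%N)) /=.
rewrite (bigID (fun i : 'I_n.+1 => (n - i < i)%N) (fun i : 'I_n.+1 => ~~ _)) /=.
rewrite (reindex_inj rev_ord_inj) /=.
rewrite (eq_big (fun i : 'I_n.+1 => ~~ (i < n - i)%N && (n - i < i)%N) G);
  first last.
- by move=> i _; rewrite subSS Gsym // -ltnS.
- by move=> i; have := ltn_ord i; rewrite subSS; lia.
rewrite addrA F2_addxx add0r.
case: ifP => n_odd.
  by apply: big1 => i; have := ltn_ord i; lia.
have ltn : (n./2 < n.+1)%N by lia.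
rewrite (big_pred1 (Ordinal ltn)) // => i /=; rewrite -val_eqE /=.
by have := ltn_ord i; lia.
Qed.

Lemma series_sqr (f : series) : f ^+ 2 = dilate 2 f.
Proof.
apply/funext => n; rewrite expr2 fps_mulE.
rewrite (sum_palindrome (G := fun i => f i * f (n - i)%N)); last first.
  by move=> i lein; rewrite subKn // mulrC.
rewrite /dilate dvdn2 divn2; case: ifP => //= even_n.
have -> : (n - n./2 = n./2)%N by lia.
exact: F2_sqr.
Qed.

Lemma series_exp2 (f : series) k : f ^+ (2 ^ k) = dilate (2 ^ k) f.
Proof.
elim: k => [|k IHk].
  by rewrite expr1; apply/funext => n; rewrite /dilate dvd1n divn1.
by rewrite expnSr exprM IHk series_sqr dilate_comp ?expn_gt0 // mulnC.
Qed.

(** The lowest exponents [i] and [k] of two nonzero series give the product the coefficient 1 at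
    [i + k]. *)
Lemma series_mul_eq0 (f g : series) : f * g = 0 -> f = 0 \/ g = 0.
Proof.
have minex (h : series) : h <> 0 ->
    exists2 i, h i = 1 & forall j, (j < i)%N -> h j = 0.
  move=> h0; have ex : exists n, h n != 0.
    apply: contrapT => /forallNP hn; apply: h0; apply/funext => n.
    by apply/eqP; move: (hn n) => /negP; rewrite negbK.
  case: (ex_minnP ex) => i hi hmin; exists i.
    by move: (h i) hi => [[|[|]]] // ? _; apply/val_inj.
  move=> j; rewrite ltnNge => /negP ij; apply/eqP; apply: contrapT => /negP hj.
  exact: ij (hmin _ hj).
move=> fg; have [->|/minex[i fi fj]] := pselect (f = 0); first by left.
have [->|/minex[k gk gj]] := pselect (g = 0); first by right.
have := congr1 (fun h : series => h (i + k)%N) fg.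
rewrite fps_mulE.
have lti : (i < (i + k).+1)%N by rewrite ltnS leq_addr.
rewrite (bigD1 (Ordinal lti)) //= fi addKn gk mul1r big1 ?addr0.
  by move/eqP; rewrite oner_eq0.
move=> j; rewrite -val_eqE /= => ne; case: (ltngtP j i) ne => // [ji|ij] _.
  by rewrite fj ?mul0r.
have jlt := ltn_ord j; by rewrite gj ?mulr0 //; lia.
Qed.

Lemma series_sqr_eq0 (f : series) : f ^+ 2 = 0 -> f = 0.
Proof. by rewrite expr2 => /series_mul_eq0[]. Qed.

(** Descent: a nonzero coefficient at n > 0 would force m to divide n and the coefficient at n/m to
    be nonzero. *)
Lemma dilate_fixed m (f : series) : (1 < m)%N -> f 0%N = 0 -> f = dilate m f ->
  f = 0.
Proof.
move=> m1 f0 fE; apply/funext => n; elim/ltn_ind: n => n IHn.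
rewrite fE /dilate; case: ifP => // /dvdnP[k nE].
case: k nE => [|k] nE; first by rewrite nE mul0n div0n f0.
by rewrite IHn // nE mulnK ?ltn_Pmulr // (ltn_trans _ m1).
Qed.

Lemma hecke_dilate p m f : coprime m p -> (0 < p)%N -> (0 < m)%N ->
  hecke p (dilate m f) = dilate m (hecke p f).
Proof.
move=> cop p0 m0; rewrite !heckeE dilateD dilate_comp // mulnC -dilate_comp //.
congr (_ + _); apply/funext => n; rewrite /contract /dilate Gauss_dvdr //.
by case: ifP => // mn; rewrite muln_divA.
Qed.

Lemma hecke_sqr p f : odd p -> hecke p (f ^+ 2) = hecke p f ^+ 2.
Proof.
by move=> p_odd; rewrite !series_sqr hecke_dilate ?coprime2n // odd_gt0.
Qed.

Definition supp m r (f : series) := forall n, n != r %[mod m] -> f n = 0.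

Lemma supp_res m r f : supp m r (res m r f).
Proof. by move=> n /negbTE nr; rewrite /res nr. Qed.

Lemma res_supp m r f : supp m r f -> res m r f = f.
Proof.
move=> fs; apply/funext => n; rewrite /res.
by case: ifPn => // /fs.
Qed.

Lemma res_supp0 m r s f : supp m s f -> r != s %[mod m] -> res m r f = 0.
Proof.
move=> fs rs; apply/funext => n; rewrite /res; case: ifP => // /eqP nr.
by rewrite fs // nr.
Qed.

Lemma supp_mod m r s f : r = s %[mod m] -> supp m r f -> supp m s f.
Proof. by move=> rs fs n; rewrite -rs => /fs. Qed.

Lemma supp_mul m r s f g : supp m r f -> supp m s g -> supp m (r + s) (f * g).
Proof.
move=> fs gs n nrs; rewrite fps_mulE big1 // => i _.
have [ir|ir] := eqVneq (i %% m)%N (r %% m)%N; last by rewrite fs ?mul0r.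
have [is_|is_] := eqVneq ((n - i) %% m)%N (s %% m)%N; last first.
  by rewrite gs ?mulr0.
case/negP: nrs; rewrite -(subnKC (_ : i <= n)%N) -1?ltnS //.
by rewrite -modnDm ir is_ modnDm.
Qed.

Lemma supp_dilate m r k f : supp m r f -> supp m (k * r) (dilate k f).
Proof.
move=> fs n nkr; rewrite /dilate; case: ifP => // /dvdnP[j nE].
case: (posnP k) nE nkr => [->|k0] ->; first by rewrite muln0 mul0n eqxx.
rewrite mulnK // mulnC => nkr; apply: fs; apply: contra nkr => /eqP jr.
by rewrite -modnMmr jr modnMmr.
Qed.

(** As p is its own inverse mod m, multiplying and dividing exponents by p move the class of r to
    the same class, that of pr. *)
Lemma hecke_res p m r f : (p * p = 1 %[mod m])%N -> (0 < p)%N ->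
  hecke p (res m r f) = res m (p * r) (hecke p f).
Proof.
move=> pp p0.
have ppK a : (p * (p * a) = a %[mod m])%N by rewrite mulnA -modnMml pp modnMml mul1n.
have E a b : (p * a == b %[mod m]) = (a == p * b %[mod m]).
  apply/eqP/eqP => [ab|ab].
    by rewrite -(modnMmr p b) -ab modnMmr ppK.
  by rewrite -(modnMmr p a) ab modnMmr ppK.
rewrite !heckeE resD; congr (_ + _); apply/funext => n.
  by rewrite /contract /res E.
rewrite /dilate /res; case: ifP => [/dvdnP[k ->]|]; last by case: ifP.
by rewrite mulnK // -E [(k * p)%N]mulnC ppK.
Qed.

Lemma res_dilate_self m k f : (0 < m)%N -> (0 < k)%N -> m = k ->
  res m 0 f = dilate k (contract k f).
Proof.
move=> m0 k0 ->; apply/funext => n; rewrite /res /dilate /contract mod0n -/(k %| n)%N.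
by case: ifP => // kn; rewrite mulnC divnK.
Qed.

(** * Series indexed by integers and by pairs of integers *)

Lemma finite_absz m : finite_set [set a : int | (`|a| <= m)%N].
Proof.
apply: (@sub_finite_set _ _ [set (i%:Z - m%:Z) | i in `I_(m + m).+1]).
  by move=> a /= am; exists (absz (a + m%:Z)) => /=; lia.
exact/finite_image/finite_II.
Qed.

Definition sq (a : int) : nat := (`|a| ^ 2)%N.

Lemma sqE a : (sq a)%:Z = a ^+ 2.
Proof. by rewrite /sq; lia. Qed.

Lemma sq_ge a : (`|a| <= sq a)%N.
Proof. by rewrite /sq; nia. Qed.

Lemma finite_fibers_int (A : set int) (e : int -> nat) :
  (forall a, A a -> (`|a| <= e a)%N) -> finite_fibers A e.
Proof.
move=> Ae m; apply: sub_finite_set (finite_absz m) => a /= [/Ae].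
exact: leq_trans.
Qed.

Lemma finite_fibers_pair (A : set (int * int)) (e : int * int -> nat) :
  (forall t, A t -> (`|t.1| <= e t /\ `|t.2| <= e t)%N) -> finite_fibers A e.
Proof.
move=> Ae m; apply: sub_finite_set (finite_setX (finite_absz m) (finite_absz m)).
by move=> t /= [/Ae[t1 t2] et]; split; [exact: leq_trans et|exact: leq_trans et].
Qed.

Section XSumF2.
Variable T : choiceType.
Implicit Types (A : set T) (e : T -> nat).

Lemma dilate_xsum A e m : (0 < m)%N ->
  dilate m (xsum 'F_2 A e) = xsum 'F_2 A (fun t => m * e t)%N.
Proof.
move=> m0; apply/funext => n; rewrite /dilate.
case: ifP => [/dvdnP[k ->]|mn].
  rewrite mulnK //; apply: eq_fsbigr => t _.
  by rewrite mulnC eqn_pmul2r.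
rewrite xsum0P // => t _; apply/eqP => nE.
by rewrite -nE dvdn_mulr in mn.
Qed.

Lemma contract_xsum A e m : (0 < m)%N ->
  contract m (xsum 'F_2 A e) =
    xsum 'F_2 [set t | A t /\ (m %| e t)%N] (fun t => e t %/ m)%N.
Proof.
move=> m0; apply/funext => n; rewrite /contract /xsum.
rewrite -(fsbig_widen [set t | A t /\ (m %| e t)%N]); first last.
- move=> t [/= At nt]; case: eqP => // eE; case: nt; split=> //.
  by rewrite eE dvdn_mulr.
- by move=> t [].
apply: eq_fsbigr => t /set_mem [_ /dvdnP[k ->]].
by rewrite mulnK // mulnC eqn_pmul2l.
Qed.

Lemma res_xsum A e m r :
  res m r (xsum 'F_2 A e) = xsum 'F_2 [set t | A t /\ e t = r %[mod m]] e.
Proof.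
apply/funext => n; rewrite /res; case: ifP => [/eqP nr|/eqP nr].
  apply/esym/fsbig_widen => [t []//|t [At /= nt]].
  by case: eqP => // eE; case: nt; rewrite eE.
by rewrite xsum0P // => t [_ et]; apply/eqP => eE; apply: nr; rewrite -eE.
Qed.

(** Terms matched by an involution without fixed points cancel mod 2. *)
Lemma xsum_double A B C e (h : T -> T) :
  finite_fibers C e -> (forall t, C t <-> A t \/ B t) ->
  (forall t, A t -> B t -> False) ->
  (forall t, A t -> B (h t)) -> (forall t, B t -> A (h t)) ->
  (forall t, h (h t) = t) -> (forall t, A t -> e (h t) = e t) ->
  xsum 'F_2 C e = 0.
Proof.
move=> Cf CAB AB0 AB BA hK eh; rewrite (xsumU _ Cf CAB AB0).
rewrite (_ : xsum 'F_2 B e = xsum 'F_2 A e) ?addss //.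
by apply/esym/(xsum_bij _ (h := h) (g := h)) => [t At|t Bt]; split; auto.
Qed.

End XSumF2.

(** * Modular equations of levels 3, 5 and 7 *)

Ltac zpair a b := case=> a b; change int in a; change int in b.

Ltac sqring :=
  apply/eqP; rewrite -eqz_nat /= !(PoszD, PoszM, sqE); apply/eqP; ring.

(** Of a and -a, for odd a, exactly one lies here, so every odd square is counted once in [Fser]. *)
Definition one4 : set int := [set a | (a %% 4)%Z = 1].

Definition Fser : series := xsum 'F_2 one4 sq.

Lemma finite_one4 k : (0 < k)%N -> finite_fibers one4 (fun a => k * sq a)%N.
Proof.
by move=> k0; apply: finite_fibers_int => a _; have := sq_ge a; nia.
Qed.

Lemma finite_sq2 (A : set (int * int)) k m : (0 < k)%N -> (0 < m)%N ->
  finite_fibers A (fun t => k * sq t.1 + m * sq t.2)%N.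
Proof.
move=> k0 m0; apply: finite_fibers_pair => -[a b] _ /=; split.
  by rewrite (leq_trans (sq_ge a)) // (leq_trans (leq_pmull _ k0)) ?leq_addr.
by rewrite (leq_trans (sq_ge b)) // (leq_trans (leq_pmull _ m0)) ?leq_addl.
Qed.

Lemma finite_ksq2 (A : set (int * int)) k m : (0 < k)%N -> (0 < m)%N ->
  finite_fibers A (fun t => k * (sq t.1 + m * sq t.2))%N.
Proof.
move=> k0 m0 i; have km0 : (0 < k * m)%N by rewrite muln_gt0 k0.
apply: sub_finite_set (finite_sq2 A k0 km0 i) => t /= [At].
by rewrite mulnDr mulnA.
Qed.

Lemma dilate_F k : (0 < k)%N -> dilate k Fser = xsum 'F_2 one4 (fun a => k * sq a)%N.
Proof. exact: dilate_xsum. Qed.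

Lemma F_mul k m : (0 < k)%N -> (0 < m)%N ->
  dilate k Fser * dilate m Fser =
    xsum 'F_2 (one4 `*` one4) (fun t => k * sq t.1 + m * sq t.2)%N.
Proof. by move=> k0 m0; rewrite !dilate_F // xsum_mul //; exact: finite_one4. Qed.

Lemma dilate1E f : dilate 1 f = f.
Proof. by apply/funext => n; rewrite /dilate dvd1n divn1. Qed.

Lemma F_mul1 m : (0 < m)%N ->
  Fser * dilate m Fser = xsum 'F_2 (one4 `*` one4) (fun t => sq t.1 + m * sq t.2)%N.
Proof.
move=> m0; rewrite -{1}[Fser]dilate1E F_mul //.
by apply: eq_xsum => // t _; rewrite mul1n.
Qed.

Lemma sqN a : sq (- a) = sq a. Proof. by rewrite /sq abszN. Qed.

(** One coordinate is even, and negating it preserves the sum mod 4. All pairs off the axes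
    therefore cancel, and each axis contributes one dilation of [Fser]. *)
Lemma xsum_odd_norm k m : (0 < k)%N -> (0 < m)%N ->
  xsum 'F_2 [set t : int * int | ((t.1 + t.2) %% 4)%Z = 1]
      (fun t => k * (sq t.1 + m * sq t.2))%N =
    dilate k Fser + dilate (k * m) Fser.
Proof.
move=> k0 m0; set C := [set t : int * int | _].
set e := (X in xsum _ _ X).
pose A1 := [set t : int * int | one4 t.1 /\ t.2 = 0].
pose A2 := [set t : int * int | t.1 = 0 /\ one4 t.2].
pose Z := [set t : int * int | [/\ C t, t.1 <> 0 & t.2 <> 0]].
have fin X : finite_fibers X e by exact: finite_ksq2.
rewrite (@xsumU _ _ A1 (A2 `|` Z)) //; first last.
- by zpair a b => -[/= a1 b0] [[/= a0]|[_ _ /(_ b0)]] //; rewrite a0 in a1.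
- zpair a b; rewrite /C /A1 /A2 /Z /one4 /=; split; last first.
    by case=> [[? ->]|[[-> ?]|[]]] //; rewrite ?addr0 ?add0r.
  have [->|/eqP a0] := eqVneq a 0; first by rewrite add0r; right; left.
  have [->|/eqP b0] := eqVneq b 0; first by rewrite addr0; left.
  by right; right.
rewrite (@xsumU _ _ A2 Z (A2 `|` Z)) //; last by move=> t [t0 _] [_ /(_ t0)].
have -> : xsum 'F_2 Z e = 0.
  pose ev (t : int * int) := if (t.1 %% 2)%Z == 0 then t.1 else t.2.
  pose h (t : int * int) :=
    if (t.1 %% 2)%Z == 0 then (- t.1, t.2) else (t.1, - t.2).
  apply: (@xsum_double _ [set t | Z t /\ 0 < ev t] [set t | Z t /\ ev t < 0]
            _ _ h) => //.
  - zpair a b; rewrite /Z /ev /C /=; split; last by case=> -[].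
    case: ifP => a2 [Ct a0 b0].
      have [?|?] : 0 < a \/ a < 0 by lia.
        by left.
      by right.
    have [?|?] : 0 < b \/ b < 0 by lia.
      by left.
    by right.
  - by zpair a b; rewrite /ev /=; case: ifP => ? [] ? ? []; lia.
  - zpair a b; rewrite /ev /Z /C /h /=.
    case: (boolP ((a %% 2)%Z == 0)) => a2 /= -[[C1 a0 b0] ev0].
      by rewrite ifT; [split; [split|]; lia | lia].
    by rewrite (negbTE a2); split; [split|]; lia.
  - zpair a b; rewrite /ev /Z /C /h /=.
    case: (boolP ((a %% 2)%Z == 0)) => a2 /= -[[C1 a0 b0] ev0].
      by rewrite ifT; [split; [split|]; lia | lia].
    by rewrite (negbTE a2); split; [split|]; lia.
  - zpair a b; rewrite /h /=; case: (boolP ((a %% 2)%Z == 0)) => a2 /=.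
      by rewrite ifT ?opprK //; lia.
    by rewrite (negbTE a2) opprK.
  - by zpair a b; rewrite /h /=; case: ifP => _ _; rewrite /e /= sqN.
rewrite addr0 !dilate_F ?muln_gt0 ?k0 //; congr (_ + _).
  apply: (xsum_bij _ (h := fst) (g := fun a => (a, 0))) => [[a b] [/= ? ->]|a ?] //.
  by split=> //; rewrite /e /= {2}/sq muln0 addn0.
apply: (xsum_bij _ (h := snd) (g := fun b => (0, b))) => [[a b] [/= -> ?]|b ?] //.
by split=> //; rewrite /e /= {2}/sq add0n mulnA.
Qed.

(** Multiplication by 1 + sqrt(-3), of norm 4, maps the index set of [xsum_odd_norm] bijectively to
    the pairs that are 1 mod 4 in both coordinates. *)
Lemma level3_F : Fser * dilate 3 Fser = (Fser + dilate 3 Fser) ^+ 4.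
Proof.
rewrite (exprDpow2 _ _ 2) !(series_exp2 _ 2) dilate_comp // -xsum_odd_norm //.
rewrite F_mul1 //; apply/esym.
apply: (xsum_bij _ (h := fun t => (t.1 - 3 * t.2, t.1 + t.2))
  (g := fun t => (((t.1 + 3 * t.2) %/ 4)%Z, ((t.2 - t.1) %/ 4)%Z))).
  zpair c d => /= cd; rewrite /one4 /=; split; first by split=> /=; lia.
    by congr pair; lia.
  by sqring.
by zpair a b; rewrite /one4 /= => -[/= a1 b1]; split; [lia|congr pair; lia].
Qed.

(** The pairs that are 1 mod 4 in both coordinates, viewed in Z[sqrt(-7)], split into multiples of 1
    + sqrt(-7), of norm 8 ([S1]), multiples of -3 + sqrt(-7), of norm 16 ([S2]), and products of odd
    pairs with half of the latter, of norm 4 ([S3]). The first two collapse by [xsum_odd_norm]; the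
    third reproduces F F(x^7) with exponents times 4. *)
Lemma level7_F :
  Fser * dilate 7 Fser + (Fser * dilate 7 Fser) ^+ 4 =
  (Fser + dilate 7 Fser) ^+ 8 + (Fser + dilate 7 Fser) ^+ 16.
Proof.
pose A := one4 `*` one4.
pose e (t : int * int) := (sq t.1 + 7 * sq t.2)%N.
pose S1 := [set t | A t /\ ((t.1 - t.2) %% 8)%Z = 0].
pose S2 := [set t | [/\ A t, ((t.1 - t.2) %% 8)%Z = 4 &
                       ((7 * t.2 - 3 * t.1) %% 16)%Z = 0]].
pose S3 := [set t | [/\ A t, ((t.1 - t.2) %% 8)%Z = 4 &
                       ((7 * t.2 - 3 * t.1) %% 16)%Z = 8]].
have fin X : finite_fibers X e.
  apply: finite_fibers_pair => -[a b] _; rewrite /e /=.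
  by have := sq_ge a; have := sq_ge b; lia.
set Y := _ ^+ 4.
rewrite F_mul1 // -/A -/e (@xsumU _ _ S1 (S2 `|` S3)) //; first last.
- zpair a b; rewrite /S1 /S2 /S3 /= => -[_ ?] [] []; lia.
- zpair a b; rewrite /S1 /S2 /S3 /A /one4 /=; split; last by case=> [|[]] [].
  move=> [/= a1 b1].
  have [?|[?|?]] : ((a - b) %% 8)%Z = 0 \/
     (((a - b) %% 8)%Z = 4 /\ ((7 * b - 3 * a) %% 16)%Z = 0 \/
      ((a - b) %% 8)%Z = 4 /\ ((7 * b - 3 * a) %% 16)%Z = 8) by lia.
  + by left.
  + by right; left; split=> //; lia.
  + by right; right; split=> //; lia.
rewrite (@xsumU _ _ S2 S3 (S2 `|` S3)) //; last first.
  by zpair a b; rewrite /S2 /S3 /= => -[_ _ ?] [_ _]; lia.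
have -> : xsum 'F_2 S1 e = dilate 8 Fser + dilate (8 * 7) Fser.
  rewrite -xsum_odd_norm //; apply/esym.
  apply: (xsum_bij _ (h := fun t => (t.1 - 7 * t.2, t.1 + t.2))
    (g := fun t => (((t.1 + 7 * t.2) %/ 8)%Z, ((t.2 - t.1) %/ 8)%Z))).
    zpair c d; rewrite /S1 /A /one4 /e /= => cd.
    by split; [split; [split=> /=|]; lia|congr pair; lia|sqring].
  zpair a b; rewrite /S1 /A /one4 /= => -[[/= a1 b1] ab].
  by split; [lia|congr pair; lia].
have -> : xsum 'F_2 S2 e = dilate 16 Fser + dilate (16 * 7) Fser.
  rewrite -xsum_odd_norm //; apply/esym.
  apply: (xsum_bij _ (h := fun t => (- 3 * t.1 - 7 * t.2, t.1 - 3 * t.2))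
    (g := fun t => (((7 * t.2 - 3 * t.1) %/ 16)%Z, (- (t.1 + 3 * t.2) %/ 16)%Z))).
    zpair c d; rewrite /S2 /A /one4 /e /= => cd.
    by split; [split; [split=> /=| |]; lia|congr pair; lia|sqring].
  zpair a b; rewrite /S2 /A /one4 /= => -[[/= a1 b1] ab ab'].
  by split; [lia|congr pair; lia].
have -> : xsum 'F_2 S3 e = dilate 4 (Fser * dilate 7 Fser).
  rewrite F_mul1 // dilate_xsum //; apply/esym.
  (* The half-integral multiplier determines the product of odd pairs only up to the wrong sign mod
     4, which [sg] corrects. *)
  pose sg (t : int * int) : int * int :=
    if (t.1 %% 4)%Z == 1 then t else (- t.1, - t.2).
  apply: (xsum_bij _
    (h := fun t => sg (((- 3 * t.1 - 7 * t.2) %/ 2)%Z, ((t.1 - 3 * t.2) %/ 2)%Z))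
    (g := fun t => sg (((7 * t.2 - 3 * t.1) %/ 8)%Z, (- (t.1 + 3 * t.2) %/ 8)%Z))).
    zpair c d; rewrite /S3 /A /one4 /e /= => -[/= c1 d1].
    have [k ck] : exists k, c = 4 * k + 1 by exists (c %/ 4)%Z; lia.
    have [l dl] : exists l, d = 4 * l + 1 by exists (d %/ 4)%Z; lia.
    have -> : ((- 3 * c - 7 * d) %/ 2)%Z = - (6 * k + 14 * l + 5) by lia.
    have -> : ((c - 3 * d) %/ 2)%Z = 2 * k - 6 * l - 1 by lia.
    rewrite /sg /=; case: ifP => kl /=.
      split; [split; [split=> /=| |]; lia| |rewrite ck dl; sqring].
      by case: ifP => ? /=; congr pair; lia.
    split; [split; [split=> /=| |]; lia| |rewrite ck dl; sqring].
    by case: ifP => ? /=; congr pair; lia.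
  zpair a b; rewrite /S3 /A /one4 /= => -[[/= a1 b1] ab ab'].
  rewrite /sg /=; case: ifP => ? /=; (split; first by split=> /=; lia).
    by case: ifP => ? /=; congr pair; lia.
  by case: ifP => ? /=; congr pair; lia.
have -> : dilate 4 (Fser * dilate 7 Fser) = Y.
  exact/esym/(series_exp2 _ 2).
rewrite -!addrA addss addr0 (exprDpow2 _ _ 3) (exprDpow2 _ _ 4).
by rewrite !(series_exp2 _ 3) !(series_exp2 _ 4) !dilate_comp // addrA.
Qed.


Lemma sq_mod5 a : (sq a %% 5)%N =
  if (a %% 5)%Z == 0 then 0%N else
  if ((a %% 5)%Z == 1) || ((a %% 5)%Z == 4) then 1%N else 4%N.
Proof.
have : (a %% 5)%Z = 0 \/ (a %% 5)%Z = 1 \/ (a %% 5)%Z = 2 \/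
    (a %% 5)%Z = 3 \/ (a %% 5)%Z = 4 by lia.
have : (sq a)%:Z = 5 * (5 * (a %/ 5)%Z ^+ 2 + 2 * (a %/ 5)%Z * (a %% 5)%Z)
                   + (a %% 5)%Z ^+ 2.
  by rewrite sqE {1}(divz_eq a 5); ring.
move: (5 * _ ^+ 2 + 2 * _ * _) => X sqX.
by case=> [|[|[|[]]]] mE; rewrite mE /= in sqX *; lia.
Qed.

Notation F5 r := (res 5 r Fser).

(** If a^2 = 1 and b^2 = 4 mod 5 then b = 2a or b = -2a mod 5, so exactly one prime above 5 divides
    a + bi. Dividing by it, up to conjugation and units, gives the pairs of [X] with 2c + d prime to
    5. All of [X] contributes F(x^5)^2, and the excluded part [X0] is once more divisible by a prime
    above 5, giving F(x^25)^2. *)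
Lemma F5_mul :
  F5 1 * F5 4 = dilate 5 Fser ^+ 2 + dilate 25 Fser ^+ 2.
Proof.
pose e (t : int * int) := (sq t.1 + sq t.2)%N.
pose e5 (t : int * int) := (5 * (sq t.1 + 1 * sq t.2))%N.
pose A := [set t : int * int | [/\ one4 t.1, one4 t.2,
             (sq t.1 %% 5 = 1)%N & (sq t.2 %% 5 = 4)%N]].
pose A1 := [set t | A t /\ ((2 * t.1 + t.2) %% 5)%Z = 0].
pose A2 := [set t | A t /\ ((2 * t.1 - t.2) %% 5)%Z = 0].
pose X := one4 `*` one4.
pose X0 := [set t | X t /\ (sq (2 * t.1 + t.2) %% 5 = 0)%N].
pose X1 := [set t | X t /\ (sq (2 * t.1 + t.2) %% 5 = 1)%N].
pose X2 := [set t | X t /\ (sq (2 * t.1 + t.2) %% 5 = 4)%N].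
have fin B : finite_fibers B e.
  apply: finite_fibers_pair => -[a b] _; rewrite /e /=.
  by have := sq_ge a; have := sq_ge b; lia.
have fin5 B : finite_fibers B e5 by exact: finite_ksq2.
have -> : F5 1 * F5 4 = xsum 'F_2 A1 e + xsum 'F_2 A2 e.
  rewrite !res_xsum xsum_mul; first last.
  - by apply: finite_fibers_int => a _; exact: sq_ge.
  - by apply: finite_fibers_int => a _; exact: sq_ge.
  rewrite -(@xsumU _ _ A1 A2 A) //; first last.
  - zpair a b; rewrite /A1 /A2 /A /= !sq_mod5 => -[[_ _ + _] +] [_].
    by do !case: ifP; lia.
  - zpair a b; rewrite /A1 /A2 /A /= !sq_mod5; split; last by case=> -[].
    move=> H; have [ab|ab] : ((2 * a + b) %% 5)%Z = 0 \/ ((2 * a - b) %% 5)%Z = 0.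
    + by case: H => _ _; do !case: ifP; lia.
    + by left.
    by right.
  apply: eq_xsum => // -[a b]; split; first by case=> -[? ?] [? ?].
  by case=> ? ? ? ?; do !split.
have -> : xsum 'F_2 A1 e = xsum 'F_2 X1 e5.
  apply/esym.
  apply: (xsum_bij _ (h := fun t => (- (2 * t.1 + t.2), 2 * t.2 - t.1))
    (g := fun t => ((- (2 * t.1 + t.2) %/ 5)%Z, ((2 * t.2 - t.1) %/ 5)%Z))).
    zpair c d; rewrite /X1 /X /A1 /A /one4 /e /e5 /= !sq_mod5 => -[[/= c1 d1] cd].
    split; [split; [split|] | congr pair; lia | sqring]; try lia.
    + by move: cd; do !case: ifP; lia.
    + by move: cd; do !case: ifP; lia.
  zpair a b; rewrite /X1 /X /A1 /A /one4 /= !sq_mod5 => -[[/= a1 b1 sa sb] ab].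
  split; [split; [split=> /=|]; try lia|congr pair; lia].
  have -> : 2 * (- (2 * a + b) %/ 5)%Z + ((2 * b - a) %/ 5)%Z = - a by lia.
  by move: sa; do !case: ifP; lia.
have -> : xsum 'F_2 A2 e = xsum 'F_2 X2 e5.
  apply/esym.
  apply: (xsum_bij _ (h := fun t => (2 * t.2 - t.1, - (2 * t.1 + t.2)))
    (g := fun t => ((- (2 * t.2 + t.1) %/ 5)%Z, ((2 * t.1 - t.2) %/ 5)%Z))).
    zpair c d; rewrite /X2 /X /A2 /A /one4 /e /e5 /= !sq_mod5 => -[[/= c1 d1] cd].
    split; [split; [split|] | congr pair; lia | sqring]; try lia.
    + by move: cd; do !case: ifP; lia.
    + by move: cd; do !case: ifP; lia.
  zpair a b; rewrite /X2 /X /A2 /A /one4 /= !sq_mod5 => -[[/= a1 b1 sa sb] ab].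
  split; [split; [split=> /=|]; try lia|congr pair; lia].
  have -> : 2 * (- (2 * b + a) %/ 5)%Z + ((2 * a - b) %/ 5)%Z = - b by lia.
  by move: sb; do !case: ifP; lia.
have XX : xsum 'F_2 X e5 = dilate 5 Fser ^+ 2.
  rewrite -dilateX // expr2 -{2}[Fser]dilate1E F_mul1 // dilate_xsum //.
have X0E : xsum 'F_2 X0 e5 = dilate 25 Fser ^+ 2.
  rewrite -dilateX // expr2 -{2}[Fser]dilate1E F_mul1 // dilate_xsum //.
  apply/esym.
  apply: (xsum_bij _ (h := fun t => (- 2 * t.1 - t.2, - t.1 + 2 * t.2))
    (g := fun t => ((- (2 * t.1 + t.2) %/ 5)%Z, ((2 * t.2 - t.1) %/ 5)%Z))).
    zpair c d; rewrite /X0 /X /one4 /e5 /= !sq_mod5 => -[/= c1 d1].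
    split; [split; [split=> /=|] | congr pair; lia | sqring]; try lia.
    by do !case: ifP; lia.
  zpair a b; rewrite /X0 /X /one4 /= !sq_mod5 => -[[/= a1 b1] ab].
  have ab' : ((2 * a + b) %% 5)%Z = 0 by move: ab; do !case: ifP; lia.
  by split; [split=> /=; lia|congr pair; lia].
rewrite -XX -X0E (@xsumU _ _ X0 (X1 `|` X2) X) //; first last.
- by move=> t; rewrite /X0 /X1 /X2 /= => -[_ ->] [] [].
- move=> t; rewrite /X0 /X1 /X2 /=; split; last by case=> [|[]] [].
  have : (sq (2 * t.1 + t.2) %% 5 = 0 \/ sq (2 * t.1 + t.2) %% 5 = 1 \/
          sq (2 * t.1 + t.2) %% 5 = 4)%N by rewrite sq_mod5; do !case: ifP; auto.
  by case=> [|[|]]; [left|right; left|right; right].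
rewrite (@xsumU _ _ X1 X2 (X1 `|` X2)) //; last first.
  by move=> t; rewrite /X1 /X2 /= => -[_ ->] [].
by rewrite [_ + (_ + _)]addrC -addrA addss addr0.
Qed.

(** A pair (c, d) stands for c + 2di, with norm [normG]; [mulG r] and [mulGbar r] below multiply by
    r + 2i and r - 2i, of norm r^2 + 4. *)
Definition normG (z : int * int) : nat := (sq z.1 + 4 * sq z.2)%N.

Definition mulG (r : int) (z : int * int) : int * int :=
  (r * z.1 - 4 * z.2, r * z.2 + z.1).

Definition mulGbar (r : int) (z : int * int) : int * int :=
  (r * z.1 + 4 * z.2, r * z.2 - z.1).

Lemma finite_normG (A : set (int * int)) : finite_fibers A normG.
Proof.
apply: finite_fibers_pair => -[a b] _; rewrite /normG /=.
by have := sq_ge a; have := sq_ge b; lia.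
Qed.

Lemma normGM r z : (normG (mulG r z))%:Z = (r ^+ 2 + 4) * (normG z)%:Z.
Proof. by case: z => a b; rewrite /normG /= !(PoszD, PoszM, sqE); ring. Qed.

Lemma normGMbar r z : (normG (mulGbar r z))%:Z = (r ^+ 2 + 4) * (normG z)%:Z.
Proof. by case: z => a b; rewrite /normG /= !(PoszD, PoszM, sqE); ring. Qed.

Definition scaleG (p : int) (z : int * int) : int * int := (p * z.1, p * z.2).

Lemma xsumUI (T : choiceType) (A B : set T) (e : T -> nat) :
  finite_fibers (A `|` B) e ->
  xsum 'F_2 (A `|` B) e =
    xsum 'F_2 A e + xsum 'F_2 B e + xsum 'F_2 (A `&` B) e.
Proof.
move=> fin.
have finA : finite_fibers A e by apply: finite_fibers_sub fin => t; left.
rewrite (@xsumU _ _ (A `\` B) B (A `|` B)) //; first last.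
- by move=> t [].
- move=> t; split=> [[At|]|[[]|]]; [|by right|by left|by right].
  by have [Bt|Bt] := pselect (B t); [right|left].
rewrite (@xsumU _ _ (A `\` B) (A `&` B) A e finA); first last.
- by move=> t [_ nB] [].
- move=> t; split=> [At|[[]|[]] //].
  by have [Bt|Bt] := pselect (B t); [right|left].
by rewrite -!addrA [X in _ = _ + X]addrCA addss addr0.
Qed.


(** * Hecke operators on theta series *)

(** The pairs of norm divisible by p are the multiples of r + 2i or of r - 2i. The overlap consists
    of the multiples of p, and its contribution cancels the dilation part of [hecke p] mod 2. *)
Lemma hecke_split (p : nat) (r : int) (A : set (int * int)) :
  prime p -> odd p -> p%:Z = r ^+ 2 + 4 ->
  (forall z, A (scaleG p%:Z z) <-> A z) ->
  hecke p (xsum 'F_2 A normG) =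
    xsum 'F_2 [set z | A (mulG r z)] normG +
    xsum 'F_2 [set z | A (mulGbar r z)] normG.
Proof.
move=> p_pr p_odd pE Ap; have p_gt0 := prime_gt0 p_pr.
have pZ0 : p%:Z != 0 by rewrite eqz_nat -lt0n.
pose dvp (x : int) := (p%:Z %| x)%Z.
have dvpM x y : dvp (x * y) -> dvp x \/ dvp y.
  by rewrite /dvp !dvdzE abszM Euclid_dvdM // => /orP.
have dvpE x : dvp x <-> exists k, x = k * p%:Z.
  by split=> [/dvdzP|?]; last exact/dvdzP.
have ndv2 : ~ dvp 2.
  rewrite /dvp dvdzE /= => /dvdn_leq -/(_ isT) p2.
  by have := prime_gt1 p_pr; case: p p2 p_odd {pE Ap p_pr p_gt0 pZ0 dvp dvpM dvpE} => [|[|[|]]].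
(* If p divides both rd - c and rd + c it divides 2rd, hence d and then c; this identifies the
   overlap. *)
have ndv2r : ~ dvp (2 * r).
  case/dvpM => // /dvpE [k rE]; have : dvp (2 * 2).
    by apply/dvpE; exists (1 - k * r); rewrite mulrBl mul1r -mulrA [r * _]mulrC mulrA -rE pE; ring.
  by case/dvpM.
have divpK x : ((x * p%:Z) %/ p%:Z)%Z = x by exact: mulzK.
(* Within [A], these are the multiples of r + 2i: (c + 2di)(r - 2i) has imaginary part 2(rd - c),
   and divisibility of that part by p suffices. [A2] is the same for r - 2i. *)
pose A1 := [set z : int * int | A z /\ dvp (r * z.2 - z.1)].
pose A2 := [set z : int * int | A z /\ dvp (r * z.2 + z.1)].
have normp z w : (normG z)%:Z = (r ^+ 2 + 4) * (normG w)%:Z -> (normG z %/ p)%N = normG w.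
  by rewrite -pE -PoszM => -[->]; rewrite mulKn.
have A1bij : xsum 'F_2 A1 (fun z => normG z %/ p)%N = xsum 'F_2 [set z | A (mulG r z)] normG.
  apply/esym/(xsum_bij _ (h := mulG r)
    (g := fun z => (((r * z.1 + 4 * z.2) %/ p%:Z)%Z, ((r * z.2 - z.1) %/ p%:Z)%Z))).
    zpair a b => Aw; split; last by apply/normp/normGM.
      by split=> //=; apply/dvpE; exists b; rewrite pE; ring.
    congr pair => /=; first by rewrite -[RHS]divpK; congr (_ %/ _)%Z; rewrite pE; ring.
    by rewrite -[RHS]divpK; congr (_ %/ _)%Z; rewrite pE; ring.
  zpair c d; rewrite /A1 /= => -[Az /dvpE [k kE]].
  have cE : c = r * d - k * p%:Z by rewrite -kE; ring.
  have E : r * c + 4 * d = (d - r * k) * p%:Z by rewrite cE pE; ring.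
  rewrite E kE !divpK; suff -> : mulG r (d - r * k, k) = (c, d) by [].
  by rewrite /mulG /= cE pE; congr pair; ring.
have A2bij : xsum 'F_2 A2 (fun z => normG z %/ p)%N = xsum 'F_2 [set z | A (mulGbar r z)] normG.
  apply/esym/(xsum_bij _ (h := mulGbar r)
    (g := fun z => (((r * z.1 - 4 * z.2) %/ p%:Z)%Z, ((r * z.2 + z.1) %/ p%:Z)%Z))).
    zpair a b => Aw; split; last by apply/normp/normGMbar.
      by split=> //=; apply/dvpE; exists b; rewrite pE; ring.
    congr pair => /=; first by rewrite -[RHS]divpK; congr (_ %/ _)%Z; rewrite pE; ring.
    by rewrite -[RHS]divpK; congr (_ %/ _)%Z; rewrite pE; ring.
  zpair c d; rewrite /A2 /= => -[Az /dvpE [k kE]].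
  have cE : c = k * p%:Z - r * d by rewrite -kE; ring.
  have E : r * c - 4 * d = (r * k - d) * p%:Z by rewrite cE pE; ring.
  rewrite E kE !divpK; suff -> : mulGbar r (r * k - d, k) = (c, d) by [].
  by rewrite /mulGbar /= cE pE; congr pair; ring.
have A12bij : xsum 'F_2 (A1 `&` A2) (fun z => normG z %/ p)%N = dilate p (xsum 'F_2 A normG).
  rewrite dilate_xsum //.
  apply/esym/(xsum_bij _ (h := scaleG p%:Z)
    (g := fun z => ((z.1 %/ p%:Z)%Z, (z.2 %/ p%:Z)%Z))).
    zpair a b => Aw; split.
    - by split; split; rewrite ?Ap //= ; apply/dvpE; [exists (r * b - a)|exists (r * b + a)]; ring.
    - by rewrite /= ![p%:Z * _]mulrC !divpK.
    have -> : normG (scaleG p%:Z (a, b)) = (p * p * normG (a, b))%N.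
      by rewrite /normG; sqring.
    by rewrite -mulnA mulKn.
  zpair c d => -[[Az /dvpE[k kE]] [_ /dvpE[l lE]]]; rewrite /= in kE lE *.
  have /dvpM[//|/dvpE[m dE]] : dvp (2 * r * d).
    by apply/dvpE; exists (k + l); rewrite [RHS]mulrDl -kE -lE; ring.
  have cE : c = (r * m - k) * p%:Z by rewrite [RHS]mulrBl -mulrA -dE -kE; ring.
  rewrite cE dE !divpK; suff E : scaleG p%:Z (r * m - k, m) = (c, d).
    by split; [rewrite -Ap E|rewrite E cE dE].
  by rewrite cE dE /scaleG /=; congr pair; ring.
rewrite heckeE contract_xsum //.
have -> : xsum 'F_2 [set t | A t /\ (p %| normG t)%N] (fun t => normG t %/ p)%N =
   xsum 'F_2 (A1 `|` A2) (fun t => normG t %/ p)%N.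
  apply: eq_xsum => //; zpair c d; rewrite /A1 /A2 /=.
  have dvN : (p %| normG (c, d))%N = dvp (normG (c, d))%:Z by rewrite /dvp dvdzE.
  have NE : (normG (c, d))%:Z = p%:Z * d ^+ 2 - (r * d - c) * (r * d + c).
    by rewrite pE /normG /= !(PoszD, PoszM, sqE); ring.
  split=> [[At]|].
    rewrite dvN => /dvpE[k kE].
    have /dvpM[?|?] : dvp ((r * d - c) * (r * d + c)).
      by apply/dvpE; exists (d ^+ 2 - k); rewrite [RHS]mulrBl -kE NE; ring.
    - by left.
    - by right.
  case=> -[At /dvpE[k kE]]; split=> //; rewrite dvN; apply/dvpE; rewrite NE kE.
    by exists (d ^+ 2 - k * (r * d + c)); ring.
  by exists (d ^+ 2 - k * (r * d - c)); ring.
rewrite xsumUI; first by rewrite A1bij A2bij A12bij -addrA addss addr0.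
move=> m; apply: sub_finite_set (@finite_normG (A1 `|` A2) (m.+1 * p)%N) => t /=.
by case=> At; rewrite -ltnS ltn_divLR // => /ltnW.
Qed.

(** The form c^2 + 4d^2 is anisotropic mod 7 because -1 is not a square there; all residues are
    checked. *)
Lemma inert7 c d : (7 %| normG (c, d))%N -> (7 %| c)%Z /\ (7 %| d)%Z.
Proof.
rewrite /normG /= => N7.
have E x : (sq x)%:Z = 7 * (7 * (x %/ 7)%Z ^+ 2 + 2 * (x %/ 7)%Z * (x %% 7)%Z)
                   + (x %% 7)%Z ^+ 2.
  by rewrite sqE {1}(divz_eq x 7); ring.
have := E c; have := E d; move: (7 * _ ^+ 2 + _) (7 * _ ^+ 2 + _) => X Y dE cE.
have c7 : (c %% 7)%Z = 0 \/ (c %% 7)%Z = 1 \/ (c %% 7)%Z = 2 \/ (c %% 7)%Z = 3 \/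
  (c %% 7)%Z = 4 \/ (c %% 7)%Z = 5 \/ (c %% 7)%Z = 6 by lia.
have d7 : (d %% 7)%Z = 0 \/ (d %% 7)%Z = 1 \/ (d %% 7)%Z = 2 \/ (d %% 7)%Z = 3 \/
  (d %% 7)%Z = 4 \/ (d %% 7)%Z = 5 \/ (d %% 7)%Z = 6 by lia.
by move: c7 d7 => [|[|[|[|[|[]]]]]] c7 [|[|[|[|[|[]]]]]] d7;
  rewrite c7 d7 /= in cE dE; lia.
Qed.

(** Norms divisible by 7 come from multiples of 7, so the contraction and the dilation part of
    [hecke 7] agree. The factor -7 is 1 mod 4, so scaling by it respects the sign normalisation
    [one4]. *)
Lemma hecke_inert (A : set (int * int)) :
  (forall z, A (scaleG (-7) z) <-> A z) -> hecke 7 (xsum 'F_2 A normG) = 0.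
Proof.
move=> A7; rewrite heckeE contract_xsum // dilate_xsum //; apply/adds_eq0/esym.
apply: (xsum_bij _ (h := scaleG (-7))
  (g := fun z => ((- z.1 %/ 7)%Z, (- z.2 %/ 7)%Z))).
  zpair a b => Aw.
  have NE : normG (scaleG (-7) (a, b)) = (7 * (7 * normG (a, b)))%N.
    by rewrite /normG; sqring.
  split; first by split; [exact/A7 | rewrite NE dvdn_mulr].
    by rewrite /=; congr pair; lia.
  by rewrite NE mulKn.
zpair c d => -[Az /inert7[c7 d7]]; suff E : scaleG (-7) ((- c %/ 7)%Z, (- d %/ 7)%Z) = (c, d).
  by split; [rewrite /= -A7 E|rewrite /= E].
by rewrite /scaleG /=; congr pair; lia.
Qed.

(** Lets [ring] prove identities in characteristic 2: [Z] is half of the expansion of [X + Y] with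
    integer coefficients. *)
Lemma eq_mod2 (X Y Z : series) : X + Y = Z + Z -> X = Y.
Proof. by rewrite addss => /adds_eq0. Qed.

(** * Parts by residue of the exponent, and the equations for D *)

Lemma res_dilate m r k f : (k * k = 1 %[mod m])%N -> (0 < k)%N ->
  res m r (dilate k f) = dilate k (res m (k * r) f).
Proof.
move=> kk k0; apply/funext => n; rewrite /dilate /res.
have [/dvdnP[j ->]|_] := boolP (k %| n)%N; last by case: ifP.
rewrite mulnK //; have kkK a : (k * (k * a) = a %[mod m])%N.
  by rewrite mulnA -modnMml kk modnMml mul1n.
congr (if _ then _ else _); apply/eqP/eqP => [jk|jr].
  by rewrite -(modnMmr k r) -jk modnMmr [(j * k)%N]mulnC kkK.
by rewrite mulnC -(modnMmr k j) jr modnMmr kkK.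
Qed.

Lemma res3_sum f : f = res 3 0 f + res 3 1 f + res 3 2 f.
Proof.
apply/funext => n; rewrite !fps_addE /res.
have : (n %% 3 < 3)%N by rewrite ltn_mod.
by case: (n %% 3)%N => [|[|[|]]] //= _; rewrite ?addr0 ?add0r.
Qed.

Lemma res32_mul f g : res 3 2 f = 0 -> res 3 2 g = 0 ->
  res 3 2 (f * g) = res 3 1 f * res 3 1 g.
Proof.
move=> f2 g2; rewrite {1}(res3_sum f) {1}(res3_sum g) f2 g2 !addr0.
have pc i j : supp 3 (i + j) (res 3 i f * res 3 j g).
  by apply: supp_mul; apply: supp_res.
rewrite mulrDl !mulrDr !resD (res_supp0 (pc 0%N 0%N)) // (res_supp0 (pc 0%N 1%N)) //.
by rewrite (res_supp0 (pc 1%N 0%N)) // !add0r (res_supp (pc 1%N 1%N)).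
Qed.

Lemma res31_mul f g : res 3 2 f = 0 -> res 3 2 g = 0 ->
  res 3 1 (f * g) = res 3 0 f * res 3 1 g + res 3 1 f * res 3 0 g.
Proof.
move=> f2 g2; rewrite {1}(res3_sum f) {1}(res3_sum g) f2 g2 !addr0.
have pc i j : supp 3 (i + j) (res 3 i f * res 3 j g).
  by apply: supp_mul; apply: supp_res.
rewrite mulrDl !mulrDr !resD (res_supp0 (pc 0%N 0%N)) // (res_supp0 (pc 1%N 1%N)) //.
by rewrite add0r addr0 (res_supp (pc 0%N 1%N)) (res_supp (pc 1%N 0%N)).
Qed.

Notation Eser := (res 3 0 Fser).

Lemma sq_mod3 a : (sq a %% 3)%N = if (a %% 3)%Z == 0 then 0%N else 1%N.
Proof.
have : (a %% 3)%Z = 0 \/ (a %% 3)%Z = 1 \/ (a %% 3)%Z = 2 by lia.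
have : (sq a)%:Z = 3 * (3 * (a %/ 3)%Z ^+ 2 + 2 * (a %/ 3)%Z * (a %% 3)%Z)
                   + (a %% 3)%Z ^+ 2.
  by rewrite sqE {1}(divz_eq a 3); ring.
move: (3 * _ ^+ 2 + 2 * _ * _) => X sqX.
by case=> [|[|]] mE; rewrite mE /= in sqX *; lia.
Qed.

Lemma D_res : D = res 3 1 Fser.
Proof.
rewrite res_xsum; apply: (xsum_bij _
  (h := fun n : nat => if (n %% 4)%N == 1%N then n%:Z else - n%:Z) (g := absz)).
  move=> n /= /andP[n0]; rewrite -gcdn_modl => n6.
  have {}n6 : (n %% 6 = 1 \/ n %% 6 = 5)%N.
    have : (n %% 6 < 6)%N by rewrite ltn_mod.
    by move: n6; case: (n %% 6)%N => [|[|[|[|[|[|]]]]]] //; auto.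
  split; last by rewrite /sq; case: ifP => _; rewrite ?abszN.
    by rewrite /one4 /= sq_mod3; case: ifP => n4; split; try case: ifP; lia.
  by case: ifP => _; rewrite ?abszN.
move=> a; rewrite /one4 /= sq_mod3 => -[a4 a3].
have {}a3 : (a %% 3)%Z != 0 by move: a3; case: ifP.
split.
  apply/andP; split; first by lia.
  rewrite -gcdn_modl.
  have [->|->] : (`|a| %% 6 = 1 \/ `|a| %% 6 = 5)%N by lia.
    by [].
  by [].
by case: ifP; lia.
Qed.

Lemma res32_F : res 3 2 Fser = 0.
Proof.
rewrite res_xsum; apply/funext => n; apply: xsum0P => a [_].
by rewrite sq_mod3; case: ifP.
Qed.

Lemma E_dilate : Eser = dilate 9 Fser.
Proof.
rewrite res_xsum dilate_F //; apply/esym.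
apply: (xsum_bij _ (h := fun b => - 3 * b) (g := fun a => (- a %/ 3)%Z)).
  move=> b b1; have {}b1 : (b %% 4)%Z = 1 by [].
  split; [|lia|sqring]; rewrite /one4 /= sq_mod3; split; first by lia.
  by case: ifP; lia.
move=> a; rewrite /one4 /= sq_mod3 => -[a1 a3].
have {}a3 : (a %% 3)%Z = 0 by move: a3; case: ifP => // /eqP.
by split; lia.
Qed.

Lemma F_DE : Fser = D + Eser.
Proof. by rewrite {1}(res3_sum Fser) res32_F addr0 addrC D_res. Qed.

Lemma series_coef0M (f g : series) : (f * g) 0%N = f 0%N * g 0%N.
Proof. by rewrite fps_mulE big_ord_recl big_ord0 addr0. Qed.

Lemma D_coef0 : D 0%N = 0.
Proof. by rewrite D_res. Qed.

Lemma D_coef1 : D 1%N = 1.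
Proof.
rewrite /D /xsum (fsbigE [:: 1%N]) //=.
- by rewrite big_cons big_nil ifT ?addr0 //; apply/mem_set.
- by move=> n /=; rewrite inE => /eqP ->.
move=> n /andP[n0 _]; rewrite inE => n1; case: eqP => // nn.
by case/negP: n1; rewrite -(eqn_exp2r _ _ (isT : (0 < 2)%N)) nn.
Qed.

Lemma D_neq0 : D <> 0.
Proof. by move=> D0; have := D_coef1; rewrite D0 => /eqP; rewrite eq_sym oner_eq0. Qed.

(** With D = F + F(x^9), adding the level 3 equation to its dilation by 3 cancels the fourth power
    of F(x^3) and leaves D^4 = F(x^3) (F + F(x^9)) = F(x^3) D. *)
Lemma level3_D : D ^+ 3 = dilate 3 Fser /\ Eser ^+ 4 = Eser * D ^+ 3 + D ^+ 12.
Proof.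
pose F1 := dilate 3 Fser.
have h0 : (Fser + F1) ^+ 4 = Fser * F1 by rewrite level3_F.
have h1 : (F1 + Eser) ^+ 4 = F1 * Eser.
  have -> : Eser = dilate 3 F1 by rewrite E_dilate dilate_comp.
  by rewrite -dilateD -dilateX // h0 dilateM.
have DE : D = Fser + Eser by rewrite {1}F_DE -addrA addss addr0.
have D4 : D * (D ^+ 3 + F1) = 0.
  rewrite mulrDr -exprS; apply/adds_eq0.
  rewrite {1}DE (exprDpow2 _ _ 2) DE mulrDl -h0 [_ * F1]mulrC -h1.
  by rewrite !(exprDpow2 _ _ 2) -addrA addsK.
have D3 : D ^+ 3 = F1 by case/series_mul_eq0: D4 => [/D_neq0//|/adds_eq0].
split=> //; rewrite D3.
have -> : D ^+ 12 = F1 ^+ 4 by rewrite -D3 -exprM.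
by move: h1; rewrite (exprDpow2 _ _ 2) mulrC => <-; rewrite addrAC addss add0r.
Qed.

Lemma res_dilate_F k r : (k * k = 1 %[mod 3])%N -> (0 < k)%N ->
  (k * r = 1 %[mod 3])%N -> res 3 r (dilate k Fser) = dilate k D.
Proof.
by move=> kk k0 kr; rewrite res_dilate // D_res; congr dilate; rewrite /res kr.
Qed.

Lemma res_dilate_F0 k r : (k * k = 1 %[mod 3])%N -> (0 < k)%N ->
  (k * r = 2 %[mod 3])%N -> res 3 r (dilate k Fser) = 0.
Proof.
move=> kk k0 kr; rewrite res_dilate //.
have -> : res 3 (k * r) Fser = res 3 2 Fser by rewrite /res kr.
by rewrite res32_F dilate0.
Qed.

(** The part of [level7_F] with exponents 2 mod 3: the eighth powers survive since 8 is 2 mod 3, the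
    sixteenth powers drop out since 16 is 1 mod 3 and F has no exponent 2 mod 3. *)
Lemma level7_D : D ^+ 8 + dilate 7 D ^+ 8 =
  D * dilate 7 D + D ^+ 4 * dilate 7 D ^+ 4.
Proof.
have FF7 : res 3 2 (Fser * dilate 7 Fser) = D * dilate 7 D.
  rewrite (res32_mul res32_F) ?(@res_dilate_F0 7 2) //.
  by rewrite -D_res (@res_dilate_F 7 1).
rewrite -exprMn; have := congr1 (res 3 2) level7_F; rewrite !resD.
rewrite (series_exp2 _ 2) res_dilate // (exprDpow2 _ _ 3) (exprDpow2 _ _ 4).
rewrite !(series_exp2 _ 3) !(series_exp2 _ 4) !dilate_comp // !resD.
have -> : res 3 (2 ^ 2 * 2) (Fser * dilate 7 Fser) = D * dilate 7 D.
  have -> : res 3 (2 ^ 2 * 2) = res 3 2 by apply/funext.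
  exact: FF7.
rewrite FF7 (@res_dilate_F (2 ^ 3) 2) // (@res_dilate_F (2 ^ 3 * 7) 2) //.
rewrite (@res_dilate_F0 (2 ^ 4) 2) // (@res_dilate_F0 (2 ^ 4 * 7) 2) // !addr0.
by rewrite -(series_exp2 _ 2) => ->.
Qed.

Lemma F5_sum : Fser = F5 1 + F5 4 + F5 0.
Proof.
apply/funext => n; rewrite !fps_addE /res.
have := sq_mod5; have : (n %% 5 < 5)%N by rewrite ltn_mod.
move=> n5 sq5; have n23 : (n %% 5 = 2 \/ n %% 5 = 3)%N -> Fser n = 0.
  move=> nE; apply: xsum0P => a _; apply/eqP => sa.
  by have := sq5 a; rewrite sa; do !case: ifP => _; case: nE => ->.
move: n23 n5; case: (n %% 5)%N => [|[|[|[|[|]]]]] //= n23 _;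
  rewrite ?addr0 ?add0r //; apply: n23; auto.
Qed.

Lemma F5_0 : F5 0 = dilate 25 Fser.
Proof.
rewrite res_xsum dilate_F //; apply/esym.
apply: (xsum_bij _ (h := fun b => 5 * b) (g := fun a => (a %/ 5)%Z)).
  move=> b b1; have {}b1 : (b %% 4)%Z = 1 by [].
  split; [|lia|sqring]; rewrite /one4 /= sq_mod5; split; first by lia.
  by do !case: ifP; lia.
move=> a; rewrite /one4 /= sq_mod5 => -[a1 a5].
have {}a5 : (a %% 5)%Z = 0 by move: a5; do !case: ifP => //; lia.
by split; lia.
Qed.

(** By [hecke_split] with r = 1, the two preimages are the pairs with c = 1 mod 4 and d = 0,
    respectively d = 2, mod 4. In their union d and -d cancel, and d = 0 leaves [Fser]. *)
Lemma hecke5_F5 : hecke 5 (Fser * dilate 4 Fser) = Fser.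
Proof.
have -> : Fser * dilate 4 Fser = xsum 'F_2 (one4 `*` one4) normG by rewrite F_mul1.
rewrite (hecke_split (r := 1)) //; last first.
  zpair c d; rewrite /one4 /=; split=> -[/= ? ?]; split=> /=; lia.
have -> : xsum 'F_2 [set z | (one4 `*` one4) (mulG 1 z)] normG =
    xsum 'F_2 [set z : int * int | (z.1 %% 4)%Z = 1 /\ (z.2 %% 4)%Z = 0] normG.
  apply: eq_xsum => //; zpair c d; rewrite /one4 /mulG /=.
  by split=> -[/= ? ?]; split=> /=; lia.
have -> : xsum 'F_2 [set z | (one4 `*` one4) (mulGbar 1 z)] normG =
    xsum 'F_2 [set z : int * int | (z.1 %% 4)%Z = 1 /\ (z.2 %% 4)%Z = 2] normG.
  apply: eq_xsum => //; zpair c d; rewrite /one4 /mulGbar /=.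
  by split=> -[/= ? ?]; split=> /=; lia.
set A := [set z | _]; set B := [set z | _].
rewrite -(@xsumU _ _ A B [set z | (z.1 %% 4)%Z = 1 /\ (z.2 %% 2)%Z = 0]); first last.
- by zpair c d => -[/= _ ?] [/= _]; lia.
- by zpair c d; rewrite /A /B /=; lia.
- exact: finite_normG.
rewrite (@xsumU _ _ [set z | one4 z.1 /\ z.2 = 0]
  [set z | [/\ one4 z.1, z.2 <> 0 & (z.2 %% 2)%Z = 0]]); first last.
- by zpair c d => -[/= _ ?] [].
- zpair c d; rewrite /one4 /=; split; last by case=> -[] // -> ->.
  move=> [? ?]; have [->|/eqP ?] := eqVneq d 0; first by left.
  by right.
- exact: finite_normG.
rewrite [X in _ + X](@xsum_double _
    [set z | [/\ one4 z.1, 0 < z.2 & (z.2 %% 2)%Z = 0]]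
    [set z | [/\ one4 z.1, z.2 < 0 & (z.2 %% 2)%Z = 0]] _ _ (fun z => (z.1, - z.2))).
- rewrite addr0; apply: (xsum_bij _ (h := fst) (g := fun c => (c, 0))).
    by zpair c d => -[/= c1 ->]; split=> //; rewrite /normG /= addn0.
  by move=> c c1; split.
- exact: finite_normG.
- zpair c d; split; last by case=> -[/= ? ? ?]; split=> //=; lia.
  move=> [/= ? ? ?]; have [?|?] : 0 < d \/ d < 0 by lia.
    by left.
  by right.
- by zpair c d => -[/= _ ? _] [/= _]; lia.
- by zpair c d => -[/= ? ? ?]; split=> //=; lia.
- by zpair c d => -[/= ? ? ?]; split=> //=; lia.
- by zpair c d; rewrite /= opprK.
by zpair c d; rewrite /normG /= sqN.
Qed.

Lemma res_supp_mod m r s f : supp m s f -> s = r %[mod m] -> res m r f = f.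
Proof. by move=> fs sr; apply: res_supp; apply: supp_mod fs. Qed.

(** Dilating [hecke5_F5] by 5 isolates the exponents of F F(x^4) divisible by 5. Among the products
    of mod 5 parts only the three diagonal ones have such exponents, and the one from [F5 0] cancels
    the other summand of the Hecke operator. *)
Lemma F5_pow5 : F5 1 ^+ 5 + F5 4 ^+ 5 = dilate 5 Fser.
Proof.
have := congr1 (dilate 5) hecke5_F5; rewrite heckeE dilateD.
rewrite -(res_dilate_self _ (m := 5)) // !dilateM // !dilate_comp //.
have pc i j : supp 5 (i + 4 * j) (F5 i * dilate 4 (F5 j)).
  by apply: supp_mul; [exact: supp_res|apply/supp_dilate/supp_res].
rewrite {1 2}F5_sum !dilateD !mulrDl !mulrDr !resD.
rewrite (res_supp_mod (pc 1%N 1%N)) // (res_supp0 (pc 1%N 4%N)) //.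
rewrite (res_supp0 (pc 1%N 0%N)) // (res_supp0 (pc 4%N 1%N)) //.
rewrite (res_supp_mod (pc 4%N 4%N)) // (res_supp0 (pc 4%N 0%N)) //.
rewrite (res_supp0 (pc 0%N 1%N)) // (res_supp0 (pc 0%N 4%N)) //.
rewrite (res_supp_mod (pc 0%N 0%N)) // !F5_0 !dilate_comp // !addr0 !add0r.
rewrite -addrA addss addr0 => <-.
by rewrite !(exprS _ 4); congr (_ * _ + _ * _); exact: (series_exp2 _ 2).
Qed.

Lemma res_comm m r k s f : res m r (res k s f) = res k s (res m r f).
Proof. by apply/funext => n; rewrite /res; do 2 case: ifP. Qed.

(** A and B are the parts of D with exponents 1 and 4 mod 5. Their sum, product and sum of fifth
    powers are known in terms of b = D(x^5) and c = D(x^25). Eliminating A and B shows that the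
    defect [R] of the claim equals its own dilation by 5, so it vanishes. *)
Lemma level5_D : D * dilate 5 D = D ^+ 6 + dilate 5 D ^+ 6.
Proof.
set b := dilate 5 D; pose c := dilate 25 D.
pose A := res 3 1 (F5 1); pose B := res 3 1 (F5 4).
have F5_2 r : res 3 2 (F5 r) = 0 by rewrite res_comm res32_F res0.
have ABsum : A + B = D + c.
  rewrite D_res [in RHS]F5_sum !resD F5_0 (@res_dilate_F 25 1) //.
  by rewrite -/c -addrA addss addr0.
have ABmul : A * B = c ^+ 2.
  rewrite -(res32_mul (F5_2 1%N) (F5_2 4)) F5_mul resD !series_sqr.
  rewrite !dilate_comp // (@res_dilate_F0 (2 * 5) 2) //.
  by rewrite (@res_dilate_F (2 * 25) 2) // add0r.
have AB5 : A ^+ 5 + B ^+ 5 = b.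
  have := congr1 (res 3 2) F5_pow5; rewrite (@res_dilate_F 5 2) // -/b => <-.
  have P5 (f : series) : res 3 2 f = 0 -> res 3 2 (f ^+ 5) = res 3 1 f ^+ 5.
    move=> f2; have f4 : f ^+ 4 = dilate 4 f := series_exp2 f 2.
    rewrite !(exprS _ 4) f4 res32_mul // ?res_dilate //.
      have -> : res 3 (4 * 1) f = res 3 1 f by [].
      by congr (_ * _); exact/esym/(series_exp2 _ 2).
    by have -> : res 3 (4 * 2) f = res 3 2 f; rewrite // f2 dilate0.
  by rewrite resD !P5.
(* A^5 + B^5 = s^5 + s^3 t + s t^2 mod 2 for s = A + B and t = AB, here with t = c^2. *)
have bE : b = (D + c) * ((D + c) ^+ 4 + (D + c) ^+ 2 * c ^+ 2 + c ^+ 4).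
  rewrite -AB5 -ABsum -ABmul (_ : c ^+ 4 = (A * B) ^+ 2); last first.
    by rewrite ABmul -exprM.
  apply: (eq_mod2 (Z := A ^+ 5 + B ^+ 5 + 3 * A ^+ 4 * B + 7 * A ^+ 3 * B ^+ 2
    + 7 * A ^+ 2 * B ^+ 3 + 3 * A * B ^+ 4)); ring.
pose R := D * b + (D ^+ 6 + b ^+ 6).
suff R0 : R = 0 by apply/adds_eq0.
apply: (@dilate_fixed 5) => //.
  have b0 : b 0%N = 0 := D_coef0.
  by rewrite /R !fps_addE !(exprS _ 5) !series_coef0M D_coef0 b0 !mul0r !addr0.
have -> : dilate 5 R = b * c + (b ^+ 6 + c ^+ 6).
  by rewrite /R !dilateD dilateM // !dilateX // /b dilate_comp.
apply: (eq_mod2 (Z := D ^+ 6 + 3 * D ^+ 5 * c + 8 * D ^+ 4 * c ^+ 2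
  + 12 * D ^+ 3 * c ^+ 3 + 11 * D ^+ 2 * c ^+ 4 + 6 * D * c ^+ 5
  + 2 * c ^+ 6 + b ^+ 6)).
have -> : R + (b * c + (b ^+ 6 + c ^+ 6)) =
  b * (D + c) + D ^+ 6 + c ^+ 6 + (b ^+ 6 + b ^+ 6) by rewrite /R; ring.
by rewrite {1}bE; ring.
Qed.

(** * Recurrences for the Hecke images of the powers of D *)

Section SpanF2.
Variable S : set series.

Lemma span_mem f : S f -> Defs.span S f.
Proof.
move=> Sf; exists 1%N, (fun=> 1), (fun=> f); split=> //.
by rewrite big_ord_recl big_ord0 addr0 scale1r.
Qed.

Lemma span0 : Defs.span S 0.
Proof.
by exists 0%N, (fun=> 0), (fun=> 0); rewrite big_ord0; split=> // -[].
Qed.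

Lemma spanD f g : Defs.span S f -> Defs.span S g -> Defs.span S (f + g).
Proof.
move=> [n [c [u [Su ->]]]] [m [d [v [Sv ->]]]].
exists (n + m)%N,
  (fun i : 'I_(n + m) => match fintype.split i with inl j => c j | inr j => d j end),
  (fun i : 'I_(n + m) => match fintype.split i with inl j => u j | inr j => v j end).
split; first by move=> i; case: (fintype.split i).
rewrite big_split_ord /=; congr (_ + _); apply: eq_bigr => i _.
  by rewrite -[lshift m i]/(unsplit (inl i)) unsplitK.
by rewrite -[rshift n i]/(unsplit (inr i)) unsplitK.
Qed.

Lemma span_ind (Q : series -> Prop) :
  Q 0 -> (forall f g, Q f -> Q g -> Q (f + g)) -> (forall f, S f -> Q f) ->
  forall f, Defs.span S f -> Q f.
Proof.
move=> Q0 QD QS _ [n [c [u [Su ->]]]]; elim/big_ind: _ => // i _.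
have [->|ci] := eqVneq (c i) 0; first by rewrite scale0r.
suff -> : c i = 1 by rewrite scale1r; apply: QS.
by move: (c i) ci => [[|[|]]] // ? _; apply/val_inj.
Qed.

Lemma span_sum (I : Type) (r : seq I) (P : pred I) (F : I -> series) :
  (forall i, P i -> Defs.span S (F i)) -> Defs.span S (\sum_(i <- r | P i) F i).
Proof. by move=> H; elim/big_ind: _ => //; [exact: span0|exact: spanD]. Qed.

End SpanF2.

Lemma span_subset (S T : set series) : S `<=` Defs.span T -> Defs.span S `<=` Defs.span T.
Proof.
move=> ST; apply: span_ind; [exact: span0|exact: spanD|exact: ST].
Qed.

Definition spanX (P : nat -> Prop) : set series := Defs.span [set D ^+ n | n in P].

Lemma spanX_mem (P : nat -> Prop) n : P n -> spanX P (D ^+ n).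
Proof. by move=> Pn; apply: span_mem; exists n. Qed.

Lemma sub_spanX (P Q : nat -> Prop) : (forall n, P n -> Q n) ->
  spanX P `<=` spanX Q.
Proof.
by move=> PQ; apply: span_subset => _ [n Pn <-]; apply: spanX_mem; apply: PQ.
Qed.

Lemma spanX_mul (P Q : nat -> Prop) k f : (forall n, P n -> Q (k + n)%N) ->
  spanX P f -> spanX Q (D ^+ k * f).
Proof.
move=> PQ; move: f; apply: span_ind; first by rewrite mulr0; exact: span0.
  by move=> f g Qf Qg; rewrite mulrDr; exact: spanD.
by move=> _ [n Pn <-]; rewrite -exprD; apply: spanX_mem; exact: PQ.
Qed.

Lemma spanX_hecke p (P Q : nat -> Prop) f :
  (forall n, P n -> spanX Q (hecke p (D ^+ n))) ->
  spanX P f -> spanX Q (hecke p f).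
Proof.
move=> PQ; move: f; apply: span_ind; first by rewrite hecke0; exact: span0.
  by move=> f g Qf Qg; rewrite heckeD; exact: spanD.
by move=> _ [n Pn <-]; exact: PQ.
Qed.

Lemma D_pow_low n m : (m < n)%N -> (D ^+ n) m = 0.
Proof.
elim: n m => // n IHn m; rewrite ltnS => mn; rewrite exprSr fps_mulE.
rewrite big_ord_recr /= subnn D_coef0 mulr0 addr0 big1 // => i _.
by rewrite IHn ?mul0r // (leq_trans _ mn).
Qed.

Lemma D_pow_diag n : (D ^+ n) n = 1.
Proof.
elim: n => [|n IHn]; first by rewrite expr0 fps_1E.
rewrite exprSr fps_mulE !big_ord_recr /= subnn D_coef0 mulr0 addr0.
rewrite big1 ?add0r => [|i _]; last by rewrite D_pow_low ?mul0r.
by rewrite subSnn D_coef1 mulr1 IHn.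
Qed.

Lemma D_pow_free N (c : nat -> 'F_2) :
  \sum_(i < N) c i *: D ^+ i = 0 -> forall i, (i < N)%N -> c i = 0.
Proof.
move=> sum0; elim/ltn_ind => i IHi iN.
have := congr1 (fun f : series => f i) sum0; rewrite fps_sumE.
rewrite (bigD1 (Ordinal iN)) //= [X in X + _](_ : _ = c i); last first.
  by transitivity (c i * (D ^+ i) i); rewrite // D_pow_diag mulr1.
rewrite big1 ?addr0 // => j; rewrite -val_eqE /= => ji.
transitivity (c j * (D ^+ j) i) => //.
case: (ltngtP j i) ji => // [ji|ij] _; first by rewrite IHi ?mul0r.
by rewrite D_pow_low ?mulr0.
Qed.

(** Linear independence of the powers of D as a membership test, the form in which leading terms are
    compared later. *)
Lemma D_pow_indep (P : nat -> Prop) n : spanX P (D ^+ n) -> P n.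
Proof.
have coord f : spanX P f -> exists N (c : nat -> 'F_2),
    (forall i, c i != 0 -> P i) /\ f = \sum_(i < N) c i *: D ^+ i.
  move: f; apply: span_ind.
  - by exists 0%N, (fun=> 0); rewrite big_ord0; split=> // i; rewrite eqxx.
  - move=> _ _ [N [c [cP ->]]] [M [d [dP ->]]].
    exists (N + M)%N, (fun i => (if (i < N)%N then c i else 0) +
                               (if (i < M)%N then d i else 0)); split.
      move=> i; case: ifP => _; case: ifP => _; rewrite ?addr0 ?add0r ?eqxx //.
      + have [->|ci] := eqVneq (c i) 0; first by rewrite add0r; exact: dP.
        by move=> _; exact: cP.
      + exact: cP.
      + exact: dP.
    rewrite (eq_bigr _ (fun i _ => scalerDl _ _ _)) big_split /=.
    congr (_ + _).
      rewrite (big_ord_widen _ (fun i => c i *: D ^+ i) (leq_addr M N)) big_mkcond.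
      by apply: eq_bigr => i _; case: ifP; rewrite ?scale0r.
    rewrite (big_ord_widen _ (fun i => d i *: D ^+ i) (leq_addl N M)) big_mkcond.
    by apply: eq_bigr => i _; case: ifP; rewrite ?scale0r.
  move=> _ [m Pm <-]; exists m.+1, (fun i => (i == m)%:R); split.
    by move=> i; case: (eqVneq i m) => [->|]; rewrite ?eqxx.
  rewrite big_ord_recr /= eqxx scale1r big1 ?add0r // => i _.
  by rewrite (ltn_eqF (ltn_ord i)) scale0r.
move=> /coord [N [c [cP DnE]]].
pose c' i := (if (i < N)%N then c i else 0) + (i == n)%:R.
have /D_pow_free -/(_ n) : \sum_(i < N + n.+1) c' i *: D ^+ i = 0.
  rewrite (eq_bigr _ (fun i _ => scalerDl _ _ _)) big_split /=; apply/adds_eq0; rewrite -[LHS](_ : D ^+ n = _).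
    rewrite (bigD1 (Ordinal (_ : (n < N + n.+1)%N))) ?leq_addl //= => lt.
    rewrite eqxx scale1r big1 ?addr0 // => i; rewrite -val_eqE /= => /negbTE ->.
    by rewrite scale0r.
  rewrite DnE (big_ord_widen _ (fun i => c i *: D ^+ i) (leq_addr n.+1 N)).
  by rewrite big_mkcond; apply: eq_bigr => i _; case: ifP; rewrite ?scale0r.
rewrite leq_addl /c' eqxx => /(_ isT); case: ifP => // _ cn.
by apply: cP; apply/eqP => c0; move/eqP: cn; rewrite c0 add0r oner_eq0.
Qed.

Lemma hecke_one p : (0 < p)%N -> hecke p 1 = 0.
Proof.
move=> p0; rewrite heckeE dilate1 //; suff -> : contract p 1 = 1 by rewrite addss.
by apply/funext => n; rewrite /contract !fps_1E muln_eq0 (gtn_eqF p0).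
Qed.

Lemma hecke7_F : hecke 7 Fser = 0.
Proof.
have -> : Fser = xsum 'F_2 [set z : int * int | one4 z.1 /\ z.2 = 0] normG.
  apply/esym/(xsum_bij _ (h := fst) (g := fun c => (c, 0))) => [|c c1] //.
  by zpair c d => -[/= c1 ->]; split=> //; rewrite /normG /= addn0.
by apply: hecke_inert; zpair c d; rewrite /one4 /=; split=> -[? ?]; split; lia.
Qed.

Lemma hecke5_F : hecke 5 Fser = 0.
Proof.
rewrite heckeE contract_xsum // dilate_F //; apply/adds_eq0/esym.
apply: (xsum_bij _ (h := fun b => 5 * b) (g := fun a => (a %/ 5)%Z)).
  move=> b b1; have {}b1 : (b %% 4)%Z = 1 by [].
  have E : sq (5 * b) = (5 * (5 * sq b))%N by sqring.
  by split; [split; [rewrite /one4 /=; lia|rewrite E dvdn_mulr] | lia | rewrite E mulKn].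
move=> a; rewrite /one4 /= => -[a1]; rewrite /dvdn sq_mod5 => a5.
have {}a5 : (a %% 5)%Z = 0 by move: a5; do !case: ifP; lia.
by split; lia.
Qed.

Lemma hecke_D p : (p * p = 1 %[mod 3])%N -> (0 < p)%N -> hecke p Fser = 0 ->
  hecke p D = 0.
Proof.
by move=> pp p0 F0; rewrite D_res hecke_res // F0 res0.
Qed.

Lemma hecke7_D : hecke 7 D = 0. Proof. exact: hecke_D hecke7_F. Qed.
Lemma hecke5_D : hecke 5 D = 0. Proof. exact: hecke_D hecke5_F. Qed.

Lemma res_FF4 : res 3 2 (Fser * dilate 4 Fser) = D ^+ 5.
Proof.
rewrite (res32_mul res32_F) ?(@res_dilate_F0 4 2) // (@res_dilate_F 4 1) //.
by rewrite -D_res (exprS _ 4); congr (_ * _); exact/esym/(series_exp2 _ 2).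
Qed.

Lemma hecke7_D5 : hecke 7 (D ^+ 5) = 0.
Proof.
rewrite -res_FF4 hecke_res // (_ : hecke 7 _ = 0) ?res0 //.
rewrite F_mul1 //; apply: (hecke_inert (A := one4 `*` one4)).
by zpair c d; rewrite /one4 /=; split=> -[/= ? ?]; split=> /=; lia.
Qed.

(* [hecke p] turns a relation between [f] and [f(x^p)] that is symmetric in the
   two into a linear recurrence satisfied by [hecke p (f^n)]. *)
Lemma hecke_mono p f i j : (0 < p)%N ->
  contract p (dilate p f ^+ i * f ^+ j) = f ^+ i * contract p (f ^+ j).
Proof. by move=> p0; rewrite -dilateX // contract_dilateM. Qed.

Lemma hecke7_rec n : hecke 7 (D ^+ (n + 8)) =
  D ^+ 4 * hecke 7 (D ^+ (n + 4)) + D * hecke 7 (D ^+ (n + 1)) +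
  D ^+ 8 * hecke 7 (D ^+ n).
Proof.
set y := dilate 7 D.
have rel : D ^+ 8 = D * y + D ^+ 4 * y ^+ 4 + y ^+ 8.
  by rewrite -level7_D -addrA addss addr0.
have rel' : y ^+ 8 = D * y + D ^+ 4 * y ^+ 4 + D ^+ 8.
  by rewrite -level7_D addrAC addss add0r.
rewrite !heckeE !dilateX // -/y !mulrDr.
have -> : D ^+ (n + 8) = y ^+ 4 * D ^+ (n + 4) + y ^+ 1 * D ^+ (n + 1) + y ^+ 8 * D ^+ n.
  by rewrite !exprD rel; move: (D ^+ n) => Dn; ring.
have -> : y ^+ (n + 8) = D ^+ 4 * y ^+ (n + 4) + D * y ^+ (n + 1) + D ^+ 8 * y ^+ n.
  by rewrite !exprD rel'; move: (y ^+ n) => yn; ring.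
rewrite !contractD !hecke_mono // expr1; ring.
Qed.

Lemma hecke5_rec n : hecke 5 (D ^+ (n + 6)) =
  D * hecke 5 (D ^+ (n + 1)) + D ^+ 6 * hecke 5 (D ^+ n).
Proof.
set y := dilate 5 D.
have rel : D ^+ 6 = D * y + y ^+ 6 by rewrite level5_D -addrA addss addr0.
have rel' : y ^+ 6 = D * y + D ^+ 6 by rewrite level5_D addrAC addss add0r.
rewrite !heckeE !dilateX // -/y !mulrDr.
have -> : D ^+ (n + 6) = y ^+ 1 * D ^+ (n + 1) + y ^+ 6 * D ^+ n.
  by rewrite !exprD rel; move: (D ^+ n) => Dn; ring.
have -> : y ^+ (n + 6) = D * y ^+ (n + 1) + D ^+ 6 * y ^+ n.
  by rewrite !exprD rel'; move: (y ^+ n) => yn; ring.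
rewrite !contractD !hecke_mono // expr1; ring.
Qed.

Lemma pow6_mod2 (A B : series) :
  A ^+ 6 + B ^+ 6 = (A + B) ^+ 2 * ((A + B) ^+ 2 + A * B) ^+ 2.
Proof.
apply: (eq_mod2 (Z := A ^+ 6 + 4 * A ^+ 5 * B + 12 * A ^+ 4 * B ^+ 2
  + 17 * A ^+ 3 * B ^+ 3 + 12 * A ^+ 2 * B ^+ 4 + 4 * A * B ^+ 5 + B ^+ 6)).
by ring.
Qed.

(** For w = fg the hypothesis gives (f^8 + g^8)^2 = w^2 + w^8, so the last factor in [pow6_mod2]
    collapses to w^4. In u = f^6 and v = g^6 the result reads u^8 + v^8 = uv + u^2 v^2, which keeps
    recurrences inside one residue class mod 6. *)
Lemma level7_pow6 (f g : series) : f ^+ 8 + g ^+ 8 = f * g + f ^+ 4 * g ^+ 4 ->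
  f ^+ 48 + g ^+ 48 = f ^+ 6 * g ^+ 6 + f ^+ 12 * g ^+ 12.
Proof.
move=> h; have S2 : (f ^+ 8 + g ^+ 8) ^+ 2 = (f * g) ^+ 2 + (f * g) ^+ 8.
  by rewrite h (exprDpow2 _ _ 1) -!exprMn -exprM.
rewrite (exprM f 8 6) (exprM g 8 6) (pow6_mod2 (f ^+ 8)) S2 -!exprMn.
move: (f * g) => v; rewrite -addrA addss addr0 mulrDl -!exprM -!exprD.
by [].
Qed.

Lemma level7_D6 (y := dilate 7 D) :
  D ^+ 48 + y ^+ 48 = D ^+ 6 * y ^+ 6 + D ^+ 12 * y ^+ 12.
Proof. exact/level7_pow6/level7_D. Qed.

(** Raising the relation to the power Q = 2^e adds no terms, so for exponents 5 + 6M there is a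
    recurrence with shifts 8Q, 2Q and Q of M at every dyadic scale. *)
Lemma hecke7_rec6 e n : let Q := (2 ^ e)%N in
  hecke 7 (D ^+ (n + 48 * Q)) =
  D ^+ (12 * Q) * hecke 7 (D ^+ (n + 12 * Q)) +
  D ^+ (6 * Q) * hecke 7 (D ^+ (n + 6 * Q)) + D ^+ (48 * Q) * hecke 7 (D ^+ n).
Proof.
move=> Q; set y := dilate 7 D.
have sym : D ^+ (48 * Q) + y ^+ (48 * Q) =
    D ^+ (6 * Q) * y ^+ (6 * Q) + D ^+ (12 * Q) * y ^+ (12 * Q).
  rewrite !exprM -!exprMn -!exprDpow2 exprMn level7_D6.
  by rewrite exprMn.
have rel : D ^+ (48 * Q) = D ^+ (6 * Q) * y ^+ (6 * Q) +
    D ^+ (12 * Q) * y ^+ (12 * Q) + y ^+ (48 * Q).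
  by rewrite -sym -addrA addss addr0.
have rel' : y ^+ (48 * Q) = D ^+ (6 * Q) * y ^+ (6 * Q) +
    D ^+ (12 * Q) * y ^+ (12 * Q) + D ^+ (48 * Q).
  by rewrite -sym addrAC addss add0r.
rewrite !heckeE !dilateX // -/y !mulrDr.
have -> : D ^+ (n + 48 * Q) = y ^+ (12 * Q) * D ^+ (n + 12 * Q) +
    y ^+ (6 * Q) * D ^+ (n + 6 * Q) + y ^+ (48 * Q) * D ^+ n.
  rewrite !(exprD _ n) rel; move: (D ^+ n) (D ^+ (12 * Q)) (D ^+ (6 * Q)).
  by move: (y ^+ (6 * Q)) (y ^+ (12 * Q)) (y ^+ (48 * Q)) => *; ring.
have -> : y ^+ (n + 48 * Q) = D ^+ (12 * Q) * y ^+ (n + 12 * Q) +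
    D ^+ (6 * Q) * y ^+ (n + 6 * Q) + D ^+ (48 * Q) * y ^+ n.
  rewrite !(exprD _ n) rel'; move: (y ^+ n) (y ^+ (12 * Q)) (y ^+ (6 * Q)).
  by move: (D ^+ (6 * Q)) (D ^+ (12 * Q)) (D ^+ (48 * Q)) => *; ring.
rewrite !contractD !hecke_mono //.
by rewrite addrACA [X in X + _]addrACA.
Qed.

Lemma hecke7_D_sqr n : hecke 7 (D ^+ (2 * n)) = hecke 7 (D ^+ n) ^+ 2.
Proof. by rewrite mulnC exprM hecke_sqr. Qed.

Lemma hecke7_small n : (n < 7)%N -> hecke 7 (D ^+ n) = 0.
Proof.
pose T n := hecke 7 (D ^+ n).
have T0 : T 0%N = 0 by rewrite /T hecke_one.
have T1 : T 1%N = 0 by exact: hecke7_D.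
have T2 : T 2%N = 0 by rewrite /T (hecke7_D_sqr 1) -/(T 1%N) T1 expr0n.
have T4 : T 4%N = 0 by rewrite /T (hecke7_D_sqr 2) -/(T 2%N) T2 expr0n.
have T5 : T 5%N = 0 by exact: hecke7_D5.
have T8 : T 8%N = 0 by rewrite /T (hecke7_D_sqr 4) -/(T 4%N) T4 expr0n.
have T3 : T 3%N = 0.
  (* The fourth power of [T 3] is [T 12], which the recurrence expresses through [T 8], [T 5] and
     [T 4]. *)
  do 2 apply: series_sqr_eq0; rewrite /T -!hecke7_D_sqr (hecke7_rec 4).
  by rewrite -/(T 8%N) -/(T 5%N) -/(T 4%N) T8 T5 T4 !mulr0 !addr0.
have T6 : T 6%N = 0 by rewrite /T (hecke7_D_sqr 3) -/(T 3%N) T3 expr0n.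
by case: n => [|[|[|[|[|[|[|]]]]]]].
Qed.

(** X = T_7(D^7) satisfies X^2 = T_7(D^14) = DX by the recurrence; the coefficient of x decides
    between the roots 0 and D. *)
Lemma hecke7_D7 : hecke 7 (D ^+ 7) = D.
Proof.
have : hecke 7 (D ^+ 7) * (hecke 7 (D ^+ 7) + D) = 0.
  rewrite mulrDr -expr2 -hecke7_D_sqr (hecke7_rec 6) (hecke7_D_sqr 5).
  by rewrite (@hecke7_small 5) // (@hecke7_small 6) // expr0n !mulr0 add0r addr0 mulrC addss.
case/series_mul_eq0 => [T7|/adds_eq0 //].
have : hecke 7 (D ^+ 7) 1%N = 1.
  by rewrite heckeE fps_addE /contract muln1 D_pow_diag addr0.
by rewrite T7 => /eqP; rewrite eq_sym oner_eq0.
Qed.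

(** * Computed initial values of T_7 *)

Definition evD (s : seq nat) : series := \sum_(m <- s) D ^+ m.

(** Adds a monomial mod 2 to a list of exponents: one that is already present cancels. *)
Definition toggle m (s : seq nat) := if m \in s then rem m s else m :: s.

Lemma evD_toggle m s : evD (toggle m s) = D ^+ m + evD s.
Proof.
rewrite /toggle /evD; case: ifP => ms; last by rewrite big_cons.
by rewrite (perm_big _ (perm_to_rem ms)) big_cons addsK.
Qed.

Lemma evD_foldr s t : evD (foldr toggle t s) = evD s + evD t.
Proof.
elim: s => [|m s IHs] /=; first by rewrite /evD big_nil add0r.
by rewrite evD_toggle IHs /evD big_cons addrA.
Qed.

Lemma evD_shift k s : evD [seq (k + m)%N | m <- s] = D ^+ k * evD s.
Proof.
rewrite /evD big_map mulr_sumr; apply: eq_bigr => m _.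
by rewrite exprD.
Qed.

(* The exponents of the monomials of [hecke 7 (D^n)], ..., [hecke 7 (D^(n+7))]. *)
Definition hecke7_window n : seq (seq nat) :=
  let shift k s := [seq (k + m)%N | m <- s] in
  iter n (fun w => rcons (behead w)
    (foldr toggle (foldr toggle (shift 8 (nth [::] w 0)) (shift 1 (nth [::] w 1)))
       (shift 4 (nth [::] w 4))))
    (rcons (nseq 7 [::]) [:: 1]).

Lemma hecke7_windowP n i : (i < 8)%N ->
  hecke 7 (D ^+ (n + i)) = evD (nth [::] (hecke7_window n) i).
Proof.
have sz k : size (hecke7_window k) = 8.
  by elim: k => //= k IHk; rewrite size_rcons size_behead IHk.
elim: n i => [|n IHn] i i8.
  rewrite add0n; have [i7|i7] := ltnP i 7.
    rewrite hecke7_small //.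
    by case: i i7 {i8} => [|[|[|[|[|[|[|]]]]]]] //=; rewrite /evD big_nil.
  have -> : i = 7 by lia.
  by rewrite hecke7_D7 /evD big_cons big_nil addr0 expr1.
rewrite /= nth_rcons size_behead sz /= nth_behead.
have [i7|i7] := ltnP i 7; first by rewrite -IHn // addSnnS.
have -> : i = 7 by lia.
rewrite eqxx !evD_foldr !evD_shift -!IHn // addSnnS hecke7_rec addn0 expr1 addrA.
by [].
Qed.

(** Start of the induction for leading terms, read off by running the order 8 recurrence. *)
Lemma hecke7_base : forall M, (M < 8)%N -> hecke 7 (D ^+ (5 + 6 * M)) =
  evD [seq (5 + 6 * m)%N | m <- nth [::]
    [:: [::]; [:: 0]; [::]; [:: 2]; [:: 1]; [:: 4; 0]; [:: 3]; [:: 6; 2]] M].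
Proof.
move=> M M8; rewrite -[(5 + _)%N]addn0 hecke7_windowP //.
by case: M M8 => [|[|[|[|[|[|[|[|]]]]]]]].
Qed.

(** * Leading terms of T_7 *)

Lemma hecke7_pow n : spanX (fun m => (m <= n)%N /\ m = n %[mod 6]) (hecke 7 (D ^+ n)).
Proof.
elim/ltn_ind: n => n IHn; have [n8|n8] := ltnP n 8.
  have [n7|n7] := ltnP n 7; first by rewrite hecke7_small //; exact: span0.
  have -> : n = 7 by lia.
  by rewrite hecke7_D7 -[D]expr1; apply: spanX_mem.
rewrite -(subnK n8) hecke7_rec.
apply: spanD; first apply: spanD.
- by apply: spanX_mul (IHn (n - 8 + 4)%N _); [move=> m [] |]; lia.
- by apply: (spanX_mul (k := 1) _ (IHn (n - 8 + 1)%N _)); [move=> m [] |]; lia.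
- by apply: spanX_mul (IHn (n - 8)%N _); [move=> m [] |]; lia.
Qed.

Lemma hecke5_pow n :
  spanX (fun m => (m <= n)%N /\ m = 5 * n %[mod 6]) (hecke 5 (D ^+ n)).
Proof.
have sqr k : hecke 5 (D ^+ (2 * k)) = hecke 5 (D ^+ k) ^+ 2.
  by rewrite mulnC exprM hecke_sqr.
have T1 : hecke 5 (D ^+ 1) = 0 by exact: hecke5_D.
have T2 : hecke 5 (D ^+ 2) = 0 by rewrite (sqr 1%N) T1 expr0n.
have T4 : hecke 5 (D ^+ 4) = 0 by rewrite (sqr 2) T2 expr0n.
have T3 : hecke 5 (D ^+ 3) = 0.
  apply: series_sqr_eq0; rewrite -sqr (hecke5_rec 0) hecke_one // T1.
  by rewrite !mulr0 addr0.
elim/ltn_ind: n => n IHn; have [n6|n6] := ltnP n 6; last first.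
  rewrite -(subnK n6) hecke5_rec; apply: spanD.
    by apply: (spanX_mul (k := 1) _ (IHn (n - 6 + 1)%N _)); [move=> m [] |]; lia.
  by apply: spanX_mul (IHn (n - 6)%N _); [move=> m [] |]; lia.
case: n {IHn} n6 => [|[|[|[|[|[|]]]]]] // _; rewrite ?hecke_one ?T1 ?T2 ?T3 ?T4 //;
  try exact: span0.
(* X = T_5(D^5) satisfies X^2 = DX, and both roots 0 and D lie in the span. *)
have : hecke 5 (D ^+ 5) * (hecke 5 (D ^+ 5) + D) = 0.
  rewrite mulrDr -expr2 -sqr (hecke5_rec 4) T4 mulr0 addr0.
  by rewrite mulrC addss.
case/series_mul_eq0 => [->|/adds_eq0 ->]; first exact: span0.
by rewrite -[D]expr1; apply: spanX_mem.
Qed.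

(* Write [M] in base 4 with digits [j = 2 j' + j'']; let [b] and [a] be the
   numbers with binary digits [j'] and [j''].  Then [code M] is the triple
   [(2 a + 3 b, 0 < a, N)] where [N] has the digits of [a - 1] and [b]. *)
Fixpoint code_rec n M : nat * bool * nat :=
  if n is n'.+1 then
    let: (k, a, l) := code_rec n' (M %/ 4)%N in
    let j := (M %% 4)%N in
    (2 * k + nth 0%N [:: 0; 2; 3; 5] j, odd j || a,
     if odd j then M.-1 else if a then (4 * l + j.+1)%N else 0%N)
  else (0, false, 0)%N.

Definition code M := code_rec M M.
Definition wt M := (code M).1.1.
Definition has_a M := (code M).1.2.
Definition low M := (code M).2.

Lemma code_recE n m M : (M <= n)%N -> (M <= m)%N -> code_rec n M = code_rec m M.
Proof.
have zero k : code_rec k 0 = (0, false, 0)%N by elim: k => //= k ->.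
elim: n m M => [|n IHn] m M; first by rewrite leqn0 => /eqP ->; rewrite !zero.
case: m => [|m]; first by rewrite leqn0 => _ /eqP ->; rewrite !zero.
have [->|M0] := posnP M; first by rewrite !zero.
by move=> Mn Mm; rewrite /= (IHn m) //; lia.
Qed.

Lemma codeE M j : (j < 4)%N -> [/\
  wt (4 * M + j) = (2 * wt M + nth 0 [:: 0; 2; 3; 5] j)%N,
  has_a (4 * M + j) = odd j || has_a M &
  low (4 * M + j) = if odd j then (4 * M + j).-1
                    else if has_a M then (4 * low M + j.+1)%N else 0%N].
Proof.
move=> j4; rewrite /wt /has_a /low.
suff -> : code (4 * M + j) = let: (k, a, l) := code M in
    ((2 * k + nth 0 [:: 0; 2; 3; 5] j)%N, odd j || a,
     if odd j then (4 * M + j).-1%N else if a then (4 * l + j.+1)%N else 0%N).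
  by case: (code M) => [[k a] l].
have [/eqP|Mj] := posnP (4 * M + j)%N.
  by rewrite addn_eq0 muln_eq0 /= => /andP[/eqP -> /eqP ->].
rewrite /code -{1}(prednK Mj) /=.
have -> : ((4 * M + j) %/ 4 = M)%N by lia.
have -> : ((4 * M + j) %% 4 = j)%N by lia.
by rewrite (@code_recE _ M) //; lia.
Qed.

Lemma wtE M j : (j < 4)%N ->
  wt (4 * M + j) = (2 * wt M + nth 0 [:: 0; 2; 3; 5] j)%N.
Proof. by case/(codeE M). Qed.

Lemma base4 M : exists M' j, M = (4 * M' + j)%N /\ (j < 4)%N.
Proof. by exists (M %/ 4)%N, (M %% 4)%N; lia. Qed.

(** Carries do not increase the weight: replacing two digits by their carry and remainder is checked
    on all 16 pairs. *)
Lemma wt_add M N : (wt (M + N) <= wt M + wt N)%N.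
Proof.
have [n leMN] := ubnP (M + N)%N; elim: n => // n IHn in M N leMN *.
have [/eqP|MN0] := posnP (M + N)%N.
  by rewrite addn_eq0 => /andP[/eqP -> /eqP ->].
have [M' [i [ME i4]]] := base4 M; have [N' [j [NE j4]]] := base4 N.
pose c := ((i + j) %/ 4)%N; pose l := ((i + j) %% 4)%N.
have MNE : (M + N = 4 * (M' + (N' + c)) + l)%N by rewrite ME NE /c /l; lia.
have l4 : (l < 4)%N by rewrite ltn_mod.
rewrite MNE wtE //.
have [wM _ _] := codeE M' i4; have [wN _ _] := codeE N' j4.
rewrite -ME in wM; rewrite -NE in wN; rewrite wM wN.
have h1 : (wt (M' + (N' + c)) <= wt M' + wt (N' + c))%N by apply: IHn; lia.
have h2 : (wt (N' + c) <= wt N' + wt c)%N by apply: IHn; lia.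
suff : (2 * wt c + nth 0 [:: 0; 2; 3; 5] l <=
   nth 0 [:: 0; 2; 3; 5] i + nth 0 [:: 0; 2; 3; 5] j)%N by lia.
rewrite /c /l; clear -i4 j4.
by case: i i4 => [|[|[|[|]]]] //; case: j j4 => [|[|[|[|]]]].
Qed.

(** Concatenation of digit strings; if the lower string has a > 0, the borrow in a - 1 stops inside
    it. *)
Lemma code_cat s h l : (l < 4 ^ s)%N -> [/\
  wt (4 ^ s * h + l) = (2 ^ s * wt h + wt l)%N,
  has_a (4 ^ s * h + l) = has_a h || has_a l &
  has_a l -> low (4 ^ s * h + l) = (4 ^ s * h + low l)%N].
Proof.
elim: s l => [|s IHs] l.
  rewrite expn0 ltnS leqn0 => /eqP ->; rewrite !mul1n !addn0.
  by rewrite orbF.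
have [l' [j [-> j4]]] := base4 l => ls.
have l's : (l' < 4 ^ s)%N by move: ls; rewrite expnS; lia.
have [wl al ll] := codeE l' j4; have [wh ah lh] := IHs l' l's.
have -> : (4 ^ s.+1 * h + (4 * l' + j) = 4 * (4 ^ s * h + l') + j)%N.
  by rewrite expnS; lia.
have [-> -> ->] := codeE (4 ^ s * h + l') j4.
rewrite wl al ll wh ah; split; [by rewrite expnS; lia|by rewrite orbCA|].
case: ifP => /= [jodd _|_ l'a]; last by rewrite l'a orbT lh // expnS; lia.
by rewrite expnS; case: j jodd {j4 ls wl al ll} => //= j _; lia.
Qed.

(** Replacing a by a - 1 lowers 2a + 3b by 2. *)
Lemma low_wt M : has_a M -> (wt (low M) + 2 = wt M)%N.
Proof.
elim/ltn_ind: M => M IHM; have [M' [j [ME j4]]] := base4 M.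
have [wM aM lM] := codeE M' j4; rewrite -ME in wM aM lM.
rewrite wM aM lM; case: ifP => jodd /=.
  move=> _; have -> : (M.-1 = 4 * M' + j.-1)%N by case: (j) ME jodd => //; lia.
  rewrite wtE; last by lia.
  by move: jodd j4 {wM aM lM ME}; case: j => [|[|[|[|]]]] //=; lia.
move=> aM'; rewrite aM'; have M'M : (M' < M)%N.
  by case: (posnP M') aM' => [->|M'0 _] //; lia.
rewrite wtE; last by case: (j) jodd j4 => [|[|[|[|]]]].
have := IHM _ M'M aM'; move: jodd j4 {wM aM lM ME}.
by case: j => [|[|[|[|]]]] //=; lia.
Qed.

(* When the low digits of [M] have [a = 0], the borrow fills them with ones. *)
Lemma low_borrow s l : (l < 4 ^ s)%N -> ~~ has_a l ->
  exists2 y, (y < 4 ^ s)%N &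
    forall h, has_a h -> low (4 ^ s * h + l) = (4 ^ s * low h + y)%N.
Proof.
elim: s l => [|s IHs] l.
  rewrite expn0 ltnS leqn0 => /eqP -> _; exists 0%N => // h _.
  by rewrite !mul1n !addn0.
have [l' [j [-> j4]]] := base4 l => ls.
have l's : (l' < 4 ^ s)%N by move: ls; rewrite expnS; lia.
have [_ -> _] := codeE l' j4; rewrite negb_or => /andP[jev l'a].
have [y ys lowE] := IHs l' l's l'a.
exists (4 * y + j.+1)%N.
  by rewrite expnS; move: jev j4 ys; case: j {ls} => [|[|[|[|]]]] //; lia.
move=> h ha; have -> : (4 ^ s.+1 * h + (4 * l' + j) = 4 * (4 ^ s * h + l') + j)%N.
  by rewrite expnS; lia.
have [_ _ ->] := codeE (4 ^ s * h + l') j4.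
have [_ -> _] := code_cat h l's; rewrite (negbTE jev) ha /= lowE // expnS; lia.
Qed.

(** The map (a, b) -> (a - 1, b) is injective on a > 0; the proof compares last digits, which also
    reveal whether a borrow occurred. *)
Lemma low_inj M N : has_a M -> has_a N -> low M = low N -> M = N.
Proof.
elim/ltn_ind: M N => M IHM N.
have [M' [i [ME i4]]] := base4 M; have [N' [j [NE j4]]] := base4 N.
have [_ aM lM] := codeE M' i4; rewrite -ME in aM lM.
have [_ aN lN] := codeE N' j4; rewrite -NE in aN lN.
rewrite aM aN lM lN; case: (boolP (odd i)) => io; case: (boolP (odd j)) => jo /=.
- by move=> _ _; case: (M) ME io => [|?]; case: (N) NE jo => [|?] /=; lia.
- by case: (has_a N') => //; lia.
- by case: (has_a M') => //; lia.
move=> aM' aN'; rewrite aM' aN' => lowE.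
have M'M : (M' < M)%N by case: (posnP M') aM' => [->|M'0 _] //; lia.
have M'N' : M' = N' by apply: IHM => //; lia.
lia.
Qed.

Definition in6 (P : nat -> Prop) n := exists2 M, n = (5 + 6 * M)%N & P M.

Definition lead M : series := if has_a M then D ^+ (5 + 6 * low M) else 0.

(** Room for error terms: for w = [wt M] these weights are strictly less than the weight w - 2 of
    [lead M]. *)
Definition below w := spanX (in6 (fun M => wt M + 3 <= w)%N).

Lemma below_mul w v k f : (v + wt k <= w)%N -> below v f ->
  below w (D ^+ (6 * k) * f).
Proof.
move=> vw; apply: spanX_mul => _ [M -> Mv]; exists (k + M)%N; first by lia.
by have := wt_add k M; lia.
Qed.

Lemma below_mem w M : (wt M + 3 <= w)%N -> below w (D ^+ (5 + 6 * M)).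
Proof. by move=> Mw; apply: spanX_mem; exists M. Qed.

Definition eq_below w (f g : series) := below w (f + g).

Lemma eq_below_trans w f g h : eq_below w f g -> eq_below w g h -> eq_below w f h.
Proof.
by move=> fg gh; have := spanD fg gh; rewrite addrA -[_ + g + g]addrA addss addr0.
Qed.

(** The leading part [h] is normalised to a range spanning a factor 4. The recurrence at scale 4^s
    or 2 * 4^s then changes [h] alone, and the tail [l] is carried along. *)
Lemma top4 M : (8 <= M)%N -> exists s h l,
  [/\ M = (4 ^ s * h + l)%N, (8 <= h < 32)%N & (l < 4 ^ s)%N].
Proof.
elim/ltn_ind: M => M IHM M8; have [M32|M32] := ltnP M 32.
  by exists 0%N, M, 0%N; rewrite mul1n addn0 M8.
have [M' [j [ME j4]]] := base4 M; have M'M : (M' < M)%N by lia.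
have [|s [h [l [M'E h8 ls]]]] := IHM _ M'M; first by lia.
exists s.+1, h, (4 * l + j)%N; split=> //; last by rewrite expnS; lia.
by rewrite ME M'E expnS; lia.
Qed.

(* The three terms [D^(6 j) T(D^(5 + 6 h'))] of the recurrence for
   [T = hecke 7] at [h]. *)
Definition rec_terms h : seq (nat * nat) :=
  if (h < 16)%N then [:: (8, h - 8); (2, h - 6); (1, h - 7)]%N
  else [:: (16, h - 16); (4, h - 12); (2, h - 14)]%N.

(** Ensures that the error terms of the three smaller instances remain error terms after
    multiplication. *)
Lemma rec_terms_wt h t : (8 <= h < 32)%N -> t \in rec_terms h ->
  (wt t.1 + wt t.2 <= wt h)%N.
Proof.
move=> h8 th; suff /allP/(_ h) : all (fun h => all (fun t =>
    wt t.1 + wt t.2 <= wt h)%N (rec_terms h)) (iota 8 24).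
  by rewrite mem_iota => /(_ h8) /allP; apply.
by vm_compute.
Qed.

(** For a tail with a > 0, where the borrow does not touch [h]: of the three leading terms only one
    keeps full weight. *)
Lemma rec_terms_lead h : (8 <= h < 32)%N ->
  [seq t.1 + t.2 | t <- rec_terms h & wt h <= wt (t.1 + t.2)]%N = [:: h].
Proof.
move=> h8; suff /allP/(_ h) : all (fun h => [seq t.1 + t.2 | t <- rec_terms h &
    wt h <= wt (t.1 + t.2)]%N == [:: h]) (iota 8 24).
  by rewrite mem_iota => /(_ h8) /eqP.
by vm_compute.
Qed.

(** For a tail with a = 0, where the borrow reaches the leading digits: the only term of full weight
    is the one at [low h], and there is none if [h] has a = 0 too. *)
Lemma rec_terms_low h : (8 <= h < 32)%N ->
  [seq t.1 + low t.2 | t <- rec_terms h &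
     has_a t.2 && (wt h <= wt (t.1 + low t.2) + 2)]%N =
  if has_a h then [:: low h] else [::].
Proof.
move=> h8; suff /allP/(_ h) : all (fun h => [seq t.1 + low t.2 | t <- rec_terms h &
     has_a t.2 && (wt h <= wt (t.1 + low t.2) + 2)]%N ==
  if has_a h then [:: low h] else [::]) (iota 8 24).
  by rewrite mem_iota => /(_ h8) /eqP.
by vm_compute.
Qed.


Lemma sum3 (T : Type) (F : T -> series) a b c :
  \sum_(t <- [:: a; b; c]) F t = F a + (F b + F c).
Proof. by rewrite !big_cons big_nil addr0. Qed.

Lemma hecke7_terms s h l : (8 <= h < 32)%N ->
  hecke 7 (D ^+ (5 + 6 * (4 ^ s * h + l))) =
  \sum_(t <- rec_terms h)
    D ^+ (6 * (4 ^ s * t.1)) * hecke 7 (D ^+ (5 + 6 * (4 ^ s * t.2 + l))).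
Proof.
have step e w w2 w8 k : (w2 = 2 * w)%N -> (w8 = 8 * w)%N ->
    (4 ^ s * w = 2 ^ e)%N ->
    hecke 7 (D ^+ (5 + 6 * (4 ^ s * (k + w8) + l))) =
    D ^+ (6 * (4 ^ s * w8)) * hecke 7 (D ^+ (5 + 6 * (4 ^ s * k + l))) +
    (D ^+ (6 * (4 ^ s * w2)) * hecke 7 (D ^+ (5 + 6 * (4 ^ s * (k + w2) + l))) +
     D ^+ (6 * (4 ^ s * w)) * hecke 7 (D ^+ (5 + 6 * (4 ^ s * (k + w) + l)))).
  move=> -> -> ew; have ewM c : (4 ^ s * (c * w) = c * 2 ^ e)%N by rewrite mulnCA ew.
  have kwM c : (4 ^ s * (k + c * w) = 4 ^ s * k + c * 2 ^ e)%N.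
    by rewrite mulnDr ewM.
  have kw : (4 ^ s * (k + w) = 4 ^ s * k + 2 ^ e)%N by rewrite mulnDr ew.
  rewrite !kwM kw !ewM ew; have := hecke7_rec6 e (5 + 6 * (4 ^ s * k + l)).
  move: (4 ^ s * k)%N (2 ^ e)%N => x Q /=.
  have -> : (5 + 6 * (x + l) + 48 * Q = 5 + 6 * (x + 8 * Q + l))%N by lia.
  have -> : (5 + 6 * (x + l) + 12 * Q = 5 + 6 * (x + 2 * Q + l))%N by lia.
  have -> : (5 + 6 * (x + l) + 6 * Q = 5 + 6 * (x + Q + l))%N by lia.
  have -> : (6 * (8 * Q) = 48 * Q)%N by lia.
  have -> : (6 * (2 * Q) = 12 * Q)%N by lia.
  by move=> H; refine (etrans H _); exact: addrC.
move=> /andP[h8 h32]; rewrite /rec_terms; case: ifP => h16.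
  rewrite sum3 /fst /snd.
  have -> : (h - 6 = h - 8 + 2)%N by lia.
  have -> : (h - 7 = h - 8 + 1)%N by lia.
  rewrite -{1}(subnK h8); apply: (step (2 * s)%N) => //.
  by rewrite muln1 expnM.
rewrite sum3 /fst /snd.
have {}h16 : (16 <= h)%N by lia.
have -> : (h - 12 = h - 16 + 4)%N by lia.
have -> : (h - 14 = h - 16 + 2)%N by lia.
rewrite -{1}(subnK h16); apply: (step (2 * s).+1%N) => //.
by rewrite expnSr expnM.
Qed.

Lemma sum_eq_below w (I : eqType) (r : seq I) (F G : I -> series) :
  (forall i, i \in r -> eq_below w (F i) (G i)) ->
  eq_below w (\sum_(i <- r) F i) (\sum_(i <- r) G i).
Proof.
move=> FG; rewrite /eq_below -big_split big_seq.
by apply: span_sum => i /FG.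
Qed.

Lemma eq_below_filter w (I : eqType) (r : seq I) (P : pred I) (F : I -> series) :
  (forall i, i \in r -> ~~ P i -> below w (F i)) ->
  eq_below w (\sum_(i <- r) F i) (\sum_(i <- r | P i) F i).
Proof.
move=> FP; rewrite /eq_below (bigID P) /= addrAC addss add0r big_seq_cond.
by apply: span_sum => i /andP[]; exact: FP.
Qed.

Lemma low_lt M : has_a M -> (low M < M)%N.
Proof.
elim/ltn_ind: M => M IHM; have [M' [j [ME j4]]] := base4 M.
have [_ aM lM] := codeE M' j4; rewrite -ME in aM lM; rewrite aM lM.
case: (boolP (odd j)) => jo /=; first by case: (M) ME jo => //; lia.
move=> aM'; rewrite aM'; have M'M : (M' < M)%N.
  by case: (posnP M') aM' => [->|M'0 _] //; lia.
by have := IHM _ M'M aM'; lia.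
Qed.

Lemma eq_below_lead M (s : seq nat) :
  [seq m <- s | wt M <= wt m + 2]%N = (if has_a M then [:: low M] else [::]) ->
  eq_below (wt M) (\sum_(m <- s) D ^+ (5 + 6 * m)) (lead M).
Proof.
move=> sM; have h : eq_below (wt M) (\sum_(m <- s) D ^+ (5 + 6 * m))
    (\sum_(m <- s | (wt M <= wt m + 2)%N) D ^+ (5 + 6 * m)).
  apply: eq_below_filter => m _; rewrite -ltnNge => wm.
  by apply: below_mem; lia.
apply: eq_below_trans h _.
rewrite -big_filter sM /lead /eq_below.
by case: ifP => _; rewrite ?big_seq1 ?big_nil addss; exact: span0.
Qed.

(** Induction through the recurrence on the leading digits. Subadditivity of the weight absorbs the
    errors, and the three leading terms are compared by the finite checks above, according to where
    the borrow ends. *)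
Lemma hecke7_lead M : eq_below (wt M) (hecke 7 (D ^+ (5 + 6 * M))) (lead M).
Proof.
elim/ltn_ind: M => M IHM; have [M8|M8] := ltnP M 8.
  rewrite hecke7_base // /evD big_map; apply: eq_below_lead.
  by case: M M8 {IHM} => [|[|[|[|[|[|[|[|]]]]]]]].
have [s [h [l [ME h8 ls]]]] := top4 M8.
have h1M t : t \in rec_terms h -> (4 ^ s * t.2 + l < M)%N.
  have h1 : (t \in rec_terms h -> t.2 < h)%N.
    case/andP: h8; rewrite /rec_terms; case: ifP => h16 ? ?; rewrite !inE.
      by case/or3P => /eqP -> /=; lia.
    by case/or3P => /eqP -> /=; lia.
  by move=> /h1; rewrite ME ltn_add2r ltn_pmul2l // expn_gt0.
have [wM aM lM] := code_cat h ls; rewrite -ME in wM aM lM.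
have s0 : (0 < 2 ^ s)%N by rewrite expn_gt0.
have mulX a m : D ^+ (6 * a) * D ^+ (5 + 6 * m) = D ^+ (5 + 6 * (a + m)).
  by rewrite -exprD; congr (D ^+ _); lia.
have T := @hecke7_terms s h l h8; rewrite -ME in T; rewrite T {T}.
apply: eq_below_trans (_ : eq_below _ _ (\sum_(t <- rec_terms h)
    D ^+ (6 * (4 ^ s * t.1)) * lead (4 ^ s * t.2 + l))) _.
  apply: sum_eq_below => t th; rewrite /eq_below -mulrDr.
  apply: below_mul (IHM _ (h1M _ th)).
  have [-> _ _] := code_cat t.2 ls; have wt12 := rec_terms_wt h8 th.
  have := @code_cat s t.1 0; rewrite expn_gt0 addn0 => -[] // -> _ _.
  rewrite wM (_ : wt 0%N = 0%N) // addn0 addnAC -mulnDr leq_add2r leq_mul2l addnC.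
  by rewrite wt12 orbT.
have [al|al] := boolP (has_a l).
  have lls : (low l < 4 ^ s)%N by rewrite (ltn_trans _ ls) ?low_lt.
  rewrite (_ : \sum_(t <- _) _ = \sum_(m <- [seq (4 ^ s * (t.1 + t.2) + low l)%N |
      t <- rec_terms h]) D ^+ (5 + 6 * m)); last first.
    rewrite big_map; apply: eq_bigr => t _; rewrite /lead.
    have [_ -> ->] := code_cat t.2 ls; rewrite ?al ?orbT // mulX.
    by congr (D ^+ (5 + 6 * _)%N); rewrite mulnDr addnA.
  apply: eq_below_lead; rewrite aM al orbT (lM al) filter_map.
  rewrite (@eq_filter _ _ (fun t => wt h <= wt (t.1 + t.2))%N) ?map_comp.
    by rewrite (map_comp (fun x => 4 ^ s * x + low l)%N) rec_terms_lead.
  move=> t /=; have [-> _ _] := code_cat (t.1 + t.2) lls.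
  by rewrite wM -(low_wt al) addnA leq_add2r leq_add2r leq_pmul2l.
have [y ys lowE] := low_borrow ls al.
(* The weight of [y] is found by taking h = 1 in [lowE], where [low 1 = 0], and applying
   [low_wt]. *)
have wy : (wt y + 2 = 2 ^ s * 2 + wt l)%N.
  have [w1 a1 _] := code_cat 1 ls; have := low_wt (_ : has_a (4 ^ s * 1 + l)).
  rewrite lowE // muln0 add0n w1; apply; by rewrite a1.
rewrite (_ : \sum_(t <- _) _ = \sum_(m <- [seq (4 ^ s * (t.1 + low t.2) + y)%N |
    t <- rec_terms h & has_a t.2]) D ^+ (5 + 6 * m)); last first.
  rewrite big_map big_filter [RHS]big_mkcond; apply: eq_bigr => t _; rewrite /lead.
  have [_ -> _] := code_cat t.2 ls; rewrite (negbTE al) orbF.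
  case: ifP => at2; rewrite ?mulr0 // lowE // mulX.
  by congr (D ^+ (5 + 6 * _)%N); rewrite mulnDr addnA.
apply: eq_below_lead; rewrite aM (negbTE al) orbF filter_map -filter_predI.
rewrite (@eq_filter _ _ (fun t => has_a t.2 && (wt h <= wt (t.1 + low t.2) + 2))%N).
  rewrite (map_comp (fun x => 4 ^ s * x + y)%N) rec_terms_low //.
  by case: ifP => // ah; rewrite ME lowE.
move=> t /=; have [-> _ _] := code_cat (t.1 + low t.2) ys.
rewrite andbC wM -addnA wy addnA leq_add2r -mulnDr leq_pmul2l //.
Qed.

(** * The kernel has dimension at most q *)

Definition ev6 N (a : nat -> 'F_2) : series := \sum_(M < N) a M *: D ^+ (5 + 6 * M).

Lemma ev6D N a b : ev6 N (fun M => a M + b M) = ev6 N a + ev6 N b.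
Proof. by rewrite -big_split; apply: eq_bigr => M _; rewrite scalerDl. Qed.

Lemma hecke_scale p c f : hecke p (c *: f) = c *: hecke p f.
Proof.
have scE (g : series) m : (c *: g) m = c * g m by [].
apply/funext => n; rewrite scE /hecke !scE.
by case: ifP => _; rewrite ?addr0 ?mulrDr.
Qed.

Lemma F2_neq0 (x : 'F_2) : x != 0 -> x = 1.
Proof. by case: x => [[|[|]]] // ? _; apply/val_inj. Qed.

Lemma W5_coord q f : W5 q f -> exists a, f = ev6 (2 * q ^ 2) a.
Proof.
move: f; apply: span_ind.
- by exists (fun=> 0); rewrite /ev6 big1 // => M _; rewrite scale0r.
- by move=> _ _ [a ->] [b ->]; exists (fun M => a M + b M); rewrite ev6D.
move=> _ [n /and3P[n0 n5 nq] <-]; exists (fun M => (n == (5 + 6 * M)%N)%:R).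
have Mlt : ((n %/ 6) < 2 * q ^ 2)%N by move: nq; lia.
have nE : n = (5 + 6 * (n %/ 6))%N by lia.
rewrite /ev6 (bigD1 (Ordinal Mlt)) // big1.
  by rewrite /= -nE eqxx scale1r addr0.
move=> M; rewrite -val_eqE /= => MM; rewrite (_ : (n == _) = false) ?scale0r //.
by apply/negbTE; apply: contra MM => /eqP; lia.
Qed.

(** Otherwise take [M0] of maximal weight in the support. The monomial [low M0] of its image
    outweighs all error terms and, by [low_inj], is not the leading monomial of any other member of
    the support, so it cannot cancel. *)
Lemma hecke7_ev6_inj N a : hecke 7 (ev6 N a) = 0 ->
  (forall M, (M < N)%N -> ~~ has_a M -> a M = 0) ->
  forall M, (M < N)%N -> a M = 0.
Proof.
move=> Ta a0 M MN; apply: contrapT => /eqP aM.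
pose P (i : 'I_N) := a i != 0; have Pi0 : P (Ordinal MN) by [].
case: (@arg_maxnP _ (Ordinal MN) P (fun i => wt i) Pi0) => M0 aM0 Mmax.
have hasa (i : 'I_N) : P i -> has_a i.
  by move=> Pi; apply: contraNT Pi => /a0 ->.
suff /D_pow_indep [m] : spanX (in6 (fun m => m != low M0)) (D ^+ (5 + 6 * low M0)).
  by move=> /addnI /eqP; rewrite eqn_pmul2l // => /eqP ->; rewrite eqxx.
have lowM0 := low_wt (hasa _ aM0).
have sub : below (wt M0) `<=` spanX (in6 (fun m => m != low M0)).
  apply: sub_spanX => _ [m -> mw]; exists m => //.
  by apply: contraTneq mw => ->; lia.
have TE : hecke 7 (ev6 N a) = \sum_(i < N | P i) hecke 7 (D ^+ (5 + 6 * i)).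
  rewrite hecke_sum [RHS]big_mkcond; apply: eq_bigr => i _.
  rewrite hecke_scale /P; case: eqVneq => [->|/F2_neq0 ->]; first by rewrite scale0r.
  by rewrite scale1r.
have : spanX (in6 (fun m => m != low M0))
    (\sum_(i < N | P i) hecke 7 (D ^+ (5 + 6 * i)) +
     \sum_(i < N | P i) lead i).
  rewrite -big_split; apply: span_sum => i Pi; apply: sub.
  apply: sub_spanX (hecke7_lead i) => _ [m -> mw]; exists m => //.
  exact: leq_trans mw (Mmax _ Pi).
rewrite -TE Ta add0r (bigD1 M0) //= {1}/lead (hasa _ aM0).
set S := \sum_(i < N | _) _ => DS.
have SS : spanX (in6 (fun m => m != low M0)) S.
  apply: span_sum => i /andP[Pi iM0]; rewrite /lead (hasa _ Pi).
  apply: spanX_mem; exists (low i) => //; apply: contraNneq iM0 => lowE.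
  by apply/eqP/val_inj/low_inj; rewrite ?hasa.
by have := spanD DS SS; rewrite -addrA addss addr0.
Qed.

(** Numbers with k base 4 digits, each 0 or 2. Below 2 * 4^k these are all the M with a = 0, because
    the additional top digit is at most 1. *)
Fixpoint no_a k : seq nat :=
  if k is k'.+1 then
    [seq (4 * m)%N | m <- no_a k'] ++ [seq (4 * m + 2)%N | m <- no_a k']
  else [:: 0%N].

Lemma size_no_a k : size (no_a k) = (2 ^ k)%N.
Proof. by elim: k => //= k IHk; rewrite size_cat !size_map IHk expnS mul2n addnn. Qed.

Lemma mem_no_a k M : (M < 2 * 4 ^ k)%N -> ~~ has_a M -> M \in no_a k.
Proof.
elim: k M => [|k IHk] M; first by case: M => [|[|M]] //; lia.
rewrite expnS => Mk; have [M' [j [ME j4]]] := base4 M.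
have [_ aM _] := codeE M' j4; rewrite ME aM negb_or => /andP[jo aM'].
have M'k : M' \in no_a k by apply: IHk => //; lia.
rewrite mem_cat; case: j j4 jo {ME aM} => [|[|[|[|]]]] // _ _.
  by rewrite addn0 map_f.
by rewrite (map_f (fun m => 4 * m + 2)%N) ?orbT.
Qed.

Lemma no_a_lt k M : M \in no_a k -> (M < 2 * 4 ^ k)%N.
Proof.
elim: k M => [|k IHk] M; first by rewrite inE => /eqP ->.
by rewrite mem_cat expnS => /orP[] /mapP[m /IHk ? ->]; lia.
Qed.

(** Reading off the q coordinates with a = 0 is injective on the combinations of the [u i], hence
    bijective by counting. Some combination thus agrees with [f] at these places, and then
    everywhere by [hecke7_ev6_inj]. *)
Lemma kernel_spanned k (u : nat -> series) (q := (2 ^ k)%N) :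
  (forall i, (i < q)%N -> W5 q (u i) /\ hecke 7 (u i) = 0) ->
  (forall c : nat -> 'F_2, \sum_(i < q) c i *: u i = 0 ->
     forall i, (i < q)%N -> c i = 0) ->
  forall f, W5 q f -> hecke 7 f = 0 -> exists c : 'I_q -> 'F_2,
    f = \sum_(i < q) c i *: u i.
Proof.
move=> uK ufree f fW Tf; pose N := (2 * q ^ 2)%N.
have NE : N = (2 * 4 ^ k)%N by rewrite /N /q -expnM [(k * 2)%N]mulnC expnM.
have [b fE] := W5_coord fW.
have /choice [a aE] : forall i : 'I_q, exists a, u i = ev6 N a.
  by move=> i; have [/W5_coord] := uK i (ltn_ord i).
pose comb (c : 'I_q -> 'F_2) M := \sum_(i < q) c i * a i M.
have combE c : ev6 N (comb c) = \sum_(i < q) c i *: u i.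
  rewrite /ev6 /comb (eq_bigr _ (fun M _ => scaler_suml _ _ _ _)) exchange_big.
  apply: eq_bigr => i _; rewrite aE scaler_sumr; apply: eq_bigr => M _.
  by rewrite scalerA.
have Tcomb c : hecke 7 (ev6 N (comb c)) = 0.
  rewrite combE hecke_sum big1 // => i _.
  by rewrite hecke_scale (uK i (ltn_ord i)).2 scaler0.
have L i : (i < q)%N -> (nth 0%N (no_a k) i < N)%N.
  by move=> iq; rewrite NE no_a_lt // mem_nth ?size_no_a.
have onL (x : nat -> 'F_2) : (forall i, (i < q)%N -> x (nth 0%N (no_a k) i) = 0) ->
    forall M, (M < N)%N -> ~~ has_a M -> x M = 0.
  move=> xL M; rewrite NE => MN aM; have := mem_no_a MN aM.
  by case/(nthP 0%N) => i; rewrite size_no_a => iq <-; exact: xL.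
pose phi (c : {ffun 'I_q -> 'F_2}) : {ffun 'I_q -> 'F_2} :=
  [ffun i : 'I_q => comb c (nth 0%N (no_a k) i)].
have phi_inj : injective phi.
  move=> c d cd; apply/ffunP => i; apply/eqP; rewrite -subr_eq0; apply/eqP.
  pose e (i : nat) : 'F_2 := if insub i is Some j then c j - d j else 0.
  have eE (j : 'I_q) : e j = c j - d j by rewrite /e valK.
  rewrite -eE; apply: (ufree e) => //.
  have e0 : forall M, (M < N)%N -> comb (fun j => e j) M = 0.
    apply: hecke7_ev6_inj (Tcomb _) _; apply: onL => j jq.
    have := congr1 (fun g : {ffun 'I_q -> 'F_2} => g (Ordinal jq)) cd.
    rewrite !ffunE /comb /= => /eqP; rewrite -subr_eq0 -sumrB => /eqP cd0.
    by rewrite -[RHS]cd0; apply: eq_bigr => x _; rewrite eE mulrBl.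
  rewrite -(combE (fun j => e j)) /ev6 big1 // => M _.
  by rewrite e0 ?scale0r.
have [psi _ psiK] := injF_bij phi_inj.
pose c := psi [ffun i : 'I_q => b (nth 0%N (no_a k) i)]; exists c.
have d0 : forall M, (M < N)%N -> comb c M + b M = 0.
  apply: (hecke7_ev6_inj (a := fun M => comb c M + b M)).
    by rewrite ev6D heckeD Tcomb add0r -fE.
  apply: onL => i iq; have := congr1
    (fun g : {ffun 'I_q -> 'F_2} => g (Ordinal iq)) (psiK [ffun i : 'I_q => b (nth 0%N (no_a k) i)]).
  by rewrite !ffunE /= => ->; exact: F2_addxx.
apply/esym/adds_eq0; rewrite -combE fE -ev6D /ev6 big1 // => M _.
by rewrite d0 ?scale0r.
Qed.

(** * Gauss-classes as sets of pairs *)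

(** A determinant: for odd first coordinates it vanishes mod 2q exactly when the pairs are
    Gauss-equivalent ([gauss_equivP]). *)
Definition cross (z w : int * int) : int := z.2 * w.1 - z.1 * w.2.

Definition gclass (q : nat) (w : int * int) : set (int * int) :=
  [set z | one4 z.1 /\ ((2 * q)%N%:Z %| cross z w)%Z].

Definition Theta q w : series := xsum 'F_2 (gclass q w) normG.

(** Keeps one of each two conjugate ideals of [AMB], so that it enumerates theta(AMB)/2. *)
Definition half_amb (q : nat) : set (int * int) :=
  [set z | one4 z.1 /\ exists2 b, one4 b & z.2 = q%:Z * b].

Definition Half q : series := Fser * dilate (4 * q ^ 2) Fser.

(** The two multiplications are adjoint for [cross]; hence the preimage of the class of w under r +
    2i is the class of (r - 2i)w. *)
Lemma cross_mulG r z w : cross (mulG r z) w = cross z (mulGbar r w).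
Proof. by rewrite /cross /mulG /mulGbar /=; ring. Qed.

Lemma cross_mulGbar r z w : cross (mulGbar r z) w = cross z (mulG r w).
Proof. by rewrite /cross /mulG /mulGbar /=; ring. Qed.

Section Classes.
Variables (k : nat) (q : nat).
Hypothesis qE : q = (2 ^ k)%N.

Let q_gt0 : (0 < q)%N. Proof. by rewrite qE expn_gt0. Qed.

Lemma dvd2q_mull (a x : int) : odd `|a| ->
  ((2 * q)%N%:Z %| a * x)%Z = ((2 * q)%N%:Z %| x)%Z.
Proof.
move=> oa; apply: Gauss_dvdzr; rewrite coprimezE /=.
by rewrite qE -expnS coprimeXl // coprime2n.
Qed.

Lemma gclass_eq w w' : odd `|w.1| -> odd `|w'.1| ->
  ((2 * q)%N%:Z %| cross w w')%Z -> gclass q w = gclass q w'.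
Proof.
move=> ow ow' ww'; apply/seteqP.
have E z : w'.1 * cross z w = w.1 * cross z w' - z.1 * cross w w'.
  by rewrite /cross; ring.
have H z : ((2 * q)%N%:Z %| cross z w)%Z = ((2 * q)%N%:Z %| cross z w')%Z.
  rewrite -(dvd2q_mull (cross z w) ow') E -(dvd2q_mull (cross z w') ow).
  by rewrite rpredBr // dvdz_mull.
by split=> z [z1]; [rewrite H|rewrite -H].
Qed.

Lemma gclass_scale (p : int) z w : (p %% 4)%Z = 1 ->
  gclass q w (scaleG p z) <-> gclass q w z.
Proof.
move=> p4; have op : odd `|p| by lia.
have -> : gclass q w (scaleG p z) =
    (one4 (p * z.1) /\ ((2 * q)%N%:Z %| p * cross z w)%Z).
  by rewrite /gclass /mkset; congr (_ /\ is_true (_ %| _)%Z); rewrite /cross /=; ring.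
rewrite dvd2q_mull // /gclass /one4 /=.
have -> : ((p * z.1) %% 4)%Z = (z.1 %% 4)%Z by rewrite -modzMml p4 mul1r.
by [].
Qed.

Lemma hecke_Theta (p : nat) r w : prime p -> (p %% 4 = 1)%N -> (r %% 4)%Z = 1 ->
  p%:Z = r ^+ 2 + 4 ->
  hecke p (Theta q w) = Theta q (mulGbar r w) + Theta q (mulG r w).
Proof.
move=> p_pr p4 r4 pE; rewrite /Theta (hecke_split (r := r)) //; first last.
- by move=> z; apply: gclass_scale; lia.
- by move: p4; lia.
have r1 x y : one4 (r * x + 4 * y) <-> one4 x.
  rewrite /one4 /= (_ : ((r * x + 4 * y) %% 4)%Z = (x %% 4)%Z) //.
  by rewrite -modzDmr modzMr addr0 -modzMml r4 mul1r.
congr (_ + _); apply: eq_xsum => // z; rewrite /gclass /=.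
  by rewrite cross_mulG -[_ - _]/(_ + - (4 * _)) -mulrN r1.
by rewrite cross_mulGbar r1.
Qed.

Lemma HalfE : Half q = xsum 'F_2 (half_amb q) normG.
Proof.
have qq : (0 < 4 * q ^ 2)%N by rewrite muln_gt0 expn_gt0 q_gt0.
rewrite /Half F_mul1 //.
have qZ : q%:Z != 0 by rewrite eqz_nat -lt0n.
apply: (xsum_bij _ (h := fun t => (t.1, q%:Z * t.2))
  (g := fun z => (z.1, (z.2 %/ q%:Z)%Z))).
  move=> [a b] [/= a1 b1]; split; first by split=> //; exists b.
    by rewrite mulKz.
  by rewrite /normG /= /sq abszM absz_nat expnMn mulnA.
by move=> [c d] [/= c1 [b b1 ->]]; rewrite mulKz.
Qed.

Definition conjG (z : int * int) : int * int := (z.1, - z.2).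

Lemma gclass_amb : gclass q (1, q%:Z) = half_amb q `|` [set z | half_amb q (conjG z)].
Proof.
have q2 : (2 * q)%N%:Z = 2 * q%:Z :> int by [].
apply/seteqP; split.
  zpair c d; rewrite /gclass /cross /= mulr1 q2 => -[c1 /dvdzP[m mE]].
  have dE : d = q%:Z * (2 * m + c) by rewrite -[LHS](subrK (c * q%:Z)) mE; ring.
  have : ((2 * m + c) %% 4)%Z = 1 \/ ((- (2 * m + c)) %% 4)%Z = 1.
    by move: c1; rewrite /one4 /=; lia.
  case=> b1; [left|right]; split=> //.
    by exists (2 * m + c).
  by exists (- (2 * m + c)); rewrite // dE /=; ring.
have ev (b c : int) : one4 b -> one4 c -> exists m, b = 2 * m + c /\ - b = 2 * (- c - m) + c.
  move=> b1 c1; exists ((b - c) %/ 2)%Z; move: b1 c1; rewrite /one4 /=; lia.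
by zpair c d => -[] [/= c1 [b b1 dE]]; have [m [bE bE']] := ev b c b1 c1;
  split=> //; rewrite /cross /= mulr1 q2; apply/dvdzP;
  [exists m; rewrite dE bE|exists (- c - m); rewrite -[d]opprK dE -mulrN bE']; ring.
Qed.

Lemma half_amb_disj z : half_amb q z -> half_amb q (conjG z) -> False.
Proof.
move=> [_ [b b1 zE]] [_ [b' b'1]]; rewrite /= zE -mulrN => /eqP.
have qZ : q%:Z != 0 by rewrite eqz_nat -lt0n.
rewrite (inj_eq (mulfI qZ)) => /eqP bb'.
by move: b1 b'1; rewrite /one4 /= -bb'; lia.
Qed.

Lemma Theta_amb : Theta q (1, q%:Z) = 0.
Proof.
rewrite /Theta gclass_amb.
apply: (@xsum_double _ (half_amb q) [set z | half_amb q (conjG z)] _ _ conjG) => //.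
- exact: finite_normG.
- exact: half_amb_disj.
- by move=> [a b]; rewrite /conjG /= opprK.
- by move=> [a b]; rewrite /conjG /= opprK.
by move=> [a b] _; rewrite /normG /= sqN.
Qed.

Lemma half_amb_scale (p : int) z : (p %% 4)%Z = 1 ->
  half_amb q (scaleG p z) <-> half_amb q z.
Proof.
move=> p4; have p1 x : one4 (p * x) <-> one4 x.
  by rewrite /one4 /= -modzMml p4 mul1r.
have qZ : q%:Z != 0 by rewrite eqz_nat -lt0n.
case: z => c d; rewrite /half_amb /scaleG /=; split=> [[/p1 c1 [b b1 dE]]|[c1 [b b1 ->]]].
  split=> //; have /dvdzP[m mE] : (q%:Z %| d)%Z.
    rewrite -(Gauss_dvdzr (m := q%:Z) (n := p)) ?dE ?dvdz_mulr //.
    by rewrite coprimezE /= qE coprimeXl // coprime2n; lia.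
  exists m; last by rewrite mE mulrC.
  rewrite -p1 (_ : p * m = b) //; apply: (mulIf qZ).
  by rewrite -mulrA -mE dE mulrC.
split; first by rewrite p1.
by exists (p * b); rewrite ?p1 // mulrCA.
Qed.

(** Conjugating the second summand of [hecke_split] turns it into the preimage under r + 2i of the
    other half of AMB. Together the summands fill the preimage of the whole class. *)
Lemma hecke_Half (p : nat) r : prime p -> (p %% 4 = 1)%N -> (r %% 4)%Z = 1 ->
  p%:Z = r ^+ 2 + 4 -> hecke p (Half q) = Theta q (mulGbar r (1, q%:Z)).
Proof.
move=> p_pr p4 r4 pE; rewrite HalfE (hecke_split (r := r)) //; first last.
- by move=> z; apply: half_amb_scale; lia.
- by move: p4; lia.
have -> : Theta q (mulGbar r (1, q%:Z)) =
    xsum 'F_2 [set z | gclass q (1, q%:Z) (mulG r z)] normG.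
  apply: eq_xsum => // z; rewrite /gclass /= cross_mulG.
  rewrite (_ : one4 (r * z.1 - 4 * z.2) <-> one4 z.1) //.
  rewrite /one4 /= (_ : ((r * z.1 - 4 * z.2) %% 4)%Z = (z.1 %% 4)%Z) //.
  by rewrite -mulrN -modzDmr modzMr addr0 -modzMml r4 mul1r.
rewrite gclass_amb; apply/esym.
rewrite (@xsumU _ _ [set z | half_amb q (mulG r z)]
   [set z | half_amb q (conjG (mulG r z))]) //; first last.
- by move=> z /=; exact: half_amb_disj.
- exact: finite_normG.
congr (_ + _); have mulGconj z : mulGbar r (conjG z) = conjG (mulG r z).
  by rewrite /mulGbar /conjG /mulG /=; congr pair; ring.
have conjK z : conjG (conjG z) = z by case: z => a b; rewrite /conjG /= opprK.
apply: (xsum_bij _ (h := conjG) (g := conjG)) => z /= zA.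
  by split; rewrite ?mulGconj ?conjK //; case: (z) => a b; rewrite /normG /= sqN.
by split=> //; rewrite -mulGconj conjK.
Qed.

End Classes.

(** * Orbits of AMB under a prime of norm p *)

Lemma mulG_mulGbar r z : mulG r (mulGbar r z) = scaleG (r ^+ 2 + 4) z.
Proof. by case: z => c d; rewrite /mulG /mulGbar /scaleG /=; congr pair; ring. Qed.

(* The product of z.1 + 2 z.2 i and w.1 + 2 w.2 i; then [mulGbar r] is
   multiplication by r - 2i. *)
Definition gmul (z w : int * int) : int * int :=
  (z.1 * w.1 - 4 * (z.2 * w.2), z.1 * w.2 + z.2 * w.1).

Definition gpow r n : int * int := iter n (mulGbar r) (1, 0).

Lemma iter_mulGbar r n w : iter n (mulGbar r) w = gmul (gpow r n) w.
Proof.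
rewrite /gpow; elim: n => [|n /= ->]; case: w => u v.
  by rewrite /gmul /=; congr pair; ring.
by rewrite /mulGbar /gmul /=; congr pair; ring.
Qed.

Lemma iter_mulGbar_odd r n w : odd `|r| -> odd `|w.1| ->
  odd `|(iter n (mulGbar r) w).1|.
Proof.
move=> r_odd w_odd; elim: n => //= n; case: (iter _ _ _) => c d /= c_odd.
have : odd `|r * c| by rewrite abszM oddM r_odd.
by move: (r * c) => x; lia.
Qed.

(** Squaring a + 2 * 2^m b i, with a and b odd, contributes exactly one more factor 2 to the
    imaginary part. *)
Lemma gpow_exp2 r m : odd `|r| -> exists a b, [/\ odd `|a|, odd `|b|
  & gpow r (2 ^ m) = (a, (2 ^ m)%N%:Z * b)].
Proof.
move=> r_odd; elim: m => [|m [a [b [a1 b1 E]]]].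
  exists r, (-1); split=> //.
  by rewrite /gpow /= /mulGbar /=; congr pair; ring.
exists (a * a - 4 * ((2 ^ m)%N%:Z * b) ^+ 2), (a * b); split.
- have : odd `|a * a| by rewrite abszM oddM a1.
  by move: (a * a) (_ ^+ 2) => x y; lia.
- by rewrite abszM oddM a1.
rewrite expnS mul2n -addnn /gpow iterD iter_mulGbar -/(gpow _ _) E.
rewrite /gmul /= addnn -mul2n PoszM; congr pair; ring.
Qed.

(** Formally T = X + 1/X for the index shift X, so T^(2^m) = X^(2^m) + X^(-2^m) in characteristic 2,
    and G_0 = 0 makes the chain symmetric about 0. The second index is |j - 2^m|, written with
    truncated subtraction. *)
Lemma iter_chebyshev (T : series -> series) (G : nat -> series) m j :
  {morph T : f g / f + g} -> G 0%N = 0 ->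
  (forall i, T (G i.+1) = G i.+2 + G i) ->
  iter (2 ^ m) T (G j) = G (j + 2 ^ m)%N + G ((j - 2 ^ m) + (2 ^ m - j))%N.
Proof.
move=> TD G0 TG; have T0 : T 0 = 0 by apply: (addrI (T 0)); rewrite -TD !addr0.
have iterTD n : {morph iter n T : f g / f + g}.
  by move=> f g; elim: n => //= n ->; rewrite TD.
elim: m j => [|m IHm] j.
  case: j => [|j] /=; first by rewrite G0 T0 addss.
  by rewrite TG expn0 addn1 subSS subn0 subSS sub0n addn0.
rewrite expnS mul2n -addnn iterD IHm iterTD !IHm -addnA -addrA; congr (_ + _).
have [jm|jm] := leqP (2 ^ m) j.
  have -> : (j - 2 ^ m + (2 ^ m - j) + 2 ^ m = j)%N by lia.
  have -> : (j + 2 ^ m - 2 ^ m + (2 ^ m - (j + 2 ^ m)) = j)%N by lia.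
  by rewrite addsK; congr (G _); lia.
have -> : (j + 2 ^ m - 2 ^ m + (2 ^ m - (j + 2 ^ m)) = j)%N by lia.
have -> : (j - 2 ^ m + (2 ^ m - j) - 2 ^ m + (2 ^ m - (j - 2 ^ m + (2 ^ m - j))) = j)%N.
  by lia.
by rewrite addrCA addss addr0; congr (G _); lia.
Qed.

Definition gorbit r q j := iter j (mulGbar r) (1, q%:Z).

Lemma gorbit_odd r q j : odd `|r| -> odd `|(gorbit r q j).1|.
Proof. by move=> r_odd; apply: iter_mulGbar_odd. Qed.

Section Chain.
Variables (k q : nat) (p : nat) (r : int).
Hypothesis qE : q = (2 ^ k)%N.
Hypotheses (p_pr : prime p) (r4 : (r %% 4)%Z = 1) (pE : p%:Z = r ^+ 2 + 4).

Let r_odd : odd `|r|. Proof. by lia. Qed.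

Let p4 : (p %% 4 = 1)%N.
Proof.
suff : (p%:Z %% 4)%Z = 1 by lia.
by rewrite pE expr2 modzDr -modzMm r4.
Qed.

(** Since (r + 2i)(r - 2i) = p is an odd integer, multiplying by it does not change the class. *)
Lemma hecke_chain j : hecke p (Theta q (gorbit r q j.+1)) =
  Theta q (gorbit r q j.+2) + Theta q (gorbit r q j).
Proof.
rewrite (hecke_Theta qE _ p_pr p4 r4 pE); congr (_ + _).
rewrite [gorbit r q j.+1]/= mulG_mulGbar -pE; set w := gorbit r q j.
have w_odd : odd `|w.1| by exact: gorbit_odd.
have p_odd : odd `|p%:Z| by lia.
rewrite /Theta (gclass_eq (w' := w) qE) //.
  by rewrite /= abszM oddM p_odd.
by rewrite (_ : cross _ _ = 0) ?dvdz0 // /cross /=; ring.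
Qed.

Lemma hecke_chain_half : hecke p (Half q) = Theta q (gorbit r q 1).
Proof. exact: (hecke_Half qE). Qed.

(** Doubling the exponent produces G_(2^(m+1)) + G_0, and G_0 is the series of AMB, which is 0 mod
    2. *)
Lemma iter_chain_half m : iter (2 ^ m) (hecke p) (Half q) = Theta q (gorbit r q (2 ^ m)).
Proof.
have T0 : Theta q (gorbit r q 0) = 0 by exact: (Theta_amb qE).
elim: m => [|m IHm]; first exact: hecke_chain_half.
rewrite {1}expnS mul2n -addnn iterD IHm.
rewrite (iter_chebyshev (G := fun j => Theta q (gorbit r q j))) //; first last.
- exact: hecke_chain.
- exact: heckeD.
by rewrite subnn T0 addr0 addnn -mul2n -expnS.
Qed.

End Chain.

Lemma xsum_conj (A : set (int * int)) :
  xsum 'F_2 [set z | A (conjG z)] normG = xsum 'F_2 A normG.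
Proof.
have conjK z : conjG (conjG z) = z by case: z => a b; rewrite /conjG /= opprK.
apply: (xsum_bij _ (h := conjG) (g := conjG)) => z /= zA; rewrite conjK //.
by split=> //; case: z zA => a b _; rewrite /normG /= sqN.
Qed.

Lemma mod4P (a : int) : odd `|a| -> exists s m, (s = 1 \/ s = 3) /\ a = 4 * m + s.
Proof. by move=> a1; exists (a %% 4)%Z, (a %/ 4)%Z; lia. Qed.

(** At level 2q membership in this class forces d = qe, with e fixed mod 4: e is -1 or 1 according
    to whether a = b mod 4. Either way the class is one of the two conjugate halves of AMB at level
    q, and these have the same series. *)
Lemma gclass_half k q (a b : int) : q = (2 ^ k)%N -> odd `|a| -> odd `|b| ->
  Theta (2 * q) (gmul (a, q%:Z * b) (1, (2 * q)%N%:Z)) = Half q.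
Proof.
move=> qE a1 b1; have q0 : (0 < q)%N by rewrite qE expn_gt0.
rewrite (HalfE qE) /Theta.
have E c d : gclass (2 * q) (gmul (a, q%:Z * b) (1, (2 * q)%N%:Z)) (c, d) <->
    one4 c /\ exists2 e, d = q%:Z * e & (4 %| e * a - c * (2 * a + b))%Z.
  have -> : gclass (2 * q) (gmul (a, q%:Z * b) (1, (2 * q)%N%:Z)) (c, d) =
     (one4 c /\ (q%:Z * 4 %| d * a - q%:Z * (8 * (d * q%:Z * b) + c * (2 * a + b)))%Z).
    rewrite /gclass /cross /gmul /mkset /=; congr (_ /\ is_true (_ %| _)%Z).
      by rewrite mulrC mulrCA; lia.
    by rewrite PoszM; ring.
  have G e : (q%:Z * 4 %| q%:Z * e * a - q%:Z * (8 * (q%:Z * e * q%:Z * b) + c * (2 * a + b)))%Z =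
      (4 %| e * a - c * (2 * a + b))%Z.
    rewrite (_ : _ - _ = q%:Z * (e * a - c * (2 * a + b) - 4 * (2 * (q%:Z * e * q%:Z * b)))).
      rewrite dvdz_mul2l; last by rewrite eqz_nat -lt0n.
      by rewrite rpredBr // dvdz_mulr.
    by ring.
  split=> -[c1].
    move=> dv; split=> //.
    have /dvdzP[e dE] : (q%:Z %| d)%Z.
      rewrite -(@Gauss_dvdzl q%:Z d a); last first.
        by rewrite coprimezE /= qE coprimeXl // coprime2n.
      have qq : (q%:Z %| q%:Z)%Z by [].
      have := dvdz_trans (dvdz_mulr 4 qq) dv.
      by rewrite rpredBr // dvdz_mulr.
    by exists e; [rewrite dE mulrC|rewrite -G -[q%:Z * e]mulrC -dE].
  by case=> e -> dv; split=> //; rewrite G.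
have [s [m [s13 aE]]] := mod4P a1; have [t [n [t13 bE]]] := mod4P b1.
have F c e : one4 c -> (4 %| e * a - c * (2 * a + b))%Z <->
    ((if s == t then - e else e) %% 4 = 1)%Z.
  move=> c1; have [l cE] : exists l, c = 4 * l + 1.
    by exists (c %/ 4)%Z; move: c1; rewrite /one4 /=; lia.
  rewrite (_ : _ - _ = e * s - (2 * s + t) + 4 * (e * m - l * (2 * a + b) - 2 * m - n)).
    by case: s13 => ->; case: t13 => ->; rewrite /=; split; lia.
  by rewrite cE aE bE; ring.
have [st|st] := boolP (s == t).
  rewrite -(xsum_conj (half_amb q)); apply: eq_xsum => //; move=> [c d]; apply: (iff_trans (E c d)); split.
    move=> [c1 [e -> /F]]; rewrite st => e1.
    by split=> //; exists (- e); [exact: e1|rewrite mulrN].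
  move=> [/= c1 [e e1 dE]]; split=> //; exists (- e).
    by rewrite mulrN -dE opprK.
  by apply/F => //; rewrite st opprK.
apply: eq_xsum => //; move=> [c d]; apply: (iff_trans (E c d)); split.
  move=> [c1 [e -> /F]]; rewrite (negbTE st) => e1.
  by split=> //; exists e; [exact: e1|].
move=> [/= c1 [e e1 dE]]; split=> //; exists e => //.
by apply/F => //; rewrite (negbTE st).
Qed.

Lemma Half_halve k q (p : nat) (r : int) : q = (2 ^ k)%N -> prime p ->
  (r %% 4)%Z = 1 -> p%:Z = r ^+ 2 + 4 -> iter q (hecke p) (Half (2 * q)) = Half q.
Proof.
move=> qE p_pr r4 pE; have q2 : (2 * q = 2 ^ k.+1)%N by rewrite expnS qE.
have r_odd : odd `|r| by lia.
rewrite {1}qE (iter_chain_half q2 p_pr r4 pE) /gorbit iter_mulGbar.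
have [a [b [a1 b1 ->]]] := gpow_exp2 k r_odd.
by rewrite -qE; apply: (gclass_half qE).
Qed.

(** The halving steps use 2^(k-1) + ... + 2 + 1 = 2^k - 1 applications. *)
Lemma Half_base k (p : nat) (r : int) : prime p -> (r %% 4)%Z = 1 -> p%:Z = r ^+ 2 + 4 ->
  iter (2 ^ k).-1 (hecke p) (Half (2 ^ k)) = Half 1.
Proof.
move=> p_pr r4 pE; elim: k => [//|k IHk].
have q0 : (0 < 2 ^ k)%N by rewrite expn_gt0.
have -> : ((2 ^ k.+1).-1 = (2 ^ k).-1 + 2 ^ k)%N by rewrite expnS; lia.
by rewrite iterD expnS (@Half_halve k _ _ _ erefl p_pr r4 pE) IHk.
Qed.

(** At level 1 the class reached is given by d even; d and -d cancel, and d = 0 leaves F. *)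
Lemma hecke_Half1 (p : nat) (r : int) : prime p -> (r %% 4)%Z = 1 ->
  p%:Z = r ^+ 2 + 4 -> hecke p (Half 1) = Fser.
Proof.
move=> p_pr r4 pE; rewrite (hecke_chain_half (k := 0) _ p_pr r4 pE) //.
have -> : Theta 1 (gorbit r 1 1) = xsum 'F_2
    [set z : int * int | one4 z.1 /\ (2 %| z.2)%Z] normG.
  apply: eq_xsum => //; zpair c d; rewrite /gclass /gorbit /cross /= !mulr1.
  have -> : r = 4 * (r %/ 4)%Z + 1 by rewrite {1}(divz_eq r 4) r4 mulrC.
  rewrite muln1; move: (r %/ 4)%Z => m.
  rewrite (_ : _ - _ = d + (2 * m * (d - c) + 2 * d) * 2); last by ring.
  by rewrite rpredDr // dvdz_mull.
pose X s : set (int * int) := [set z | [/\ one4 z.1, (2 %| z.2)%Z & (0 < s * z.2)%R]].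
rewrite (@xsumU _ _ [set z : int * int | one4 z.1 /\ z.2 = 0]
  [set z : int * int | [/\ one4 z.1, (2 %| z.2)%Z & z.2 != 0]]) //; first last.
- by move=> [c d] /= [_ ->] [].
- move=> [c d] /=; split=> [[c1 d2]|[[c1 ->]|[]]] //.
  by have [->|d0] := eqVneq d 0; [left|right].
- exact: finite_normG.
have -> : xsum 'F_2 [set z : int * int | [/\ one4 z.1, (2 %| z.2)%Z & z.2 != 0]] normG = 0.
  apply: (@xsum_double _ (X 1) (X (-1)) _ _ conjG).
  - exact: finite_normG.
  - zpair c d; rewrite /X /=; split; last by case=> -[c1 d2 d0]; split=> //; lia.
    by case=> c1 d2 /eqP d0; have [d1|d1] : 0 < d \/ d < 0 by [lia];
      [left|right]; split=> //; lia.
  - by zpair c d; rewrite /X /= => -[_ _ d0] [_ _]; lia.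
  - by zpair c d; rewrite /X /= => -[c1 d2 d0]; split=> //; lia.
  - by zpair c d; rewrite /X /= => -[c1 d2 d0]; split=> //; lia.
  - by zpair c d; rewrite /conjG /= opprK.
  - by zpair c d; rewrite /normG /= sqN.
rewrite addr0; apply/esym.
apply: (xsum_bij _ (h := fun a => (a, 0)) (g := fun z : int * int => z.1)).
  by move=> a a1; rewrite /normG /= muln0 addn0.
by move=> [c d] [/= c1 ->].
Qed.

(** * The kernel is spanned by theta series *)

(** Lifting one binary digit at a time: if [cross] is 2^m times an odd number, multiplying by (r -
    2i)^(2^m) corrects it mod 2^(m+1), by [gpow_exp2]. *)
Lemma gorbit_surj k q r w : q = (2 ^ k)%N -> odd `|r| -> odd `|w.1| ->
  exists j, gclass q w = gclass q (gorbit r q j).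
Proof.
move=> qE r_odd w_odd.
have H m : exists j (x : int), cross w (gorbit r q j) = (2 ^ m)%N%:Z * x.
  elim: m => [|m [j [x xE]]]; first by exists 0%N, (cross w (gorbit r q 0)); rewrite mul1r.
  have [y [x2|x2]] : exists y : int, x = 2 * y \/ x = 2 * y + 1 by exists (x %/ 2)%Z; lia.
    by exists j, y; rewrite xE x2 expnS PoszM; ring.
  have [a [b [a1 b1 ab]]] := gpow_exp2 m r_odd; exists (2 ^ m + j)%N.
  have := gorbit_odd q j r_odd; move: xE; rewrite [gorbit r q (_ + j)]iterD iter_mulGbar ab.
  rewrite -/(gorbit r q j); case: (gorbit r q j) => c d; case: w w_odd => u v /= u1 xE c1.
  have : odd `|b * c * u| by rewrite !abszM !oddM b1 c1.
  have : odd `|a * x| by rewrite abszM oddM a1 x2; lia.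
  (* The new value of [cross] is 2^m (ax - bcu - 4bdv), where ax and bcu are both odd. *)
  move=> ax bcu; exists (((a * x - b * c * u) %/ 2)%Z - 2 * (b * d * v)).
  rewrite expnS PoszM; apply/eqP; rewrite -subr_eq0; apply/eqP.
  have E : ((a * x - b * c * u) %/ 2)%Z * 2 = a * x - b * c * u.
    by apply/divzK; move: ax bcu; move: (a * x) (b * c * u) => X Y; lia.
  transitivity (a * (cross (u, v) (c, d)) - (2 ^ m)%N%:Z * (((a * x - b * c * u) %/ 2)%Z * 2
     + b * c * u)); last by rewrite E xE; ring.
  by rewrite /cross /gmul /=; ring.
have [j [x jx]] := H k.+1; exists j.
apply: (gclass_eq qE) => //; first exact: gorbit_odd.
by rewrite jx {1}qE -expnS dvdz_mulr.
Qed.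

Lemma hecke7_Theta k q w : q = (2 ^ k)%N -> hecke 7 (Theta q w) = 0.
Proof. by move=> qE; apply: hecke_inert => z; apply: (gclass_scale qE). Qed.

Lemma hecke7_Half k q : q = (2 ^ k)%N -> hecke 7 (Half q) = 0.
Proof.
move=> qE; rewrite (HalfE qE).
by apply: hecke_inert => z; apply: (half_amb_scale qE).
Qed.

(** * Theta series as polynomials in D *)

Lemma exp4_mod6 k : (4 ^ k.+1 %% 6 = 4)%N.
Proof. by elim: k => // k IHk; rewrite expnS; lia. Qed.

Lemma four_sqr k : (4 * (2 ^ k) ^ 2 = 4 ^ k.+1)%N.
Proof. by rewrite expnAC [RHS]expnS. Qed.

Lemma exp4_dilate (f : series) m : f ^+ (4 ^ m) = dilate (4 ^ m) f.
Proof. by rewrite -[4%N]/(2 ^ 2)%N -expnM series_exp2. Qed.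

Lemma res_dilate4 r m f : (r < 3)%N -> res 3 r (dilate (4 ^ m) f) = dilate (4 ^ m) (res 3 r f).
Proof.
move=> r3; have m1 : (4 ^ m %% 3 = 1)%N by rewrite -modnXm exp1n.
rewrite res_dilate ?expn_gt0 //; last by rewrite -modnMm m1.
congr dilate; apply/funext => n; rewrite /res -modnMml m1 mul1n //.
Qed.

Lemma res32_Half k : res 3 2 (Half (2 ^ k)) = D ^+ (1 + 4 ^ k.+1).
Proof.
rewrite /Half four_sqr res32_mul ?res_dilate4 ?res32_F ?dilate0 //.
by rewrite -D_res -exp4_dilate exprD expr1.
Qed.

Lemma res31_HalfE k : res 3 1 (Half (2 ^ k)) =
  Eser * D ^+ (4 ^ k.+1) + D * Eser ^+ (4 ^ k.+1).
Proof.
rewrite /Half four_sqr res31_mul ?res_dilate4 ?res32_F ?dilate0 //.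
by rewrite -D_res -!exp4_dilate.
Qed.

Definition low1 N n := (n %% 6 = 1)%N /\ (n <= N)%N.

(** Write t = 4^(k+1) and X_k = E D^t + D E^t. The relation E^4 = E D^3 + D^12 gives X_0 = D^13 and
    X_(k+1) = D^(3t) X_k + D^(1+12t), which eliminates E. *)
Lemma res31_Half k : spanX (low1 (12 * (2 ^ k) ^ 2 + 1)) (res 3 1 (Half (2 ^ k))).
Proof.
have [_ E4] := level3_D.
rewrite res31_HalfE -[12%N]/(3 * 4)%N -mulnA four_sqr; elim: k => [|k IHk].
  have -> : Eser * D ^+ (4 ^ 1) + D * Eser ^+ (4 ^ 1) = D ^+ 13.
    by rewrite expn1 E4 mulrDr [D * (Eser * _)]mulrCA -!exprS addrA addss add0r.
  by apply: spanX_mem; split.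
have E : Eser ^+ (4 ^ k.+2) = Eser ^+ (4 ^ k.+1) * D ^+ (3 * 4 ^ k.+1) + D ^+ (12 * 4 ^ k.+1).
  rewrite [in LHS]expnS exprM E4 exp4_dilate dilateD dilateM ?expn_gt0 //.
  by rewrite -!exp4_dilate -!exprM.
have -> : Eser * D ^+ (4 ^ k.+2) + D * Eser ^+ (4 ^ k.+2) =
  D ^+ (3 * 4 ^ k.+1) * (Eser * D ^+ (4 ^ k.+1) + D * Eser ^+ (4 ^ k.+1)) +
  D ^+ (1 + 12 * 4 ^ k.+1).
  rewrite E exprD expr1 mulrDr !addrA; congr (_ + _); rewrite mulrDr; congr (_ + _).
    rewrite [RHS]mulrCA -exprD; congr (_ * D ^+ _).
    by rewrite [LHS]expnS; lia.
  by rewrite [LHS]mulrA [LHS]mulrC.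
have x4 := exp4_mod6 k; have y4 := expnS 4 k.+1; apply: spanD; last first.
  by apply: spanX_mem; split; lia.
by apply: spanX_mul IHk => n [n1 nN]; split; lia.
Qed.

Lemma W5E q : W5 q = spanX (fun n => (n %% 6 = 5)%N /\ (n < 12 * q ^ 2)%N).
Proof.
rewrite /W5 /spanX; congr Defs.span; congr (_ @` _); apply/funext => n.
apply/propext; split=> [/and3P[_ /eqP] //|[n5 nq]]; apply/and3P; split=> //.
  by case: n n5 {nq}.
exact/eqP.
Qed.

(** Both parts are recorded because T_5 exchanges them. *)
Definition good q (X : series) :=
  W5 q (res 3 2 X) /\ spanX (low1 (12 * q ^ 2 + 1)) (res 3 1 X).

Lemma good0 q : good q 0.
Proof. by split; rewrite res0; apply: span0. Qed.

Lemma goodD q X Y : good q X -> good q Y -> good q (X + Y).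
Proof. by move=> [X2 X1] [Y2 Y1]; split; rewrite resD; apply: spanD. Qed.

(** The degree bounds match: an exponent that is 5 mod 6 and at most 12q^2 + 1 is already less than
    12q^2. *)
Lemma good_hecke5 q X : good q X -> good q (hecke 5 X).
Proof.
rewrite /good W5E => -[X2 X1]; split.
  rewrite -[res 3 2 _]/(res 3 (5 * 1) _) -hecke_res //.
  apply: spanX_hecke X1 => n [n1 nq]; apply: sub_spanX (hecke5_pow n) => m [mn m5].
  by move: mn m5 n1 nq; move: (q ^ 2)%N => Q; split; lia.
have -> : res 3 1 (hecke 5 X) = hecke 5 (res 3 2 X) by rewrite hecke_res.
apply: spanX_hecke X2 => n [n1 nq]; apply: sub_spanX (hecke5_pow n) => m [mn m5].
by move: mn m5 n1 nq; move: (q ^ 2)%N => Q; split; lia.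
Qed.

Lemma good_Half k : good (2 ^ k) (Half (2 ^ k)).
Proof.
split; last exact: res31_Half.
rewrite res32_Half W5E; apply: spanX_mem.
have := exp4_mod6 k; rewrite -[12%N]/(3 * 4)%N -mulnA four_sqr.
by move: (4 ^ _)%N => x; split; lia.
Qed.

Lemma good_Theta k q w : q = (2 ^ k)%N -> odd `|w.1| -> good q (Theta q w).
Proof.
move=> qE w_odd; have [//|j wj] := @gorbit_surj k q 1 w qE _ w_odd.
rewrite /Theta wj -/(Theta _ _).
have : good q (Theta q (gorbit 1 q j)) /\ good q (Theta q (gorbit 1 q j.+1)).
  elim: j {wj} => [|j [IH0 IH1]].
    split; first by rewrite (Theta_amb qE); exact: good0.
    rewrite -(@hecke_chain_half k q 5 1 qE) //.
    by apply: good_hecke5; rewrite qE; exact: good_Half.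
  split=> //.
  have -> : Theta q (gorbit 1 q j.+2) =
      hecke 5 (Theta q (gorbit 1 q j.+1)) + Theta q (gorbit 1 q j).
    by rewrite (@hecke_chain k q 5 1 qE) // -addrA addss addr0.
  by apply: goodD => //; exact: good_hecke5.
by case.
Qed.

Definition theta_span q : set series := Defs.span
  ([set Half q] `|` [set Theta q w | w in [set w : int * int | odd `|w.1|]]).

Lemma theta_span_hecke k q (p : nat) (r : int) X : q = (2 ^ k)%N -> prime p ->
  (r %% 4)%Z = 1 -> p%:Z = r ^+ 2 + 4 -> theta_span q X -> theta_span q (hecke p X).
Proof.
move=> qE p_pr r4 pE.
have r_odd : odd `|r| by lia.
have Th w : odd `|w.1| -> theta_span q (Theta q w).
  by move=> w_odd; apply: span_mem; right; exists w.
have p4 : (p %% 4 = 1)%N.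
  suff : (p%:Z %% 4)%Z = 1 by lia.
  by rewrite pE expr2 modzDr -modzMm r4.
move: X; apply: span_ind => [|f g|f].
- by rewrite hecke0; apply: span0.
- by rewrite heckeD; apply: spanD.
case=> [->|[w w_odd <-]].
  by rewrite (hecke_chain_half qE p_pr r4 pE); apply/Th/gorbit_odd.
rewrite (hecke_Theta qE w p_pr p4 r4 pE); have := w_odd; rewrite /= => {}w_odd.
have : odd `|r * w.1| by rewrite abszM oddM r_odd.
by move=> rw; apply: spanD; apply: Th => /=; move: rw; move: (r * w.1) => x; lia.
Qed.

Lemma theta_span_good k q X : q = (2 ^ k)%N -> theta_span q X ->
  good q X /\ hecke 7 X = 0.
Proof.
move=> qE; move: X; apply: span_ind => [|f g [gf f0] [gg g0]|f].
- by split; [exact: good0|exact: hecke0].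
- by split; [exact: goodD|rewrite heckeD f0 g0 addr0].
case=> [->|[w w_odd <-]]; split.
- by rewrite qE; exact: good_Half.
- exact: (hecke7_Half qE).
- exact: (good_Theta qE).
- exact: (hecke7_Theta _ qE).
Qed.

Lemma resZ m r (c : 'F_2) (f : series) : res m r (c *: f) = c *: res m r f.
Proof.
apply/funext => n; rewrite (_ : (c *: res m r f : series) n = c * res m r f n) //.
by rewrite /res; case: ifP; rewrite ?mulr0.
Qed.

(** The prime is 13 = (-3)^2 + 4: it is 1 mod 3, so T_13 commutes with [res 3 2], and r = -3 is 1
    mod 4 as the chain requires. *)
Lemma kernel_eq k : let q := (2 ^ k)%N in
  W5 q `&` [set f | hecke 7 f = 0] = res 3 2 @` theta_span q.
Proof.
move=> q; have qE : q = (2 ^ k)%N by [].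
have q0 : (0 < q)%N by rewrite qE expn_gt0.
pose v i := iter i (hecke 13) (Half q).
have v_span i : theta_span q (v i).
  elim: i => [|i]; first by apply: span_mem; left.
  by apply: (@theta_span_hecke k q 13 (-3)).
have h7 X : hecke 7 X = 0 -> hecke 7 (res 3 2 X) = 0 by move=> X0; rewrite hecke_res // X0 res0.
have iterR n X : iter n (hecke 13) (res 3 2 X) = res 3 2 (iter n (hecke 13) X).
  by elim: n => //= n ->; rewrite hecke_res.
apply/seteqP; split=> [f [Wf f0]|_ [X /(theta_span_good qE)[[WX _] X0] <-]]; last first.
  by split=> //; exact: h7.
have base : iter q.-1 (hecke 13) (Half q) = Half 1 by exact: (@Half_base k 13 (-3)).
have u_ker i : (i < q)%N -> W5 q (res 3 2 (v i)) /\ hecke 7 (res 3 2 (v i)) = 0.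
  by move=> _; have [[]] := theta_span_good qE (v_span i); split=> //; exact: h7.
suff /(kernel_spanned u_ker)/(_ f Wf f0)[c ->] : forall c : nat -> 'F_2,
    \sum_(i < q) c i *: res 3 2 (v i) = 0 -> forall i, (i < q)%N -> c i = 0.
  exists (\sum_(i < q) c i *: v i); last first.
    by rewrite (big_morph _ (resD 3 2) (res0 3 2)); apply: eq_bigr => i _; rewrite resZ.
  apply: span_sum => i _.
  by have [->|/F2_neq0 ->] := eqVneq (c i) 0; rewrite ?scale0r ?scale1r;
    [exact: span0|exact: v_span].
move=> c sum0; elim/ltn_ind => i IHi iq.
have T13 n : iter n (hecke 13) 0 = 0 by elim: n => //= n ->; exact: hecke0.
(* Applying T_13^(q-1-i) isolates c_i: the terms j < i vanish by induction, the term j = i becomes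
   c_i D^5, and for j > i the chain has passed Half 1 and reached F, whose part 2 mod 3 is 0. *)
have := T13 (q.-1 - i)%N; rewrite -[X in iter _ _ X]sum0.
have -> : iter (q.-1 - i) (hecke 13) (\sum_(j < q) c j *: res 3 2 (v j)) =
    \sum_(j < q) c j *: res 3 2 (v (q.-1 - i + j)%N).
  elim: (q.-1 - i)%N => //= n ->; rewrite hecke_sum; apply: eq_bigr => j _.
  by rewrite hecke_scale hecke_res.
rewrite (bigD1 (Ordinal iq)) //= big1 ?addr0 => [|j].
  rewrite subnK; last by rewrite -ltnS prednK.
  rewrite /v base res_FF4.
  have [->//|/F2_neq0 ->] := eqVneq (c i) 0; rewrite scale1r.
  by move=> D5; rewrite -(D_pow_diag 5) D5.
rewrite -val_eqE /= neq_ltn => /orP[ji|ij]; first by rewrite IHi ?scale0r.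
have -> : (q.-1 - i + j = (j - i.+1) + (1 + q.-1))%N by move: (ltn_ord j); lia.
rewrite /v 2!iterD base /= (@hecke_Half1 13 (-3)) //.
by rewrite -iterR res32_F T13 scaler0.
Qed.

(** * Ideals of the Gaussian integers *)

Lemma principal_is_ideal (R : comNzRingType) (x : R) : is_ideal (principal x).
Proof.
split=> [|_ _ [a _ <-] [b _ <-]|a _ [b _ <-]].
- by exists 0; rewrite ?mul0r.
- by exists (a + b); rewrite ?mulrDl.
- by exists (a * b); rewrite ?mulrA.
Qed.

Lemma coset_eq (R : comNzRingType) (I : set R) x y : is_ideal I ->
  [set x + z | z in I] = [set y + z | z in I] <-> I (x - y).
Proof.
move=> [I0 ID IM]; have IN z : I z -> I (- z) by rewrite -mulN1r; exact: IM.
split=> [xy|Ixy]; last first.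
  apply/seteqP; split=> _ [z Iz <-].
    by exists (x - y + z); [exact: ID|rewrite addrA subrKC].
  exists (- (x - y) + z); first by apply: ID => //; exact: IN.
  by rewrite opprB addrA subrKC.
have : [set x + z | z in I] x by exists 0; rewrite ?addr0.
by rewrite xy => -[z Iz <-]; rewrite addrC addKr.
Qed.

Lemma principal_gaussE a b x y : principal (GaussInt a b) (GaussInt x y) <->
  exists s t, x = s * a - t * b /\ y = s * b + t * a.
Proof.
split=> [[[s t] _ [<- <-]]|[s [t [-> ->]]]]; first by exists s, t.
by exists (GaussInt s t).
Qed.

(* With g = gcd(a, b), the ideal has a Z-basis (M, 0), (e, g) for M = (a^2 + b^2)/g
   and some e, so that the points of the box M x g represent the cosets. *)
Lemma ideal_norm_principal a b : a != 0 ->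
  ideal_norm (principal (GaussInt a b)) = (sq a + sq b)%N.
Proof.
move=> a_neq0; have [u [v uv]] := Bezoutz a b.
set g := gcdn `|a| `|b|.
have g_gt0 : (0 < g)%N by rewrite gcdn_gt0 absz_gt0 a_neq0.
have /dvdzP[a' aE] : (g%:Z %| a)%Z by exact: dvdz_gcdl.
have /dvdzP[b' bE] : (g%:Z %| b)%Z by exact: dvdz_gcdr.
have gZ : g%:Z != 0 by rewrite eqz_nat -lt0n.
have {}uv : u * a' + v * b' = 1.
  apply: (mulIf gZ); rewrite mul1r mulrDl -!mulrA -aE -bE uv //.
have [m mE] : exists m : nat, m%:Z = a' * a' + b' * b'.
  by exists (sq a' + sq b')%N; rewrite PoszD !sqE !expr2.
have -> : (sq a + sq b = (m * g) * g)%N.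
  by apply/eqP; rewrite -eqz_nat !(PoszM, PoszD, sqE) mE aE bE; apply/eqP; ring.
have m_gt0 : (0 < m)%N.
  have : a' != 0 by apply: contra a_neq0; rewrite aE => /eqP ->; rewrite mul0r.
  by move=> ?; nia.
pose coset (x : gaussInt) := [set x + y | y in principal (GaussInt a b)].
pose f n := coset (GaussInt (n %/ g)%N%:Z (n %% g)%N%:Z).
have co x y := @coset_eq _ _ x y (principal_is_ideal (GaussInt a b)).
rewrite /ideal_norm; apply: card_fset_set.
have -> : range coset = [set f n | n in `I_(m * g * g)].
  apply/seteqP; split=> [_ [[x y] _ <-]|_ [n _ <-]]; last by eexists.
  (* The basis vector (e, g) is (v + ui)(a + bi), while (M, 0) is (a' - b'i)(a + bi); the witnesses
     below combine these two multipliers. *)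
  pose e := v * a - u * b; pose y1 := (y %/ g%:Z)%Z.
  pose x1 := ((x - y1 * e) %/ (m * g)%N%:Z)%Z.
  have M_gt0 : (0 < m * g)%N by rewrite muln_gt0 m_gt0.
  have M0 : (m * g)%N%:Z != 0 by rewrite eqz_nat -lt0n.
  pose x0 := ((x - y1 * e) %% (m * g)%N%:Z)%Z; pose y0 := (y %% g%:Z)%Z.
  have yE : y = y1 * g%:Z + y0 by exact: divz_eq.
  have xE : x - y1 * e = x1 * (m * g)%N%:Z + x0 by exact: divz_eq.
  have x0_ge0 : 0 <= x0 by exact: modz_ge0.
  have y0_ge0 : 0 <= y0 by exact: modz_ge0.
  have x0_lt : x0 < (m * g)%N%:Z by exact: ltz_pmod.
  have y0_lt : y0 < g%:Z by exact: ltz_pmod.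
  have xy0 : (`|y0| < g)%N by lia.
  exists (`|x0| * g + `|y0|)%N.
    have /(leq_mul (leqnn g)) : (`|x0| < m * g)%N by lia.
    by rewrite /mkset /= [(g * (m * g))%N]mulnC mulnS; lia.
  rewrite /f divnMDl // divn_small // addn0 modnMDl modn_small //.
  rewrite !gez0_abs //; apply/esym/co.
  rewrite -[_ - _]/(GaussInt (x - x0) (y - y0)).
  apply/principal_gaussE; exists (y1 * v + x1 * a'), (y1 * u - x1 * b').
  have -> : x = y1 * e + x1 * (m * g)%N%:Z + x0 by rewrite -addrA -xE; ring.
  rewrite yE; split; first by rewrite /e PoszM mE aE bE; ring.
  have -> : y1 * g%:Z = y1 * g%:Z * (u * a' + v * b') by rewrite uv mulr1.
  by rewrite aE bE; ring.
apply: inj_card_eq => i j /set_mem/= im /set_mem/= jm /co.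
rewrite -[_ - _]/(GaussInt (_ - _) (_ - _)) => /principal_gaussE[s [t [xE yE]]].
have yE' : (i %% g)%N%:Z - (j %% g)%N%:Z = (s * b' + t * a') * g%:Z.
  by rewrite yE aE bE; ring.
have w0 : s * b' + t * a' = 0.
  by move: (ltn_pmod i g_gt0) (ltn_pmod j g_gt0) yE'; move: (_ + _) (i %% g)%N (j %% g)%N; nia.
have xE' : (i %/ g)%N%:Z - (j %/ g)%N%:Z = (u * s - v * t) * (m * g)%N%:Z.
  have sE : s = a' * (u * s - v * t).
    rewrite -[LHS]mul1r -uv.
    transitivity (a' * (u * s - v * t) + v * (s * b' + t * a')); first by ring.
    by rewrite w0 mulr0 addr0.
  have tE : t = - b' * (u * s - v * t).
    rewrite -[LHS]mul1r -uv.
    transitivity (- b' * (u * s - v * t) + u * (s * b' + t * a')); first by ring.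
    by rewrite w0 mulr0 addr0.
  by rewrite xE PoszM mE aE bE [in LHS]sE [in X in _ - X]tE; ring.
have gi : (i %/ g < m * g)%N by rewrite ltn_divLR.
have gj : (j %/ g < m * g)%N by rewrite ltn_divLR.
rewrite (divn_eq i g) (divn_eq j g); congr (_ * _ + _)%N.
  move: xE' gi gj; move: (u * s - v * t) (i %/ g)%N (j %/ g)%N (m * g)%N => z X Y M.
  have M0 : 0 <= M%:Z by [].
  have [->|[z1|z1]] : z = 0 \/ 1 <= z \/ z <= -1 by lia.
  - by rewrite mul0r; lia.
  - by have := ler_wpM2r M0 z1; lia.
  - by have := ler_wpM2r M0 z1; lia.
by move: yE'; rewrite w0 mul0r; lia.
Qed.

(** * From ideals to pairs *)

Lemma red2_xsum (T : choiceType) (A : set T) e : finite_fibers A e ->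
  red2 (xsum int A e) = xsum 'F_2 A e.
Proof.
move=> Ae; apply/funext => m; rewrite /red2 !(xsum_trunc _ _ _ (leqnn m)).
rewrite !fsbig_finite ?Ae // rmorph_sum /=; apply: eq_bigr => t _.
exact: rmorph_nat.
Qed.

Lemma gauss_natE n : n%:R = GaussInt n%:Z 0.
Proof. by elim: n => [//|n IHn]; rewrite mulrS IHn intS. Qed.

Lemma gauss_intE (m : int) : m%:~R = GaussInt m 0.
Proof. by case: m => n; rewrite ?NegzE ?mulrNz -pmulrn gauss_natE. Qed.

Definition gideal (z : int * int) : set gaussInt := principal (GaussInt z.1 (2 * z.2)).

Lemma gideal_norm z : odd `|z.1| -> ideal_norm (gideal z) = normG z.
Proof.
case: z => c d /= c1; rewrite ideal_norm_principal; last by case: c c1 => [[|]|].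
by rewrite /normG /=; sqring.
Qed.

Lemma gideal_odd z : odd `|z.1| -> odd_ideal (gideal z).
Proof.
move=> z1; split; first exact: principal_is_ideal.
by rewrite gideal_norm // /normG oddD oddM /= addbF /sq oddX z1 orbT.
Qed.

Lemma scaleGN1 z : scaleG (-1) z = (- z.1, - z.2).
Proof. by rewrite /scaleG !mulN1r. Qed.

Lemma gidealN z : gideal (scaleG (-1) z) = gideal z.
Proof.
rewrite scaleGN1; case: z => c d; apply/seteqP; split=> -[x y] /principal_gaussE[s [t [-> ->]]];
  apply/principal_gaussE; exists (- s), (- t); split => /=; ring.
Qed.

(** Two such generators differ by a unit; i and -i would make the real part even. *)
Lemma gideal_inj z w : odd `|z.1| -> odd `|w.1| -> gideal z = gideal w ->
  z = w \/ z = scaleG (-1) w.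
Proof.
move=> z1 w1 zw; have := gideal_norm w1; rewrite -zw gideal_norm // => Nzw.
have : gideal w (GaussInt z.1 (2 * z.2)) by rewrite -zw; exists 1; rewrite ?mul1r.
move=> /principal_gaussE[s [t [z1E z2E]]].
have NE : (normG z)%:Z = (s ^+ 2 + t ^+ 2) * (normG w)%:Z.
  transitivity (z.1 ^+ 2 + (2 * z.2) ^+ 2); first by rewrite /normG !(PoszM, PoszD, sqE); ring.
  by rewrite z1E z2E /normG !(PoszM, PoszD, sqE); ring.
have w0 : (0 < normG w)%N.
  by rewrite /normG addn_gt0 expn_gt0 absz_gt0; case: (w.1) w1 => [[|]|].
have st : s ^+ 2 + t ^+ 2 = 1.
  apply: (mulIf (x := (normG w)%:Z)); first by rewrite eqz_nat -lt0n.
  by rewrite -NE Nzw mul1r.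
have t0 : t = 0.
  have t1 : - 1 <= t <= 1 by nia.
  have [//|[t_1|t_1]] : t = 0 \/ t = 1 \/ t = -1 by lia.
    have s0 : s = 0 by move: st; rewrite t_1; nia.
    by move: z1; rewrite z1E s0 t_1; lia.
  have s0 : s = 0 by move: st; rewrite t_1; nia.
  by move: z1; rewrite z1E s0 t_1; lia.
rewrite scaleGN1; move: z1E z2E st; rewrite t0.
have [->|[->|]] : s = 1 \/ s = -1 \/ (s != 1 /\ s != -1) by lia.
- by move=> z1E z2E _; left; case: (z) (w) z1E z2E => a b [c d] /= ? ?; congr pair; lia.
- by move=> z1E z2E _; right; case: (z) (w) z1E z2E => a b [c d] /= ? ?; congr pair; lia.
by move=> s1 _ _; nia.
Qed.

Lemma one4_odd x : one4 x -> odd `|x|. Proof. by rewrite /one4 /=; lia. Qed.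

Lemma odd_one4 z : odd `|z.1| -> one4 z.1 \/ one4 (scaleG (-1) z).1.
Proof. by rewrite scaleGN1 /one4 /=; case: z => a b /=; lia. Qed.

(** Inverse of [gideal] on pairs with first coordinate 1 mod 4; an ideal without such a generator is
    sent to (0, 0). *)
Definition generator (I : set gaussInt) : int * int :=
  xget (0, 0) [set z | one4 z.1 /\ I = gideal z].

Lemma generatorK z : one4 z.1 -> generator (gideal z) = z.
Proof.
move=> z1; apply: xget_unique => // w [w1 zw].
have [|//|wz] := gideal_inj (one4_odd w1) (one4_odd z1); first by [].
by move: w1 z1; rewrite wz scaleGN1 /one4 /=; case: (z) => a b /=; lia.
Qed.

Lemma xsum_gideal (C : set (set gaussInt)) (A : set (int * int)) :
  (forall z, A z -> one4 z.1 /\ C (gideal z)) ->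
  (forall I, C I -> exists z, I = gideal z /\ A z) ->
  xsum int C (@ideal_norm gaussInt) = xsum int A normG.
Proof.
move=> AC CA; apply/esym; apply: (xsum_bij _ (h := gideal) (g := generator)).
  by move=> z /AC[z1 Cz]; rewrite generatorK // gideal_norm //; exact: one4_odd.
by move=> I /CA[z [-> Az]]; rewrite generatorK //; have [] := AC _ Az.
Qed.

Lemma principal_natE n x y : principal (n%:R : gaussInt) (GaussInt x y) <->
  (n%:Z %| x)%Z /\ (n%:Z %| y)%Z.
Proof.
rewrite gauss_natE; split=> [/principal_gaussE[s [t [-> ->]]]|].
  by rewrite !mulr0 subr0 add0r !dvdz_mull.
move=> [/dvdzP[s ->] /dvdzP[t ->]]; apply/principal_gaussE; exists s, t.
by rewrite !mulr0 subr0 add0r.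
Qed.

(** The real parts force N to be z.1 / w.1 mod 4q, which exists because w.1 is odd. The condition on
    imaginary parts, halved, then says that [cross z w] vanishes mod 2q. *)
Lemma gauss_equivP k q z w : q = (2 ^ k)%N -> odd `|z.1| -> odd `|w.1| ->
  gauss_equiv q (gideal w) (gideal z) <-> ((2 * q)%N%:Z %| cross z w)%Z.
Proof.
move=> qE z1 w1.
have NE (N a b c d : int) : principal (4 * q%:R : gaussInt)
    (N%:~R * GaussInt a (2 * b) - GaussInt c (2 * d)) <->
    ((4 * q)%N%:Z %| N * a - c)%Z /\ ((2 * q)%N%:Z %| N * b - d)%Z.
  rewrite -natrM gauss_intE.
  have -> : GaussInt N 0 * GaussInt a (2 * b) - GaussInt c (2 * d) =
     GaussInt (N * a - c) (2 * (N * b - d)).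
    by congr GaussInt => /=; ring.
  rewrite principal_natE (_ : (4 * q)%N%:Z = 2 * (2 * q)%N%:Z); last by lia.
  by rewrite dvdz_mul2l.
have E (a b c d : int) : odd `|a| -> ((2 * q)%N%:Z %| d * a - c * b)%Z <-> exists N : int,
    ((4 * q)%N%:Z %| N * a - c)%Z /\ ((2 * q)%N%:Z %| N * b - d)%Z.
  move=> a1; have q24 : ((2 * q)%N%:Z %| (4 * q)%N%:Z)%Z.
    by apply/dvdzP; exists 2; lia.
  split=> [dv|[N [/(dvdz_trans q24) dv1 dv2]]]; last first.
    rewrite (_ : _ - _ = b * (N * a - c) - a * (N * b - d)); last by ring.
    by rewrite rpredB // dvdz_mull.
  have /coprimezP[[u v] /= uv] : coprimez a (4 * q)%N%:Z.
    by rewrite coprimezE /= coprime_sym qE -[4%N]/(2 ^ 2)%N -expnD coprimeXl // coprime2n.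
  exists (c * u).
  have Nc : c * u * a - c = - (c * v) * (4 * q)%N%:Z.
    rewrite -[X in _ - X]mulr1 -uv; ring.
  split; first by rewrite Nc dvdz_mull.
  rewrite -(dvd2q_mull qE _ a1).
  rewrite (_ : _ * _ = b * (c * u * a - c) - (d * a - c * b)); last by ring.
  by rewrite rpredBr // Nc !dvdz_mull.
split=> [[a [b [c [d]]]]|].
  move=> /= [a1 c1 /(gideal_inj (w := (a, b)) w1 a1) wE
    /(gideal_inj (w := (c, d)) z1 c1) zE [N /NE NN]].
  have dv : ((2 * q)%N%:Z %| d * a - c * b)%Z by apply/E => //; exists N.
  have [->|->] : cross z w = d * a - c * b \/ cross z w = - (d * a - c * b).
    by case: wE => ->; case: zE => ->; rewrite /cross ?scaleGN1 /=; [left|right|right|left]; ring.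
  - by [].
  - by rewrite rpredN.
move=> /E[//|N NN]; exists w.1, w.2, z.1, z.2; split=> //.
by exists N; apply/NE.
Qed.

Lemma theta_class k q w : q = (2 ^ k)%N -> odd `|w.1| ->
  red2 (theta [set J | odd_ideal J /\ gauss_equiv q (gideal w) J]) = Theta q w.
Proof.
move=> qE w1; rewrite /theta (@xsum_gideal _ (gclass q w)).
- by rewrite red2_xsum //; exact: finite_normG.
- move=> z [z1 dv]; have z1' := one4_odd z1; split=> //; split; first exact: gideal_odd.
  exact/(gauss_equivP qE).
move=> J [_ wJ]; have [a [b [c [d [_ c1 _ JE _]]]]] := wJ.
have {}JE : J = gideal (c, d) by [].
have wz z : odd `|z.1| -> J = gideal z -> ((2 * q)%N%:Z %| cross z w)%Z.
  by move=> z1 Jz; apply/(gauss_equivP qE) => //; rewrite -Jz.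
have [c4|c4] := @odd_one4 (c, d) c1.
  by exists (c, d); split=> //; split=> //; apply: wz.
exists (scaleG (-1) (c, d)); rewrite gidealN; split=> //; split=> //.
by apply: wz; [exact: one4_odd|rewrite gidealN].
Qed.

Lemma theta_AMB k q : q = (2 ^ k)%N -> theta (AMB q) = xsum int (half_amb q) normG *+ 2.
Proof.
move=> qE; rewrite /theta.
rewrite (@xsum_gideal _ (half_amb q `|` [set z | half_amb q (conjG z)])).
- rewrite (@xsumU _ _ (half_amb q) [set z | half_amb q (conjG z)]) //; first last.
  + exact: (half_amb_disj qE).
  + exact: finite_normG.
  rewrite mulr2n; congr (_ + _).
  have conjK z : conjG (conjG z) = z by case: z => a b; rewrite /conjG /= opprK.
  apply: (xsum_bij _ (h := conjG) (g := conjG)) => z /= zA; rewrite conjK //.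
  by split=> //; case: z zA => a b _; rewrite /normG /= sqN.
- case=> c d; case=> -[/= c1 [b b1 dE]]; split=> //.
    exists c, b; split; [exact: one4_odd|exact: one4_odd|].
    by rewrite /gideal /= dE; congr (principal (GaussInt _ _)); ring.
  exists c, (- b); rewrite abszN; split; [exact: one4_odd|exact: one4_odd|].
  by rewrite /gideal /= -[d]opprK dE; congr (principal (GaussInt _ _)); ring.
move=> _ [a [b [a1 b1 ->]]].
have -> : principal (GaussInt a (2 * b * q%:Z)) = gideal (a, q%:Z * b).
  by rewrite /gideal /=; congr (principal (GaussInt _ _)); ring.
have amb c e : one4 c -> odd `|e| ->
    (half_amb q `|` [set z | half_amb q (conjG z)]) (c, q%:Z * e).
  move=> c1 e1; have [e4|e4] : one4 e \/ one4 (- e) by rewrite /one4 /=; lia.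
    by left; split=> //; exists e.
  by right; split=> //; exists (- e); rewrite //= mulrN.
have [a4|a4] := @odd_one4 (a, b) a1; first by exists (a, q%:Z * b); split=> //; exact: amb.
exists (scaleG (-1) (a, q%:Z * b)); rewrite gidealN; split=> //.
by move: a4; rewrite !scaleGN1 /= -mulrN => a4; apply: amb; rewrite ?abszN.
Qed.

Lemma DI_E k q : q = (2 ^ k)%N -> DI q = res 3 2 @` theta_span q.
Proof.
move=> qE; have half_red g : g *+ 2 = theta (AMB q) -> red2 g = Half q.
  rewrite (theta_AMB qE) (HalfE qE) -red2_xsum; last exact: finite_normG.
  move=> g2; congr red2; apply/funext => n; have := congr1 (@^~ n) g2.
  by rewrite /= !mulr2n !fps_addE; lia.
rewrite /DI /theta_span; congr (_ @` _); apply/seteqP; split; apply: span_subset.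
  move=> _ [[C [I I_odd ->] <-]|[g gE <-]]; last first.
    by apply: span_mem; left; exact: half_red.
  (* If [I] has no generator of the required shape, nothing is equivalent to it, and the theta
     series of its empty class is 0. *)
  have [[w [w1 IE]]|noI] := pselect (exists w, odd `|w.1| /\ I = gideal w).
    by rewrite IE (theta_class qE w1); apply: span_mem; right; exists w.
  rewrite (_ : red2 _ = 0); first exact: span0.
  apply/funext => n; rewrite /red2 /theta xsum0P // => J [_ [a [b [c [d [a1 _ IE _ _]]]]]].
  by case: noI; exists (a, b).
move=> _ [->|[w w1 <-]]; apply: span_mem.
  right; exists (xsum int (half_amb q) normG); first by rewrite (theta_AMB qE).
  by rewrite red2_xsum ?(HalfE qE) //; exact: finite_normG.
left; exists [set J | odd_ideal J /\ gauss_equiv q (gideal w) J].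
  by exists (gideal w) => //; exact: gideal_odd.
exact: (theta_class qE).
Qed.

Theorem theorem4p4 (q : nat) (hq : exists k : nat, q = (2 ^ k)%N) :
  hecke 7 @` W5 q `<=` W5 q /\ W5 q `&` [set f | hecke 7 f = 0] = DI q.
Proof.
case: hq => k qE; split; last by rewrite (DI_E qE) qE kernel_eq.
rewrite W5E => _ [f Wf <-]; apply: spanX_hecke Wf => n [n5 nq].
apply: sub_spanX (hecke7_pow n) => m [mn mE]; split; first by rewrite mE.
exact: leq_ltn_trans nq.
Qed.
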